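(* Let $0<T\le\infty$ and let $\xi,\xi_n\in S([0,T])$, $n\ge1$. Let $a<b$ be the endpoints of the maximal interval on which $\tau(\cdot;\xi)$ is finite, and let $a_n<b_n$ be the endpoints of the maximal interval on which $\tau(\cdot;\xi_n)$ is finite, where $-\infty\le a<b\le\infty$ and $-\infty\le a_n<b_n\le\infty$. If $\xi_n\to\xi$ uniformly on $[0,T]$, then $a_n\to a$, $b_n\to b$, and $\tau(x;\xi_n)\to\tau(x;\xi)$ uniformly in $x\in[c,d]$ for any compact interval $[c,d]\subset(a,b)$.
   Context: For $T=\infty$, $[0,T]$ is understood as $[0,\infty)$. A driver is a continuous function $\xi:[0,T]\to\mathbb{R}$. The upwards Loewner flow of $\xi$ in the upper half plane $\mathbb{H}$ is the solution of $\partial_t h_t(z)=\frac{-2}{h_t(z)-\xi(t)}$, $h_0(z)=z$; for $z\in\mathbb{H}$ it exists on all of $[0,T]$. Hitting times: for $x\in\mathbb{R}\setminus\{\xi(0)\}$, let $x(t)=h_t(x;\xi)$ be the real solution of the same ODE started at $x$, and let $\tau(x;\xi):=\inf\{t\ge 0: \liminf_{s\nearrow t}|x(s)-\xi(s)|=0\}$ (with $t\in[0,T]$ and $\inf\emptyset=+\infty$); also $\tau(\xi(0);\xi)=0$. Simple-curve drivers: for $T<\infty$, $S([0,T])$ is the set of continuous $\xi:[0,T]\to\mathbb{R}$ that generate a simple curve, i.e. there is an injective continuous $\gamma:[0,T]\to\mathbb{H}\cup\{\xi(T)\}$ with $\gamma(0)=\xi(T)$ and $\gamma((0,T])\subset\mathbb{H}$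 such that $h_T$ maps $\mathbb{H}$ conformally onto $\mathbb{H}\setminus\gamma((0,T])$. For $T=\infty$, $\xi\in S([0,\infty))$ means $\xi|_{[0,T']}\in S([0,T'])$ for all finite $T'$. Convention: for infinite endpoints, $a_n\to-\infty$ means that for every $N$, $a_n<-N$ for all large $n$ (the value $a_n=-\infty$ being allowed), and similarly for $b_n\to+\infty$. *)

(* Defs.v *)
From Stdlib Require Import Reals.
From Coquelicot Require Import Coquelicot.

Open Scope R_scope.

(** The time horizon is [T : Rbar]; for [T = p_infty] this is [[0, oo)]. *)
Definition time_interval (T : Rbar) (t : R) : Prop :=
  0 <= t /\ Rbar_le t T.

(** Functions on an interval are total functions on [R]; only their values on
    that interval are ever used. *)
Definition is_driver (T : Rbar) (xi : R -> R) : Prop :=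
  continuous_on (time_interval T) xi.

(** [is_derive] with the neighbourhoods of [t] restricted to [D], hence a
    one-sided derivative at an endpoint of [D]. *)
Definition is_derive_within {V : NormedModule R_AbsRing}
    (D : R -> Prop) (f : R -> V) (t : R) (l : V) : Prop :=
  filterdiff f (within D (locally t)) (fun s : R => scal s l).

Definition upper_half_plane (z : C) : Prop := 0 < Im z.

Definition is_loewner_flow (T : Rbar) (xi : R -> R) (h : R -> C -> C) : Prop :=
  forall z : C, upper_half_plane z ->
    h 0 z = z /\
    forall t : R, time_interval T t ->
      upper_half_plane (h t z) /\
      is_derive_within (V := C_R_NormedModule) (time_interval T)
        (fun s => h s z) t (Cdiv (RtoC (-2)) (Cminus (h t z) (RtoC (xi t)))).

Definition conformal_onto (f : C -> C) (U V : C -> Prop) : Prop :=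
  (forall z, U z -> ex_derive (K := C_AbsRing) (V := C_NormedModule) f z) /\
  (forall z w, U z -> U w -> f z = f w -> z = w) /\
  (forall w, V w <-> exists z, U z /\ f z = w).

Definition generates_simple_curve (T : R) (xi : R -> R) : Prop :=
  exists (h : R -> C -> C) (gamma : R -> C),
    is_loewner_flow T xi h /\
    continuous_on (time_interval T) gamma /\
    (forall s t, time_interval T s -> time_interval T t ->
       gamma s = gamma t -> s = t) /\
    gamma 0 = RtoC (xi T) /\
    (forall t, 0 < t <= T -> upper_half_plane (gamma t)) /\
    conformal_onto (h T) upper_half_plane
      (fun w => upper_half_plane w /\
                ~ exists t, 0 < t <= T /\ gamma t = w).

Definition simple_curve_driver_fin (T : R) (xi : R -> R) : Prop :=
  is_driver T xi /\ generates_simple_curve T xi.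

Definition simple_curve_driver (T : Rbar) (xi : R -> R) : Prop :=
  match T with
  | Finite T => simple_curve_driver_fin T xi
  | p_infty => forall T' : R, 0 < T' -> simple_curve_driver_fin T' xi
  | m_infty => False
  end.

(** A real solution on [[0, t)], started at [x] and not meeting the driver
    before time [t]. *)
Definition is_real_solution (xi : R -> R) (x t : R) (u : R -> R) : Prop :=
  u 0 = x /\
  forall s, 0 <= s < t ->
    u s <> xi s /\
    is_derive_within (V := R_NormedModule) (fun r => 0 <= r < t) u s
      (-2 / (u s - xi s)).

(** Lower limit from the left, as the supremum of the eventual lower bounds. *)
Definition LimInf_left (f : R -> R) (t : R) : Rbar :=
  Lub_Rbar (fun m => at_left t (fun s => m <= f s)).

(** Time [0] is left out for [x <> xi 0], since no [s] in the time interval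
    increases to [0].  The solution exists up to the first time it meets the
    driver and not beyond, so the set below has at most one element.  The
    infimum of the empty set is [p_infty]. *)
Definition hitting_time (T : Rbar) (xi : R -> R) (x : R) : Rbar :=
  if Req_EM_T x (xi 0) then Finite 0
  else Glb_Rbar (fun t =>
    0 < t /\ Rbar_le t T /\
    exists u, is_real_solution xi x t u /\
              LimInf_left (fun s => Rabs (u s - xi s)) t = Finite 0).

Definition is_interval (I : R -> Prop) : Prop :=
  forall x y z, I x -> I z -> x <= y <= z -> I y.

Definition maximal_interval (P I : R -> Prop) : Prop :=
  is_interval I /\ (forall x, I x -> P x) /\
  forall J : R -> Prop, is_interval J -> (forall x, J x -> P x) ->
    (forall x, I x -> J x) -> forall x, J x -> I x.

Definition finite_hitting_endpoints
    (T : Rbar) (xi : R -> R) (a b : Rbar) : Prop :=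
  exists I : R -> Prop,
    maximal_interval (fun x => is_finite (hitting_time T xi x)) I /\
    is_glb_Rbar I a /\ is_lub_Rbar I b.

(** Unlike in [is_lim_seq], the terms of the sequence may be infinite. *)
Definition is_lim_Rbar_seq (u : nat -> Rbar) (l : Rbar) : Prop :=
  match l with
  | Finite r => forall eps : posreal, eventually (fun n =>
      Rbar_lt (r - eps) (u n) /\ Rbar_lt (u n) (r + eps))
  | p_infty => forall M : R, eventually (fun n => Rbar_lt M (u n))
  | m_infty => forall M : R, eventually (fun n => Rbar_lt (u n) M)
  end.

Definition converges_uniformly_on
    (D : R -> Prop) (f : nat -> R -> R) (g : R -> R) : Prop :=
  forall eps : posreal, eventually (fun n =>
    forall x, D x -> Rabs (f n x - g x) < eps).

(** Uniform convergence of extended-real functions to a finite limit: the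
    terms are required to be finite on all of [D] from some index on. *)
Definition converges_uniformly_finite_on
    (D : R -> Prop) (f : nat -> R -> Rbar) (g : R -> Rbar) : Prop :=
  (forall x, D x -> is_finite (g x)) /\
  forall eps : posreal, eventually (fun n =>
    forall x, D x -> is_finite (f n x) /\ Rabs (real (f n x) - real (g x)) < eps).

(* Main.v *)
Require Import Defs.
From Stdlib Require Import Reals Lra Lia ClassicalEpsilon.
From Coquelicot Require Import Coquelicot.
Open Scope R_scope.

(** A real point to the right of the driver stays to the right of it until it
    is hit, and moving the driver by at most [r0] while moving the point by more
    than [r0] in the favourable direction delays the hit.  So if two drivers
    differ by at most [r0 < r], the hitting time of [x] for the one lies between
    those of [x - r] and [x + r] for the other.  This gives the convergence of the
    endpoints at once, and it gives uniform convergence of the hitting times on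
    compact intervals as soon as the hitting time of the limit driver is
    continuous.  Lower semicontinuity holds for every continuous driver, by
    continuous dependence on the initial point.  Upper semicontinuity is where
    the simple curve enters ([no_gap], [swallowed_upper_semi]): if a point [x0] is
    hit at time [t0] and all points beyond it survive to a later time [t1], then
    on [[t0, t1]] the flows of these points decrease either to a curve that lies
    off the driver at some time, so that the real points between the two do not
    survive backwards to time [0], or to the driver itself, which is impossible
    because their speed blows up there.

    So it has to be shown that, for a driver that generates a simple curve, every
    real point other than the driver at time [ts <= T] survives backwards to time
    [0] ([backward_survival]).  A point [w] of the upper half plane survives
    backwards from [T] to [0] if and only if it is not on the curve.  The points
    that are swallowed between [T] and [t] form an initial piece of the curve
    ([swallowed_initial]): a separate compact piece would be surrounded by
    surviving points, and the imaginary part of the backward flow, being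
    harmonic, cannot vanish inside without vanishing on the boundary.  As points
    swallowed shortly before [ts] are close to the driver, and there always are
    such points, the swallowed set of time [ts] accumulates on the real axis only
    at the driver ([alive_near_real]).  Therefore, if a real point [p] other than
    the driver did not survive, there would be a rectangle of surviving points
    standing on the real axis around [p].  This is excluded by
    [surviving_stretch_avoids_driver].  By the boundary estimate [hopf], imaginary
    parts over the rectangle shrink at most by a constant factor, so the backward
    flow distorts distances at most by a constant factor; but then a fine grid of
    points just above the real axis cannot let the driver pass, because its
    nearest points would be pushed too strongly.

    No complex analysis is presupposed.  Harmonicity is used in the form
    [four_point], obtained from the differential equation by Gronwall's
    inequality, and it enters through the comparison of the imaginary part with
    quadratic polynomials ([min_principle]).  Solutions of the complex and of the
    real equation come from one Picard iteration for a planar system. *)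

(** * Calculus on a closed interval *)

(** [auto_derive] leaves [Derive] terms for abstract functions. *)
Ltac use_derive H :=
  match goal with
  | |- context [Derive ?f ?x] => rewrite (is_derive_unique f x _ H)
  end.

Lemma is_derive_continuity_pt (f : R -> R) (x l : R) :
  is_derive f x l -> continuity_pt f x.
Proof.
  intros H. apply continuity_pt_filterlim.
  apply (ex_derive_continuous (V := R_NormedModule)). now exists l.
Qed.

Lemma exp_increasing_le (x y : R) : x <= y -> exp x <= exp y.
Proof. intros [H| ->]; [left; now apply exp_increasing|apply Rle_refl]. Qed.

Lemma mvt_le (f f' : R -> R) (a b M : R) :
  a <= b ->
  (forall s, a <= s <= b -> is_derive f s (f' s)) ->
  (forall s, a <= s <= b -> f' s <= M) ->
  f b - f a <= M * (b - a).
Proof.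
  intros Hab Hd Hle.
  destruct (MVT_gen f a b f') as [c [Hc Heq]].
  - intros x. rewrite Rmin_left, Rmax_right by lra. intros Hx. apply Hd. lra.
  - intros x. rewrite Rmin_left, Rmax_right by lra. intros Hx.
    eapply is_derive_continuity_pt, Hd. lra.
  - rewrite Rmin_left, Rmax_right in Hc by lra.
    rewrite Heq. apply Rmult_le_compat_r; [lra|]. now apply Hle.
Qed.

Lemma mvt_ge (f f' : R -> R) (a b m : R) :
  a <= b ->
  (forall s, a <= s <= b -> is_derive f s (f' s)) ->
  (forall s, a <= s <= b -> m <= f' s) ->
  m * (b - a) <= f b - f a.
Proof.
  intros Hab Hd Hle.
  assert (H : - f b - - f a <= - m * (b - a)).
  { apply (mvt_le (fun s => - f s) (fun s => - f' s)); [lra| |].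
    - intros s Hs. apply (is_derive_opp (V := R_NormedModule)). now apply Hd.
    - intros s Hs. generalize (Hle s Hs). lra. }
  lra.
Qed.

(** [first_zero] and [last_zero] are the continuity arguments by which an
    estimate that improves itself as long as it holds is shown to hold
    throughout. *)
Lemma first_zero (f : R -> R) (a b : R) :
  a <= b -> (forall s, a <= s <= b -> continuity_pt f s) ->
  0 < f a -> f b <= 0 ->
  exists z, a < z <= b /\ f z = 0 /\ forall s, a <= s < z -> 0 < f s.
Proof.
  intros Hab Hc Ha Hb.
  set (E := fun z => a <= z <= b /\ forall s, a <= s <= z -> 0 < f s).
  assert (HEa : E a).
  { split; [lra|]. intros s Hs. now replace s with a by lra. }
  destruct (completeness E) as [z [Hub Hlub]].
  { exists b. intros x [Hx _]. lra. }
  { now exists a. }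
  assert (Haz : a <= z) by now apply Hub.
  assert (Hzb : z <= b) by (apply Hlub; intros x [Hx _]; lra).
  assert (Hpos : forall s, a <= s < z -> 0 < f s).
  { intros s Hs. destruct (classic (exists y, E y /\ s < y)) as [[y [[_ Hy] Hsy]]|Hn].
    - apply Hy. lra.
    - exfalso. assert (z <= s); [|lra]. apply Hlub. intros y Hy.
      destruct (Rle_lt_dec y s); [easy|]. exfalso. apply Hn. now exists y. }
  assert (Hz : f z <= 0).
  { destruct (Rle_lt_dec (f z) 0) as [H|H]; [easy|exfalso].
    assert (z < b) by (destruct Hzb; [easy|subst; lra]).
    destruct (Hc z (conj Haz Hzb) (f z) H) as [d [Hd Hdl]].
    set (z' := Rmin (z + d / 2) b).
    assert (Hz' : z < z' <= b /\ z' <= z + d / 2).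
    { unfold z'. split; [split|]; [apply Rmin_glb_lt; lra|apply Rmin_r|apply Rmin_l]. }
    assert (E z').
    { split; [lra|]. intros s Hs.
      destruct (Rlt_le_dec s z) as [Hsz|Hsz]; [apply Hpos; lra|].
      destruct (Req_dec z s) as [<-|Hne]; [easy|].
      assert (HR : Rabs (f s - f z) < f z).
      { apply (Hdl s). split; [split; [exact I|lra]|]. simpl. unfold R_dist.
        rewrite Rabs_right; lra. }
      apply Rabs_def2 in HR. lra. }
    generalize (Hub z' H1). lra. }
  assert (Haz' : a < z) by (destruct Haz as [Haz|Haz]; [easy|subst; lra]).
  exists z. split; [lra|]. split; [|easy].
  destruct Hz as [Hz|Hz]; [exfalso|easy].
  destruct (Hc z (conj Haz Hzb) (- f z)) as [d [Hd Hdl]]; [lra|].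
  set (z' := Rmax (z - d / 2) a).
  assert (Hz' : a <= z' < z /\ z - d / 2 <= z').
  { unfold z'. split; [split|]; [apply Rmax_r|apply Rmax_lub_lt; lra|apply Rmax_l]. }
  assert (HR : Rabs (f z' - f z) < - f z).
  { apply (Hdl z'). split; [split; [exact I|lra]|]. simpl. unfold R_dist.
    rewrite Rabs_left; lra. }
  apply Rabs_def2 in HR. generalize (Hpos z'). lra.
Qed.

Lemma last_zero (f : R -> R) (a b : R) :
  a <= b -> (forall s, a <= s <= b -> continuity_pt f s) ->
  f a <= 0 -> 0 < f b ->
  exists z, a <= z < b /\ f z = 0 /\ forall s, z < s <= b -> 0 < f s.
Proof.
  intros Hab Hc Ha Hb.
  destruct (first_zero (fun s => f (- s)) (- b) (- a)) as [z [Hz [Hz0 Hzp]]].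
  - lra.
  - intros s Hs. apply (continuity_pt_comp Ropp f).
    + apply continuity_pt_opp, continuity_pt_id.
    + apply Hc. lra.
  - now rewrite Ropp_involutive.
  - now rewrite Ropp_involutive.
  - exists (- z). split; [lra|]. split; [easy|].
    intros s Hs. rewrite <- (Ropp_involutive s). apply Hzp. lra.
Qed.

(** Gronwall's inequality; the additive constant [E] is absorbed into the
    unknown, which is why the exponent is asked to be at least [1]. *)
Lemma gronwall (phi phi' : R -> R) (a b K E : R) :
  a <= b -> 1 <= K -> 0 <= E ->
  (forall s, a <= s <= b -> is_derive phi s (phi' s)) ->
  (forall s, a <= s <= b -> phi' s <= K * phi s + E) ->
  phi b <= (phi a + E) * exp (K * (b - a)).
Proof.
  intros Hab HK HE Hd Hle.
  assert (H : (phi b + E) * exp (- K * b) - (phi a + E) * exp (- K * a) <= 0 * (b - a)).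
  { apply (mvt_le (fun s => (phi s + E) * exp (- K * s))
      (fun s => phi' s * exp (- K * s) + (phi s + E) * (- K * exp (- K * s)))).
    - easy.
    - intros s Hs. specialize (Hd s Hs). auto_derive.
      + now exists (phi' s).
      + use_derive Hd. ring.
    - intros s Hs. specialize (Hle s Hs).
      assert (Hp := exp_pos (- K * s)).
      replace (_ + _) with ((phi' s - (K * phi s + K * E)) * exp (- K * s)) by ring.
      assert (phi' s - (K * phi s + K * E) <= 0) by nra. nra. }
  assert (H1 : (phi b + E) * exp (- K * b) <= (phi a + E) * exp (- K * a)) by lra.
  apply (Rmult_le_compat_r (exp (K * b))) in H1; [|left; apply exp_pos].
  rewrite 2!Rmult_assoc, <- 2!exp_plus in H1.
  replace (- K * b + K * b) with 0 in H1 by ring.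
  replace (- K * a + K * b) with (K * (b - a)) in H1 by ring.
  rewrite exp_0 in H1. lra.
Qed.

(** * Picard iteration for a planar system

    The vector field is bounded and globally Lipschitz, so that the solution
    exists on the whole line; the Loewner equation is reduced to this case by
    truncating its vector field away from the driver. *)

Lemma is_derive_RInt_cont (h : R -> R) (t0 t : R) :
  (forall s, continuous h s) -> is_derive (fun t => RInt h t0 t) t (h t).
Proof.
  intros Hc. apply (is_derive_RInt (V := R_NormedModule) h _ t0); [|apply Hc].
  apply filter_forall. intros b.
  apply (RInt_correct (V := R_CompleteNormedModule)).
  apply ex_RInt_continuous. intros; apply Hc.
Qed.

Lemma RInt_exp_bound (h : R -> R) (t0 t c K : R) :
  0 < c -> (forall s, continuous h s) ->
  (forall s, Rabs (h s) <= K * exp (c * Rabs (s - t0))) ->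
  Rabs (RInt h t0 t) <= K / c * exp (c * Rabs (t - t0)).
Proof.
  intros Hc0 Hc Hb.
  assert (HK : 0 <= K / c).
  { apply Rdiv_le_0_compat; [|easy].
    generalize (Hb t0) (Rabs_pos (h t0)). rewrite Rminus_diag, Rabs_R0, Rmult_0_r, exp_0. lra. }
  assert (HI : forall I : R -> R, I t0 = 0 -> (forall s, is_derive I s (h s)) ->
    Rabs (I t) <= K / c * exp (c * Rabs (t - t0))).
  2: { apply HI; [apply (RInt_point (V := R_CompleteNormedModule))|].
       intros s. now apply is_derive_RInt_cont. }
  intros I H0 Hd.
  destruct (Rle_lt_dec t0 t) as [Ht|Ht].
  - rewrite (Rabs_right (t - t0)) by lra.
    assert (Hb' : forall s, t0 <= s <= t -> - (K * exp (c * (s - t0))) <= h s <= K * exp (c * (s - t0))).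
    { intros s Hs. apply Rabs_le_between. generalize (Hb s). now rewrite (Rabs_right (s - t0)) by lra. }
    assert (E1 : forall e s, is_derive (fun s => I s - e * (K / c) * exp (c * (s - t0))) s
        (h s - e * (K * exp (c * (s - t0))))).
    { intros e s. specialize (Hd s). auto_derive.
      - exists (h s); exact Hd.
      - use_derive Hd. unfold Rminus. field. lra. }
    apply Rabs_le. split.
    + generalize (mvt_ge _ _ t0 t 0 Ht (fun s _ => E1 (-1) s)).
      rewrite H0, Rminus_diag, Rmult_0_r, exp_0. intros H.
      assert (H' := H (fun s Hs => ltac:(generalize (Hb' s Hs); lra))). lra.
    + generalize (mvt_le _ _ t0 t 0 Ht (fun s _ => E1 1 s)).
      rewrite H0, Rminus_diag, Rmult_0_r, exp_0. intros H.
      assert (H' := H (fun s Hs => ltac:(generalize (Hb' s Hs); lra))). lra.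
  - rewrite (Rabs_left (t - t0)) by lra.
    assert (Hb' : forall s, t <= s <= t0 -> - (K * exp (c * - (s - t0))) <= h s <= K * exp (c * - (s - t0))).
    { intros s Hs. apply Rabs_le_between. generalize (Hb s). now rewrite (Rabs_left1 (s - t0)) by lra. }
    assert (E1 : forall e s, is_derive (fun s => I s - e * (K / c) * exp (c * - (s - t0))) s
        (h s + e * (K * exp (c * - (s - t0))))).
    { intros e s. specialize (Hd s). auto_derive.
      - exists (h s); exact Hd.
      - use_derive Hd. unfold Rminus. field. lra. }
    assert (Ht' : t <= t0) by lra.
    apply Rabs_le. split.
    + generalize (mvt_le _ _ t t0 0 Ht' (fun s _ => E1 (-1) s)).
      rewrite H0, Rminus_diag, Ropp_0, Rmult_0_r, exp_0. intros H.
      assert (H' := H (fun s Hs => ltac:(generalize (Hb' s Hs); lra))). lra.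
    + generalize (mvt_ge _ _ t t0 0 Ht' (fun s _ => E1 1 s)).
      rewrite H0, Rminus_diag, Ropp_0, Rmult_0_r, exp_0. intros H.
      assert (H' := H (fun s Hs => ltac:(generalize (Hb' s Hs); lra))). lra.
Qed.

Lemma lipschitz_continuous (u : R -> R) (B : R) :
  (forall s t, Rabs (u t - u s) <= B * Rabs (t - s)) -> forall s, continuous u s.
Proof.
  intros H s. apply continuity_pt_filterlim. intros eps Heps.
  assert (HB : 0 <= B).
  { generalize (H 0 1) (Rabs_pos (u 1 - u 0)). rewrite Rminus_0_r, Rabs_R1. lra. }
  exists (eps / (B + 1)). split; [apply Rdiv_lt_0_compat; lra|].
  intros x [_ Hx]. simpl in *. unfold R_dist in *.
  apply Rle_lt_trans with (1 := H s x).
  apply Rle_lt_trans with ((B + 1) * Rabs (x - s)).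
  - generalize (Rabs_pos (x - s)). nra.
  - apply (Rmult_lt_compat_l (B + 1)) in Hx; [|lra].
    replace ((B + 1) * (eps / (B + 1))) with eps in Hx; [easy|field; lra].
Qed.

Section Picard.

Variables (f g : R -> R -> R -> R) (L B t0 x0 y0 : R).
Hypothesis HL : 0 < L.
Hypothesis Hfc : forall u v : R -> R, (forall s, continuous u s) -> (forall s, continuous v s) ->
  forall s, continuous (fun s => f s (u s) (v s)) s.
Hypothesis Hgc : forall u v : R -> R, (forall s, continuous u s) -> (forall s, continuous v s) ->
  forall s, continuous (fun s => g s (u s) (v s)) s.
Hypothesis Hfb : forall s x y, Rabs (f s x y) <= B.
Hypothesis Hgb : forall s x y, Rabs (g s x y) <= B.
Hypothesis Hfl : forall s x y x' y',
  Rabs (f s x y - f s x' y') <= L * (Rabs (x - x') + Rabs (y - y')).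
Hypothesis Hgl : forall s x y x' y',
  Rabs (g s x y - g s x' y') <= L * (Rabs (x - x') + Rabs (y - y')).

Fixpoint picard (n : nat) : (R -> R) * (R -> R) :=
  match n with
  | O => (fun _ => x0, fun _ => y0)
  | S n =>
      let u := fst (picard n) in
      let v := snd (picard n) in
      (fun t => x0 + RInt (fun s => f s (u s) (v s)) t0 t,
       fun t => y0 + RInt (fun s => g s (u s) (v s)) t0 t)
  end.

Lemma primitive_lipschitz (h : R -> R) (c s t : R) :
  (forall s, continuous h s) -> (forall s, Rabs (h s) <= B) ->
  Rabs ((c + RInt h t0 t) - (c + RInt h t0 s)) <= B * Rabs (t - s).
Proof.
  intros Hc Hb.
  assert (Hd : forall s, is_derive (fun t => c + RInt h t0 t) s (h s)).
  { intros r. replace (h r) with (0 + h r) by ring.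
    apply (is_derive_plus (V := R_NormedModule) (fun _ => c)); [apply is_derive_Reals, derivable_pt_lim_const|].
    now apply is_derive_RInt_cont. }
  assert (Hb' : forall s, - B <= h s <= B) by (intros r; now apply Rabs_le_between).
  destruct (Rle_lt_dec s t) as [Ht|Ht].
  - rewrite (Rabs_right (t - s)) by lra. apply Rabs_le. split.
    + generalize (mvt_ge _ h s t (- B) Ht (fun r _ => Hd r) (fun r _ => proj1 (Hb' r))). lra.
    + generalize (mvt_le _ h s t B Ht (fun r _ => Hd r) (fun r _ => proj2 (Hb' r))). lra.
  - rewrite (Rabs_left (t - s)) by lra. apply Rabs_le.
    assert (Ht' : t <= s) by lra. split.
    + generalize (mvt_le _ h t s B Ht' (fun r _ => Hd r) (fun r _ => proj2 (Hb' r))). lra.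
    + generalize (mvt_ge _ h t s (- B) Ht' (fun r _ => Hd r) (fun r _ => proj1 (Hb' r))). lra.
Qed.

Lemma picard_cont (n : nat) :
  (forall s, continuous (fst (picard n)) s) /\ (forall s, continuous (snd (picard n)) s).
Proof.
  induction n as [|n [IHu IHv]]; simpl.
  - split; intros s; apply continuous_const.
  - split; apply (lipschitz_continuous _ B); intros s t; apply primitive_lipschitz; auto.
Qed.

Lemma picard_lipschitz (n : nat) (s t : R) :
  Rabs (fst (picard n) t - fst (picard n) s) <= B * Rabs (t - s) /\
  Rabs (snd (picard n) t - snd (picard n) s) <= B * Rabs (t - s).
Proof.
  destruct n as [|n]; simpl.
  - assert (0 <= B) by (generalize (Hfb 0 0 0) (Rabs_pos (f 0 0 0)); lra).
    generalize (Rabs_pos (t - s)).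
    rewrite 2!Rminus_diag, Rabs_R0. split; nra.
  - destruct (picard_cont n). split; apply primitive_lipschitz; auto.
Qed.

Lemma RInt_lip_bound (F : R -> R -> R -> R) (u v u' v' : R -> R) (K t : R) :
  (forall s x y x' y', Rabs (F s x y - F s x' y') <= L * (Rabs (x - x') + Rabs (y - y'))) ->
  (forall s, continuous (fun s => F s (u s) (v s)) s) ->
  (forall s, continuous (fun s => F s (u' s) (v' s)) s) ->
  (forall s, Rabs (u s - u' s) + Rabs (v s - v' s) <= K * exp (4 * L * Rabs (s - t0))) ->
  Rabs (RInt (fun s => F s (u s) (v s)) t0 t - RInt (fun s => F s (u' s) (v' s)) t0 t)
  <= K / 4 * exp (4 * L * Rabs (t - t0)).
Proof.
  intros HF Hc Hc' Hd.
  rewrite <- (RInt_minus (V := R_CompleteNormedModule));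
    try (apply ex_RInt_continuous; intros; auto).
  replace (K / 4) with (L * K / (4 * L)) by (field; lra).
  apply (RInt_exp_bound (fun s => F s (u s) (v s) - F s (u' s) (v' s))).
  - lra.
  - intros s. apply (continuous_minus (V := R_NormedModule)); auto.
  - intros s. eapply Rle_trans; [apply HF|]. rewrite Rmult_assoc.
    apply Rmult_le_compat_l; [lra|apply Hd].
Qed.

Definition picard_gap : R := B / (2 * L).

(** The weight [exp (4 L |t - t0|)] makes the iteration contract by a factor
    [1/2] on the whole line at once: integration divides it by [4 L], and two
    coordinates contribute. *)
Lemma picard_step (n : nat) (t : R) :
  Rabs (fst (picard (S n)) t - fst (picard n) t) +
  Rabs (snd (picard (S n)) t - snd (picard n) t)
  <= picard_gap * (/ 2) ^ n * exp (4 * L * Rabs (t - t0)).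
Proof.
  revert t. induction n as [|n IH]; intros t.
  - simpl. rewrite Rmult_1_r.
    assert (H : forall F : R -> R -> R -> R, (forall s x y, Rabs (F s x y) <= B) ->
      (forall s, continuous (fun s => F s x0 y0) s) -> forall c,
      Rabs (c + RInt (fun s => F s x0 y0) t0 t - c) <= B / (4 * L) * exp (4 * L * Rabs (t - t0))).
    { intros F HF Hc c. rewrite Rplus_minus_l.
      apply RInt_exp_bound; [lra|easy|].
      intros s. apply Rle_trans with (1 := HF s x0 y0).
      assert (0 <= B) by (generalize (Hfb 0 0 0) (Rabs_pos (f 0 0 0)); lra).
      assert (1 <= exp (4 * L * Rabs (s - t0))).
      { rewrite <- exp_0. apply exp_increasing_le. generalize (Rabs_pos (s - t0)). nra. }
      nra. }
    assert (H1 := H f Hfb (Hfc _ _ (fun s => continuous_const x0 s) (fun s => continuous_const y0 s)) x0).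
    assert (H2 := H g Hgb (Hgc _ _ (fun s => continuous_const x0 s) (fun s => continuous_const y0 s)) y0).
    replace picard_gap with (B / (4 * L) + B / (4 * L)) by (unfold picard_gap; field; lra).
    lra.
  - destruct (picard_cont n) as [Cu Cv]. destruct (picard_cont (S n)) as [Cu' Cv'].
    change (picard (S (S n))) with
      ((fun t => x0 + RInt (fun s => f s (fst (picard (S n)) s) (snd (picard (S n)) s)) t0 t,
       fun t => y0 + RInt (fun s => g s (fst (picard (S n)) s) (snd (picard (S n)) s)) t0 t)).
    assert (E : forall F c, (forall s x y x' y', Rabs (F s x y - F s x' y') <= L * (Rabs (x - x') + Rabs (y - y'))) ->
      (forall u v : R -> R, (forall s, continuous u s) -> (forall s, continuous v s) ->
       forall s, continuous (fun s => F s (u s) (v s)) s) ->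
      Rabs (c + RInt (fun s => F s (fst (picard (S n)) s) (snd (picard (S n)) s)) t0 t -
            (c + RInt (fun s => F s (fst (picard n) s) (snd (picard n) s)) t0 t))
      <= picard_gap * (/ 2) ^ n / 4 * exp (4 * L * Rabs (t - t0))).
    { intros F c HF HFc.
      rewrite Rminus_plus_l_l.
      apply RInt_lip_bound; auto. }
    assert (E1 := E f x0 Hfl Hfc). assert (E2 := E g y0 Hgl Hgc).
    change (fst (picard (S n)) t) with (x0 + RInt (fun s => f s (fst (picard n) s) (snd (picard n) s)) t0 t).
    change (snd (picard (S n)) t) with (y0 + RInt (fun s => g s (fst (picard n) s) (snd (picard n) s)) t0 t).
    cbv beta iota delta [fst snd] in E1, E2 |- *.
    rewrite <- tech_pow_Rmult. lra.
Qed.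

Lemma geometric_cauchy (a : nat -> R) (A : R) :
  (forall n, Rabs (a (S n) - a n) <= A * (/ 2) ^ n) ->
  exists l : R, is_lim_seq a l /\ forall n, Rabs (l - a n) <= 2 * A * (/ 2) ^ n.
Proof.
  intros H.
  assert (HA : 0 <= A).
  { generalize (H 0%nat) (Rabs_pos (a 1%nat - a 0%nat)). simpl. lra. }
  assert (Hq : forall n, 0 < (/ 2) ^ n) by (intros n; apply pow_lt; lra).
  assert (H2 : forall n k, Rabs (a (n + k)%nat - a n) <= 2 * A * (/ 2) ^ n - 2 * A * (/ 2) ^ (n + k)).
  { intros n k. induction k as [|k IH].
    - rewrite Nat.add_0_r, !Rminus_diag, Rabs_R0. lra.
    - rewrite Nat.add_succ_r.
      replace (a (S (n + k)) - a n) with ((a (S (n + k)) - a (n + k)%nat) + (a (n + k)%nat - a n)) by ring.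
      eapply Rle_trans; [apply Rabs_triang|].
      generalize (H (n + k)%nat). rewrite <- (tech_pow_Rmult (/ 2) (n + k)).
      lra. }
  assert (H3 : forall n m, (n <= m)%nat -> Rabs (a m - a n) <= 2 * A * (/ 2) ^ n).
  { intros n m Hnm. replace m with (n + (m - n))%nat by lia.
    generalize (H2 n (m - n)%nat) (Hq (n + (m - n))%nat). nra. }
  assert (HC : ex_finite_lim_seq a).
  { apply ex_lim_seq_cauchy_corr. intros eps.
    assert (HG : is_lim_seq (fun n => 4 * A * (/ 2) ^ n) 0).
    { replace (Finite 0) with (Rbar_mult (4 * A) 0) by (simpl; f_equal; ring).
      apply is_lim_seq_scal_l, is_lim_seq_geom. rewrite Rabs_right; lra. }
    apply is_lim_seq_spec in HG. destruct (HG eps) as [N HN].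
    exists N. intros n m Hn Hm.
    generalize (H3 N n Hn) (H3 N m Hm). intros A1 A2.
    specialize (HN N (le_n N)). rewrite Rminus_0_r in HN.
    apply Rle_lt_trans with (4 * A * (/ 2) ^ N).
    - replace (a n - a m) with ((a n - a N) + - (a m - a N)) by ring.
      eapply Rle_trans; [apply Rabs_triang|]. rewrite Rabs_Ropp. lra.
    - eapply Rle_lt_trans; [apply Rle_abs|apply HN]. }
  destruct HC as [l Hl]. exists l. split; [easy|].
  intros n.
  apply (is_lim_seq_le_loc (fun m => Rabs (a m - a n)) (fun _ => 2 * A * (/ 2) ^ n)
    (Rabs (l - a n)) (2 * A * (/ 2) ^ n)).
  - exists n. intros m Hm. now apply H3.
  - apply (is_lim_seq_abs _ (l - a n)). apply is_lim_seq_minus'; [easy|apply is_lim_seq_const].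
  - apply is_lim_seq_const.
Qed.

Lemma le_of_geometric (x K : R) : (forall n, x <= K * (/ 2) ^ n) -> x <= 0.
Proof.
  intros H.
  apply (is_lim_seq_le (fun _ => x) (fun n => K * (/ 2) ^ n) x 0 H).
  - apply is_lim_seq_const.
  - replace (Finite 0) with (Rbar_mult K 0) by (simpl; f_equal; ring).
    apply is_lim_seq_scal_l, is_lim_seq_geom. rewrite Rabs_right; lra.
Qed.

Lemma picard_solution : exists u v : R -> R,
  u t0 = x0 /\ v t0 = y0 /\
  forall t, is_derive u t (f t (u t) (v t)) /\ is_derive v t (g t (u t) (v t)).
Proof.
  set (A := fun t => picard_gap * exp (4 * L * Rabs (t - t0))).
  assert (Hu : forall t, exists l : R, is_lim_seq (fun n => fst (picard n) t) l /\
     forall n, Rabs (l - fst (picard n) t) <= 2 * A t * (/ 2) ^ n).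
  { intros t. apply geometric_cauchy. intros n. unfold A.
    generalize (picard_step n t) (Rabs_pos (snd (picard (S n)) t - snd (picard n) t)). lra. }
  assert (Hv : forall t, exists l : R, is_lim_seq (fun n => snd (picard n) t) l /\
     forall n, Rabs (l - snd (picard n) t) <= 2 * A t * (/ 2) ^ n).
  { intros t. apply geometric_cauchy. intros n. unfold A.
    generalize (picard_step n t) (Rabs_pos (fst (picard (S n)) t - fst (picard n) t)). lra. }
  set (u := fun t => proj1_sig (constructive_indefinite_description _ (Hu t))).
  set (v := fun t => proj1_sig (constructive_indefinite_description _ (Hv t))).
  assert (Hu1 : forall t, is_lim_seq (fun n => fst (picard n) t) (u t)).
  { intros t. apply (proj2_sig (constructive_indefinite_description _ (Hu t))). }
  assert (Hu2 : forall t n, Rabs (u t - fst (picard n) t) <= 2 * A t * (/ 2) ^ n).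
  { intros t. apply (proj2_sig (constructive_indefinite_description _ (Hu t))). }
  assert (Hv1 : forall t, is_lim_seq (fun n => snd (picard n) t) (v t)).
  { intros t. apply (proj2_sig (constructive_indefinite_description _ (Hv t))). }
  assert (Hv2 : forall t n, Rabs (v t - snd (picard n) t) <= 2 * A t * (/ 2) ^ n).
  { intros t. apply (proj2_sig (constructive_indefinite_description _ (Hv t))). }
  clearbody u v.
  assert (Lim : forall (w : R -> R) (wn : nat -> R -> R), (forall t, is_lim_seq (fun n => wn n t) (w t)) ->
     (forall n s t, Rabs (wn n t - wn n s) <= B * Rabs (t - s)) -> forall s, continuous w s).
  { intros w wn Hw Hl. apply (lipschitz_continuous _ B). intros s t.
    apply (is_lim_seq_le (fun n => Rabs (wn n t - wn n s)) (fun _ => B * Rabs (t - s))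
      (Rabs (w t - w s)) (B * Rabs (t - s))).
    - intros n; apply Hl.
    - apply (is_lim_seq_abs _ (w t - w s)). apply is_lim_seq_minus'; apply Hw.
    - apply is_lim_seq_const. }
  assert (Cu : forall s, continuous u s).
  { apply (Lim u (fun n => fst (picard n))); [easy|]. intros n s t. apply picard_lipschitz. }
  assert (Cv : forall s, continuous v s).
  { apply (Lim v (fun n => snd (picard n))); [easy|]. intros n s t. apply picard_lipschitz. }
  assert (E : forall F c (w : R -> R) (wn : nat -> R -> R),
      (forall s x y x' y', Rabs (F s x y - F s x' y') <= L * (Rabs (x - x') + Rabs (y - y'))) ->
      (forall u v : R -> R, (forall s, continuous u s) -> (forall s, continuous v s) ->
       forall s, continuous (fun s => F s (u s) (v s)) s) ->
      (forall n t, wn (S n) t = c + RInt (fun s => F s (fst (picard n) s) (snd (picard n) s)) t0 t) ->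
      (forall t n, Rabs (w t - wn n t) <= 2 * A t * (/ 2) ^ n) ->
      forall t, w t = c + RInt (fun s => F s (u s) (v s)) t0 t).
  { intros F c w wn HF HFc Hwn Hw t.
    apply Rminus_diag_uniq, Rabs_eq_0, Rle_antisym; [|apply Rabs_pos].
    apply (le_of_geometric _ (2 * A t)). intros n.
    replace (w t - (c + RInt (fun s => F s (u s) (v s)) t0 t)) with ((w t - wn (S n) t) +
     (RInt (fun s => F s (fst (picard n) s) (snd (picard n) s)) t0 t
      - RInt (fun s => F s (u s) (v s)) t0 t)) by (rewrite Hwn; ring).
    eapply Rle_trans; [apply Rabs_triang|].
    destruct (picard_cont n) as [Pu Pv].
    assert (E1 : Rabs (RInt (fun s => F s (fst (picard n) s) (snd (picard n) s)) t0 t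
      - RInt (fun s => F s (u s) (v s)) t0 t) <=
        4 * picard_gap * (/ 2) ^ n / 4 * exp (4 * L * Rabs (t - t0))).
    { apply RInt_lip_bound; auto. intros s.
      rewrite (Rabs_minus_sym _ (u s)), (Rabs_minus_sym _ (v s)).
      generalize (Hu2 s n) (Hv2 s n). unfold A. lra. }
    generalize (Hw t (S n)). rewrite <- tech_pow_Rmult. unfold A in *. lra. }
  assert (Eu := E f x0 u (fun n => fst (picard n)) Hfl Hfc (fun n t => eq_refl) Hu2).
  assert (Ev := E g y0 v (fun n => snd (picard n)) Hgl Hgc (fun n t => eq_refl) Hv2).
  assert (D : forall F c (w : R -> R),
      (forall u v : R -> R, (forall s, continuous u s) -> (forall s, continuous v s) ->
       forall s, continuous (fun s => F s (u s) (v s)) s) ->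
      (forall t, w t = c + RInt (fun s => F s (u s) (v s)) t0 t) ->
      w t0 = c /\ forall t, is_derive w t (F t (u t) (v t))).
  { intros F c w HF Hw. split.
    - rewrite Hw. rewrite (RInt_point (V := R_CompleteNormedModule)). apply Rplus_0_r.
    - intros t. apply (is_derive_ext (fun t => c + RInt (fun s => F s (u s) (v s)) t0 t)).
      { intros s; now rewrite Hw. }
      replace (F t (u t) (v t)) with (0 + F t (u t) (v t)) by ring.
      apply (is_derive_plus (V := R_NormedModule) (fun _ => c)); [apply is_derive_Reals, derivable_pt_lim_const|].
      exact (is_derive_RInt_cont (fun s => F s (u s) (v s)) t0 t (HF u v Cu Cv)). }
  destruct (D f x0 u Hfc Eu) as [U0 U1]. destruct (D g y0 v Hgc Ev) as [V0 V1].
  exists u, v. split; [easy|]. split; [easy|]. intros t. now split; [apply U1|apply V1].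
Qed.

End Picard.

(** * Complex-valued solutions of the Loewner equation *)

(** Differentiability is asked of the two coordinates, so that real calculus
    applies to them directly. *)
Definition cderive (f : R -> C) (t : R) (l : C) : Prop :=
  is_derive (fun s => fst (f s)) t (fst l) /\ is_derive (fun s => snd (f s)) t (snd l).

Lemma cderive_minus (f g : R -> C) (t : R) (l m : C) :
  cderive f t l -> cderive g t m -> cderive (fun s => f s - g s)%C t (l - m)%C.
Proof.
  intros [H1 H2] [H3 H4]. split; simpl.
  - now apply (is_derive_minus (V := R_NormedModule) (fun s => fst (f s)) (fun s => fst (g s))).
  - now apply (is_derive_minus (V := R_NormedModule) (fun s => snd (f s)) (fun s => snd (g s))).
Qed.

Lemma cderive_plus (f g : R -> C) (t : R) (l m : C) :
  cderive f t l -> cderive g t m -> cderive (fun s => f s + g s)%C t (l + m)%C.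
Proof.
  intros [H1 H2] [H3 H4]. split; simpl.
  - now apply (is_derive_plus (V := R_NormedModule) (fun s => fst (f s)) (fun s => fst (g s))).
  - now apply (is_derive_plus (V := R_NormedModule) (fun s => snd (f s)) (fun s => snd (g s))).
Qed.

Lemma cderive_scal (f : R -> C) (c : C) (t : R) (l : C) :
  cderive f t l -> cderive (fun s => c * f s)%C t (c * l)%C.
Proof.
  intros [H1 H2]. split; simpl.
  - apply (is_derive_minus (V := R_NormedModule) (fun s => fst c * fst (f s)) (fun s => snd c * snd (f s)));
      now apply (is_derive_scal (fun s => _ (f s))).
  - apply (is_derive_plus (V := R_NormedModule) (fun s => fst c * snd (f s)) (fun s => snd c * fst (f s)));
      now apply (is_derive_scal (fun s => _ (f s))).
Qed.

Lemma cderive_reflect (f : R -> C) (t : R) (l : C) :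
  cderive f (- t) l -> cderive (fun s => f (- s)) t (- l)%C.
Proof.
  assert (H : forall (u : R -> R) m, is_derive u (- t) m -> is_derive (fun s => u (- s)) t (- m)).
  { intros u m Hu. replace (- m) with (-1 * m) by ring.
    apply (is_derive_comp (V := R_NormedModule) u Ropp); [easy|].
    replace (-1) with (- 1) by ring.
    apply (is_derive_opp (V := R_NormedModule) (fun x => x)), is_derive_Reals, derivable_pt_lim_id. }
  intros [H1 H2]. split; simpl; now apply (H (fun s => _ (f s))).
Qed.

Lemma Cmod_sq (z : C) : Cmod z ^ 2 = fst z ^ 2 + snd z ^ 2.
Proof. unfold Cmod. apply pow2_sqrt. nra. Qed.

Lemma sq_le (x r : R) : 0 <= r -> x ^ 2 <= r ^ 2 -> x <= r.
Proof. intros. nra. Qed.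

Lemma is_derive_sum_sq (u v : R -> R) (s l m : R) : is_derive u s l -> is_derive v s m ->
  is_derive (fun s => u s ^ 2 + v s ^ 2) s (2 * (u s * l + v s * m)).
Proof.
  intros Hu Hv. auto_derive.
  - split; [now exists l|]. split; [now exists m|easy].
  - use_derive Hu. use_derive Hv. ring.
Qed.

(** Gronwall's inequality for the squared modulus, which unlike the modulus is
    differentiable at zeros of [f]. *)
Lemma cgronwall_fwd (f f' : R -> C) (a b L B : R) :
  a <= b -> 0 <= L -> 0 <= B ->
  (forall s, a <= s <= b -> cderive f s (f' s)) ->
  (forall s, a <= s <= b -> Cmod (f' s) <= L * Cmod (f s) + B) ->
  Cmod (f b) ^ 2 <= (Cmod (f a) ^ 2 + B ^ 2) * exp ((2 * L + 1) * (b - a)).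
Proof.
  intros Hab HL HB Hd Hb.
  assert (H := gronwall (fun s => fst (f s) ^ 2 + snd (f s) ^ 2)
    (fun s => 2 * (fst (f s) * fst (f' s) + snd (f s) * snd (f' s))) a b (2 * L + 1) (B ^ 2)).
  rewrite !Cmod_sq. apply H; clear H; [easy|lra|nra| |].
  - intros s Hs. destruct (Hd s Hs) as [H1 H2]. now apply is_derive_sum_sq.
  - intros s Hs. specialize (Hb s Hs). rewrite <- Cmod_sq.
    assert (CS : fst (f s) * fst (f' s) + snd (f s) * snd (f' s) <= Cmod (f s) * Cmod (f' s)).
    { apply sq_le. { apply Rmult_le_pos; apply Cmod_ge_0. }
      rewrite Rpow_mult_distr, !Cmod_sq.
      generalize (pow2_ge_0 (fst (f s) * snd (f' s) - snd (f s) * fst (f' s))). nra. }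
    apply (Rmult_le_compat_l (Cmod (f s)) _ _ (Cmod_ge_0 _)) in Hb.
    generalize (pow2_ge_0 (Cmod (f s) - B)). nra.
Qed.

Lemma cgronwall (f f' : R -> C) (a b L B s1 s2 : R) :
  0 <= L -> 0 <= B -> a <= s1 <= b -> a <= s2 <= b ->
  (forall s, a <= s <= b -> cderive f s (f' s)) ->
  (forall s, a <= s <= b -> Cmod (f' s) <= L * Cmod (f s) + B) ->
  Cmod (f s2) ^ 2 <= (Cmod (f s1) ^ 2 + B ^ 2) * exp ((2 * L + 1) * (b - a)).
Proof.
  intros HL HB Hs1 Hs2 Hd Hb.
  apply Rle_trans with ((Cmod (f s1) ^ 2 + B ^ 2) * exp ((2 * L + 1) * Rabs (s2 - s1))).
  - destruct (Rle_lt_dec s1 s2) as [H|H].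
    + rewrite Rabs_right by lra. apply cgronwall_fwd with f'; auto.
      * intros s Hs; apply Hd; lra.
      * intros s Hs; apply Hb; lra.
    + rewrite Rabs_left by lra.
      replace (- (s2 - s1)) with (- s2 - - s1) by ring.
      assert (G := cgronwall_fwd (fun s => f (Ropp s)) (fun s => Copp (f' (Ropp s))) (- s1) (- s2) L B).
      simpl in G. rewrite !Ropp_involutive in G.
      apply G; [lra|easy|easy| |].
      * intros s Hs. apply cderive_reflect, Hd. lra.
      * intros s Hs. rewrite Cmod_opp. apply Hb. lra.
  - apply Rmult_le_compat_l.
    { assert (H0 := Cmod_ge_0 (f s1)). nra. }
    apply exp_increasing_le, Rmult_le_compat_l; [lra|].
    apply Rabs_le. lra.
Qed.

Definition vf (z : C) : C := (RtoC (-2) / z)%C.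

Lemma vf_fst (z : C) : fst (vf z) = -2 * fst z / (fst z ^ 2 + snd z ^ 2).
Proof. unfold vf, Cdiv, Cinv, Cmult, RtoC, Rdiv. cbn [fst snd]. ring. Qed.

Lemma vf_snd (z : C) : snd (vf z) = 2 * snd z / (fst z ^ 2 + snd z ^ 2).
Proof. unfold vf, Cdiv, Cinv, Cmult, RtoC, Rdiv. cbn [fst snd]. ring. Qed.

Lemma vf_mod (z : C) : z <> 0 -> Cmod (vf z) = 2 / Cmod z.
Proof.
  intros Hz. unfold vf. rewrite Cmod_div by easy. rewrite Cmod_R.
  rewrite Rabs_left by lra. f_equal. ring.
Qed.

Lemma vf_diff (z w : C) : z <> 0 -> w <> 0 -> (vf z - vf w = 2 * (z - w) / (z * w))%C.
Proof. intros Hz Hw. unfold vf. replace (RtoC (-2)) with (- RtoC 2)%C by (unfold RtoC, Copp; simpl; f_equal; ring). field. now split. Qed.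

Lemma vf_diff_mod (z w : C) (d : R) : 0 < d -> d <= Cmod z -> d <= Cmod w ->
  Cmod (vf z - vf w) <= 2 / d ^ 2 * Cmod (z - w).
Proof.
  intros Hd Hz Hw.
  assert (z <> 0) by (intros ->; rewrite Cmod_0 in Hz; lra).
  assert (w <> 0) by (intros ->; rewrite Cmod_0 in Hw; lra).
  rewrite vf_diff by easy.
  rewrite Cmod_div, !Cmod_mult by (now apply Cmult_neq_0).
  rewrite Cmod_R, Rabs_right by lra.
  apply Rle_trans with (2 * Cmod (z - w) / (d ^ 2)); [|right; field; lra].
  assert (Hge := Cmod_ge_0 (z - w)%C).
  apply Rmult_le_compat_l; [lra|].
  apply Rinv_le_contravar; nra.
Qed.

(** Lifting the imaginary part to at least [d] makes the vector field bounded
    and Lipschitz without changing it where the imaginary part exceeds [d]. *)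
Definition lift (d : R) (z : C) : C := (fst z, Rmax (snd z) d).

Lemma lift_mod (d : R) (z : C) : 0 < d -> d <= Cmod (lift d z).
Proof.
  intros Hd. apply sq_le; [apply Cmod_ge_0|]. rewrite Cmod_sq. simpl.
  generalize (Rmax_r (snd z) d). nra.
Qed.

Lemma Rmax_lip (x y d : R) : Rabs (Rmax x d - Rmax y d) <= Rabs (x - y).
Proof.
  unfold Rmax. destruct (Rle_dec x d), (Rle_dec y d); unfold Rabs;
    repeat destruct Rcase_abs; lra.
Qed.

Lemma lift_lip (d : R) (z w : C) : Cmod (lift d z - lift d w) <= Cmod (z - w).
Proof.
  apply sq_le; [apply Cmod_ge_0|]. rewrite !Cmod_sq. simpl.
  generalize (Rmax_lip (snd z) (snd w) d). intros H.
  apply Rplus_le_compat; [right; ring|].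
  generalize (Rabs_pos (Rmax (snd z) d - Rmax (snd w) d)).
  apply Rsqr_le_abs_1 in H. unfold Rsqr in H. lra.
Qed.

Lemma lift_id (d : R) (z : C) : d <= snd z -> lift d z = z.
Proof. intros H. unfold lift. rewrite Rmax_left by easy. now destruct z. Qed.

Lemma lifted_diff (d : R) (z w : C) : 0 < d ->
  Cmod (vf (lift d z) - vf (lift d w)) <= 2 / d ^ 2 * Cmod (z - w).
Proof.
  intros Hd. eapply Rle_trans; [apply vf_diff_mod with (d := d); auto using lift_mod|].
  apply Rmult_le_compat_l; [|apply lift_lip].
  apply Rlt_le, Rdiv_lt_0_compat; nra.
Qed.

Lemma lifted_mod (d : R) (z : C) : 0 < d -> Cmod (vf (lift d z)) <= 2 / d.
Proof.
  intros Hd. assert (H := lift_mod d z Hd).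
  rewrite vf_mod. 2: { intros E. rewrite E, Cmod_0 in H. lra. }
  apply Rmult_le_compat_l; [lra|]. now apply Rinv_le_contravar.
Qed.

Lemma continuous_Rmax_const (v : R -> R) (d : R) :
  (forall s, continuous v s) -> forall s, continuous (fun s => Rmax (v s) d) s.
Proof.
  intros Hv s. apply (continuous_comp v (fun y => Rmax y d)); [apply Hv|].
  apply (lipschitz_continuous (fun y => Rmax y d) 1).
  intros x y. generalize (Rmax_lip y x d). lra.
Qed.

Definition lifted_flow (xi : R -> R) (d a b : R) (f : R -> C) : Prop :=
  forall s, a <= s <= b -> cderive f s (vf (lift d (f s - RtoC (xi s))%C)).

Lemma fst_le_Cmod (z : C) : Rabs (fst z) <= Cmod z.
Proof. generalize (Rmax_Cmod z) (Rmax_l (Rabs (fst z)) (Rabs (snd z))). lra. Qed.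

Lemma snd_le_Cmod (z : C) : Rabs (snd z) <= Cmod z.
Proof. generalize (Rmax_Cmod z) (Rmax_r (Rabs (fst z)) (Rabs (snd z))). lra. Qed.

Lemma Cmod_le_sum (z : C) : Cmod z <= Rabs (fst z) + Rabs (snd z).
Proof.
  generalize (Rabs_pos (fst z)) (Rabs_pos (snd z)). intros.
  apply sq_le; [lra|]. rewrite Cmod_sq, <- (pow2_abs (fst z)), <- (pow2_abs (snd z)). nra.
Qed.

Lemma lifted_flow_exists (xi : R -> R) (d t0 : R) (w : C) :
  (forall s, continuous xi s) -> 0 < d ->
  exists f : R -> C, f t0 = w /\ forall a b, lifted_flow xi d a b f.
Proof.
  intros Hxi Hd.
  set (V := fun s x y : R => vf (lift d ((x, y) - RtoC (xi s))%C)).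
  assert (HL : 0 < 2 / d ^ 2) by (apply Rdiv_lt_0_compat; nra).
  assert (Hlip : forall s x y x' y', Cmod (V s x y - V s x' y') <= 2 / d ^ 2 * (Rabs (x - x') + Rabs (y - y'))).
  { intros s x y x' y'. unfold V. eapply Rle_trans; [now apply lifted_diff|].
    apply Rmult_le_compat_l; [lra|].
    eapply Rle_trans; [apply Cmod_le_sum|]. simpl. right. f_equal; f_equal; ring. }
  assert (Hc : forall u v : R -> R, (forall s, continuous u s) -> (forall s, continuous v s) -> forall s,
     continuous (fun s => -2 * (u s - xi s) / ((u s - xi s) ^ 2 + (Rmax (v s) d) ^ 2)) s /\
     continuous (fun s => 2 * (Rmax (v s) d) / ((u s - xi s) ^ 2 + (Rmax (v s) d) ^ 2)) s).
  { intros u v Hu Hv s.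
    assert (H1 : continuity_pt (fun s => u s - xi s) s).
    { apply continuity_pt_minus; apply continuity_pt_filterlim; [apply Hu|apply Hxi]. }
    assert (H2 : continuity_pt (fun s => Rmax (v s) d) s).
    { apply continuity_pt_filterlim, continuous_Rmax_const, Hv. }
    assert (Hm : 0 < Rmax (v s) d) by (generalize (Rmax_r (v s) d); lra).
    assert (H3 : continuity_pt (fun s => (u s - xi s) ^ 2 + (Rmax (v s) d) ^ 2) s).
    { apply continuity_pt_plus.
      - apply (continuity_pt_comp (fun s => u s - xi s) (fun x => x ^ 2)); [easy|].
        apply derivable_continuous_pt, derivable_pt_pow.
      - apply (continuity_pt_comp (fun s => Rmax (v s) d) (fun x => x ^ 2)); [easy|].
        apply derivable_continuous_pt, derivable_pt_pow. }
    assert (H4 : (u s - xi s) ^ 2 + (Rmax (v s) d) ^ 2 <> 0).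
    { apply Rgt_not_eq. generalize (pow2_ge_0 (u s - xi s)). nra. }
    split; apply continuity_pt_filterlim; apply continuity_pt_div; try easy;
      (apply continuity_pt_mult; [apply continuity_pt_const; now intros ? ?|easy]). }
  destruct (picard_solution (fun s x y => fst (V s x y)) (fun s x y => snd (V s x y))
     (2 / d ^ 2) (2 / d) t0 (fst w) (snd w)) as [u [v [Hu [Hv Huv]]]].
  - easy.
  - intros u v Hu Hv s. eapply continuous_ext; [|exact (proj1 (Hc u v Hu Hv s))].
    intros r. unfold V. rewrite vf_fst. simpl.
    replace (v r + - 0) with (v r) by ring. reflexivity.
  - intros u v Hu Hv s. eapply continuous_ext; [|exact (proj2 (Hc u v Hu Hv s))].
    intros r. unfold V. rewrite vf_snd. simpl.
    replace (v r + - 0) with (v r) by ring. reflexivity.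
  - intros s x y. eapply Rle_trans; [apply fst_le_Cmod|]. now apply lifted_mod.
  - intros s x y. eapply Rle_trans; [apply snd_le_Cmod|]. now apply lifted_mod.
  - intros s x y x' y'. eapply Rle_trans; [|apply Hlip]. apply (fst_le_Cmod (V s x y - V s x' y')%C).
  - intros s x y x' y'. eapply Rle_trans; [|apply Hlip]. apply (snd_le_Cmod (V s x y - V s x' y')%C).
  - exists (fun s => (u s, v s)). split.
    + rewrite Hu, Hv. now destruct w.
    + intros a b s _. destruct (Huv s) as [H1 H2]. now split.
Qed.

Lemma Csub_diff (z w c : C) : ((z - c) - (w - c) = z - w)%C.
Proof. ring. Qed.

Lemma lifted_flow_dep (xi : R -> R) (d a b : R) (f g : R -> C) (s1 s2 : R) :
  0 < d -> lifted_flow xi d a b f -> lifted_flow xi d a b g ->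
  a <= s1 <= b -> a <= s2 <= b ->
  Cmod (f s2 - g s2) ^ 2 <= Cmod (f s1 - g s1) ^ 2 * exp ((4 / d ^ 2 + 1) * (b - a)).
Proof.
  intros Hd Hf Hg Hs1 Hs2.
  assert (HL : 0 < 2 / d ^ 2) by (apply Rdiv_lt_0_compat; [lra|nra]).
  replace (4 / d ^ 2) with (2 * (2 / d ^ 2)) by (field; lra).
  replace (Cmod (f s1 - g s1) ^ 2) with (Cmod (f s1 - g s1) ^ 2 + 0 ^ 2) by ring.
  apply (cgronwall (fun s => f s - g s)%C
    (fun s => vf (lift d (f s - RtoC (xi s))) - vf (lift d (g s - RtoC (xi s))))%C); try lra.
  - intros s Hs. apply cderive_minus; [now apply Hf|now apply Hg].
  - intros s Hs. rewrite Rplus_0_r.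
    eapply Rle_trans; [now apply lifted_diff|]. rewrite Csub_diff. lra.
Qed.

Lemma Cmod_sq_eq0 (z w : C) : Cmod (z - w) ^ 2 <= 0 -> z = w.
Proof.
  intros H. assert (H0 := Cmod_ge_0 (z - w)%C).
  assert (E : (z - w)%C = 0) by (apply Cmod_eq_0; nra).
  replace z with (z - w + w)%C by ring. rewrite E. ring.
Qed.

Lemma lifted_flow_unique (xi : R -> R) (d a b : R) (f g : R -> C) (s1 s2 : R) :
  0 < d -> lifted_flow xi d a b f -> lifted_flow xi d a b g ->
  a <= s1 <= b -> a <= s2 <= b -> f s1 = g s1 -> f s2 = g s2.
Proof.
  intros Hd Hf Hg Hs1 Hs2 E.
  assert (H := lifted_flow_dep xi d a b f g s1 s2 Hd Hf Hg Hs1 Hs2).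
  rewrite E in H. replace (g s1 - g s1)%C with (RtoC 0) in H by ring.
  rewrite Cmod_0, pow_i, Rmult_0_l in H by lia. now apply Cmod_sq_eq0.
Qed.

(** * Solutions in the upper half plane *)

Definition hsol (xi : R -> R) (a b : R) (f : R -> C) : Prop :=
  forall s, a <= s <= b -> 0 < snd (f s) /\ cderive f s (vf (f s - RtoC (xi s))%C).

(** [alive xi a b w]: the flow run backwards from [w] at time [b] stays in the
    upper half plane down to time [a]; equivalently [w] is in the image of the
    flow map from time [a] to time [b]. *)
Definition alive (xi : R -> R) (a b : R) (w : C) : Prop :=
  exists f, hsol xi a b f /\ f b = w.

Lemma snd_sub_R (z : C) (x : R) : snd (z - RtoC x)%C = snd z.
Proof. simpl. ring. Qed.

Lemma fst_sub_R (z : C) (x : R) : fst (z - RtoC x)%C = fst z - x.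
Proof. simpl. ring. Qed.

Lemma hsol_sub xi a b a' b' f : a <= a' -> b' <= b -> hsol xi a b f -> hsol xi a' b' f.
Proof. intros Ha Hb H s Hs. apply H. lra. Qed.

Lemma hsol_Im_incr xi a b f s1 s2 : hsol xi a b f -> a <= s1 -> s1 <= s2 -> s2 <= b ->
  snd (f s1) <= snd (f s2).
Proof.
  intros H H1 H12 H2.
  assert (G := mvt_ge (fun s => snd (f s)) (fun s => snd (vf (f s - RtoC (xi s))%C)) s1 s2 0 H12).
  enough (0 * (s2 - s1) <= snd (f s2) - snd (f s1)) by lra. apply G.
  - intros s Hs. apply H. lra.
  - intros s Hs. destruct (H s) as [Hp _]; [lra|].
    rewrite vf_snd, snd_sub_R. apply Rdiv_le_0_compat; [lra|].
    generalize (pow2_ge_0 (fst (f s - RtoC (xi s))%C)). nra.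
Qed.

Lemma hsol_lifted xi a b f d : hsol xi a b f -> a <= b -> d <= snd (f a) -> lifted_flow xi d a b f.
Proof.
  intros H Hab Hd s Hs. rewrite lift_id; [now apply H|].
  rewrite snd_sub_R. apply Rle_trans with (1 := Hd). apply (hsol_Im_incr xi a b); auto; lra.
Qed.

Lemma lifted_hsol xi a b f d : 0 < d -> lifted_flow xi d a b f ->
  (forall s, a <= s <= b -> d <= snd (f s)) -> hsol xi a b f.
Proof.
  intros H0 H Hd s Hs. generalize (H s Hs) (Hd s Hs). intros H1 H2.
  split; [lra|]. now rewrite lift_id in H1 by (now rewrite snd_sub_R).
Qed.

(** Imaginary parts increase with time, so both solutions stay above the
    smaller of their initial heights, where the vector field is Lipschitz. *)
Lemma hsol_unique xi a b f g s1 s2 : hsol xi a b f -> hsol xi a b g ->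
  a <= s1 <= b -> a <= s2 <= b -> f s1 = g s1 -> f s2 = g s2.
Proof.
  intros Hf Hg H1 H2 E.
  set (d := Rmin (snd (f a)) (snd (g a))).
  assert (Hd : 0 < d).
  { apply Rmin_glb_lt; [apply Hf|apply Hg]; lra. }
  apply (lifted_flow_unique xi d a b f g s1); auto; apply hsol_lifted; auto; try lra.
  - apply Rmin_l.
  - apply Rmin_r.
Qed.

Lemma alive_sub xi a b a' w : a <= a' -> alive xi a b w -> alive xi a' b w.
Proof. intros Ha [f [Hf E]]. exists f. split; [|easy]. apply (hsol_sub xi a b); auto; lra. Qed.

Lemma alive_refl xi a w : (forall s, continuous xi s) -> 0 < snd w -> alive xi a a w.
Proof.
  intros Hc Hw. destruct (lifted_flow_exists xi (snd w) a w Hc Hw) as [f [E Hf]].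
  exists f. split; [|easy]. apply (lifted_hsol xi a a f (snd w)); auto.
  intros s Hs. replace s with a by lra. rewrite E. lra.
Qed.

Section Alive.

Variable xi : R -> R.
Hypothesis Hxi : forall s, continuous xi s.

Lemma lifted_Im_incr d a b f s1 s2 : 0 < d -> lifted_flow xi d a b f ->
  a <= s1 -> s1 <= s2 -> s2 <= b -> snd (f s1) <= snd (f s2) <= snd (f s1) + 2 / d * (s2 - s1).
Proof.
  intros Hd H H1 H12 H2.
  assert (G : forall s, s1 <= s <= s2 -> is_derive (fun s => snd (f s)) s (snd (vf (lift d (f s - RtoC (xi s))%C)))).
  { intros s Hs. apply H. lra. }
  split.
  - assert (G1 := mvt_ge _ _ s1 s2 0 H12 G).
    enough (0 * (s2 - s1) <= snd (f s2) - snd (f s1)) by lra. apply G1.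
    intros s Hs. rewrite vf_snd. simpl.
    generalize (Rmax_r (snd (f s) + - 0) d). intros Hm.
    apply Rdiv_le_0_compat; [lra|].
    generalize (pow2_ge_0 (fst (f s) + - xi s)). nra.
  - assert (G1 := mvt_le _ _ s1 s2 (2 / d) H12 G).
    enough (snd (f s2) - snd (f s1) <= 2 / d * (s2 - s1)) by lra. apply G1.
    intros s Hs. eapply Rle_trans; [apply Rle_abs|].
    eapply Rle_trans; [apply snd_le_Cmod|]. now apply lifted_mod.
Qed.

Lemma forward_exists a b w : 0 < snd w -> a <= b -> exists f, hsol xi a b f /\ f a = w.
Proof.
  intros Hw Hab. destruct (lifted_flow_exists xi (snd w) a w Hxi Hw) as [f [E Hf]].
  exists f. split; [|easy]. apply (lifted_hsol xi a b f (snd w)); auto.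
  intros s Hs. rewrite <- E. apply (lifted_Im_incr (snd w) a b f); auto; lra.
Qed.

(** The imaginary part decreases backwards in time at speed at most [2] over
    itself, so a lower bound [m] on it buys a fixed further amount of time. *)
Lemma alive_extend a b f m : hsol xi a b f -> a <= b -> 0 < m -> m <= snd (f a) ->
  alive xi (a - m ^ 2 / 8) b (f b).
Proof.
  intros Hf Hab Hm Hfa.
  assert (Hm2 : 0 < m / 2) by lra.
  destruct (lifted_flow_exists xi (m / 2) b (f b) Hxi Hm2) as [g [E Hg]].
  exists g. split; [|easy].
  apply (lifted_hsol xi _ b g (m / 2)); auto.
  assert (Ega : g a = f a).
  { apply (lifted_flow_unique xi (m / 2) a b g f b a); auto; try lra.
    apply hsol_lifted; auto; lra. }
  intros s Hs. destruct (Rle_lt_dec a s) as [H|H].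
  - apply Rle_trans with (snd (g a)); [rewrite Ega; lra|].
    apply (lifted_Im_incr (m / 2) a b g a s); auto; lra.
  - assert (G := lifted_Im_incr (m / 2) s a g s a Hm2 (Hg s a)).
    assert (H1 : snd (g a) <= snd (g s) + 2 / (m / 2) * (a - s)) by (apply G; lra).
    rewrite Ega in H1.
    assert (H2 : 2 / (m / 2) * (a - s) <= 2 / (m / 2) * (m ^ 2 / 8)).
    { apply Rmult_le_compat_l; [|lra]. apply Rlt_le, Rdiv_lt_0_compat; lra. }
    replace (2 / (m / 2) * (m ^ 2 / 8)) with (m / 2) in H2 by (field; lra). lra.
Qed.

Lemma hsol_concat a b c f g : a <= b -> b <= c -> hsol xi a b g -> hsol xi b c f -> g b = f b ->
  exists h, hsol xi a c h /\ h a = g a /\ h b = f b /\ h c = f c.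
Proof.
  intros Hab Hbc Hg Hf E.
  assert (Hd : 0 < snd (g a)) by (apply Hg; lra).
  set (d := snd (g a)).
  destruct (lifted_flow_exists xi d c (f c) Hxi Hd) as [h [Eh Hh]].
  assert (Hgb : d <= snd (f b)).
  { rewrite <- E. apply (hsol_Im_incr xi a b g); auto; lra. }
  assert (Eb : h b = f b).
  { apply (lifted_flow_unique xi d b c h f c b); auto; try lra. now apply hsol_lifted. }
  assert (Ea : h a = g a).
  { apply (lifted_flow_unique xi d a b h g b a); auto; try lra.
    - apply hsol_lifted; auto. unfold d; lra.
    - now rewrite Eb. }
  exists h. split; [|now rewrite Ea, Eb, Eh].
  apply (lifted_hsol xi a c h d); auto.
  intros r Hr. apply Rle_trans with (snd (h a)); [rewrite Ea; unfold d; lra|].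
  apply (lifted_Im_incr d a c h a r); auto; lra.
Qed.

Lemma alive_concat a b c f : a <= b -> b <= c -> hsol xi b c f -> alive xi a b (f b) ->
  alive xi a c (f c).
Proof.
  intros Hab Hbc Hf [g [Hg E]].
  destruct (hsol_concat a b c f g) as [h [Hh [_ [_ Ec]]]]; auto. now exists h.
Qed.

(** Openness of survival, with a Lipschitz estimate; the lower bound on the
    imaginary part is uniform over the nearby solutions. *)
Lemma alive_stable a b f : a <= b -> hsol xi a b f ->
  exists K r, 1 <= K /\ 0 < r /\ forall w, Cmod (w - f b) < r ->
    exists g, hsol xi a b g /\ g b = w /\
      forall s, a <= s <= b -> Cmod (g s - f s) <= K * Cmod (w - f b) /\ snd (f a) / 2 <= snd (g s).
Proof.
  intros Hab Hf.
  assert (Hm : 0 < snd (f a)) by (apply Hf; lra).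
  set (d := snd (f a) / 2). assert (Hd2 : snd (f a) = 2 * d) by (unfold d; lra).
  clearbody d. assert (Hd : 0 < d) by lra.
  set (K := exp ((4 / d ^ 2 + 1) * (b - a))).
  assert (HK : 1 <= K).
  { apply Rle_trans with (exp 0); [rewrite exp_0; lra|]. apply exp_increasing_le, Rmult_le_pos; [|lra].
    assert (0 < 4 / d ^ 2) by (apply Rdiv_lt_0_compat; [lra|now apply pow_lt]). lra. }
  exists K, (d / K). split; [easy|]. split; [apply Rdiv_lt_0_compat; lra|].
  intros w Hw. destruct (lifted_flow_exists xi d b w Hxi Hd) as [g [E Hg]].
  assert (Hdist : forall s, a <= s <= b -> Cmod (g s - f s) <= K * Cmod (w - f b)).
  { intros s Hs. assert (H0 := Cmod_ge_0 (w - f b)%C). apply sq_le; [nra|].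
    assert (H1 := lifted_flow_dep xi d a b g f b s). rewrite E in H1. fold K in H1.
    eapply Rle_trans; [apply H1; auto; try lra; apply hsol_lifted; auto; lra|].
    assert (0 <= Cmod (w - f b) ^ 2) by nra. nra. }
  assert (HI : forall s, a <= s <= b -> d <= snd (g s)).
  { intros s Hs. assert (H1 : snd (f a) <= snd (f s)) by (apply (hsol_Im_incr xi a b); auto; lra).
    assert (H2 := snd_le_Cmod (g s - f s)%C). simpl in H2. apply Rabs_le_between in H2.
    assert (H3 := Hdist s Hs).
    apply (Rmult_lt_compat_l K) in Hw; [|lra].
    replace (K * (d / K)) with d in Hw by (field; lra). lra. }
  exists g. split; [now apply (lifted_hsol xi a b g d)|]. split; [easy|].
  intros s Hs. split; [auto|]. apply HI in Hs. lra.
Qed.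

(** Every use of [alive_extend] gains the same amount of time.  The lower bound
    is assumed only at times down to which all of [K] survives, which is when
    the minimum principle can provide it. *)
Lemma alive_continuation (K : C -> Prop) a b m : a <= b -> 0 < m ->
  (forall w, K w -> 0 < snd w) ->
  (forall s, a <= s <= b -> (forall w, K w -> alive xi s b w) ->
    forall f, hsol xi s b f -> K (f b) -> m <= snd (f s)) ->
  forall w, K w -> alive xi a b w.
Proof.
  intros Hab Hm HK Hstep.
  assert (H : forall n w, K w -> alive xi (Rmax a (b - INR n * (m ^ 2 / 8))) b w).
  { induction n as [|n IH]; intros w Hw.
    - simpl. rewrite Rmult_0_l, Rminus_0_r, Rmax_right by lra. now apply alive_refl, HK.
    - set (s := Rmax a (b - INR n * (m ^ 2 / 8))) in *.
      assert (Hs : a <= s <= b).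
      { split; [apply Rmax_l|]. apply Rmax_lub; [lra|].
        assert (0 <= INR n) by apply pos_INR. assert (0 <= m ^ 2) by nra. nra. }
      destruct (IH w Hw) as [f [Hf E]]. rewrite <- E in Hw |- *.
      assert (H1 := alive_extend s b f m Hf (proj2 Hs) Hm (Hstep s Hs IH f Hf Hw)).
      eapply alive_sub; [|exact H1].
      rewrite S_INR. unfold s, Rmax. assert (0 <= m ^ 2) by nra.
      repeat destruct Rle_dec; nra. }
  intros w Hw.
  destruct (INR_unbounded ((b - a) / (m ^ 2 / 8))) as [n Hn].
  assert (Hm2 : 0 < m ^ 2 / 8) by nra.
  apply (Rmult_lt_compat_r (m ^ 2 / 8)) in Hn; [|easy].
  replace ((b - a) / (m ^ 2 / 8) * (m ^ 2 / 8)) with (b - a) in Hn by (field; nra).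
  generalize (H n w Hw). rewrite Rmax_left by lra. easy.
Qed.

End Alive.

(** * The backward flow map to second order *)

(** The value at time [a] of the flow run backwards from [w] at time [b];
    meaningful when [alive xi a b w]. *)
Definition bval (xi : R -> R) (a b : R) (w : C) : C :=
  epsilon (inhabits (RtoC 0)) (fun z => exists f, hsol xi a b f /\ f b = w /\ f a = z).

Lemma bval_eq xi a b f : a <= b -> hsol xi a b f -> bval xi a b (f b) = f a.
Proof.
  intros Hab Hf.
  assert (H : exists g, hsol xi a b g /\ g b = f b /\ g a = bval xi a b (f b)).
  { apply (epsilon_spec (inhabits (RtoC 0)) (fun z => exists g, hsol xi a b g /\ g b = f b /\ g a = z)).
    now exists (f a), f. }
  destruct H as [g [Hg [E1 E2]]]. rewrite <- E2.
  apply (hsol_unique xi a b g f b a); auto; lra.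
Qed.

(** Without initial value the bound is linear in the forcing term [B]; this is
    how orders in [h] are propagated below. *)
Lemma cgronwall0 (f f' : R -> C) (a b L B s : R) :
  0 <= L -> 0 <= B -> a <= s <= b -> f b = 0 ->
  (forall s, a <= s <= b -> cderive f s (f' s)) ->
  (forall s, a <= s <= b -> Cmod (f' s) <= L * Cmod (f s) + B) ->
  Cmod (f s) <= B * exp ((2 * L + 1) * (b - a)).
Proof.
  intros HL HB Hs E Hd Hb.
  assert (H := cgronwall f f' a b L B b s HL HB ltac:(lra) Hs Hd Hb).
  rewrite E, Cmod_0 in H. set (Q := exp ((2 * L + 1) * (b - a))) in *.
  assert (HQ : 1 <= Q).
  { unfold Q. apply Rle_trans with (exp 0); [rewrite exp_0; lra|].
    apply exp_increasing_le, Rmult_le_pos; lra. }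
  apply sq_le; [nra|]. apply Rle_trans with (1 := H).
  rewrite Rpow_mult_distr. assert (0 <= B ^ 2) by nra. nra.
Qed.

Lemma Cmod_div_le (x y : C) (p q : R) : 0 < q -> Cmod x <= p -> q <= Cmod y -> Cmod (x / y) <= p / q.
Proof.
  intros Hq Hx Hy.
  assert (y <> 0) by (intros ->; rewrite Cmod_0 in Hy; lra).
  rewrite Cmod_div by easy. assert (H0 := Cmod_ge_0 x).
  unfold Rdiv. apply Rmult_le_compat; auto.
  - left. apply Rinv_0_lt_compat. lra.
  - now apply Rinv_le_contravar.
Qed.

Lemma Cmod_nonzero (z : C) (m : R) : 0 < m -> m <= Cmod z -> z <> 0.
Proof. intros Hm H ->. rewrite Cmod_0 in H. lra. Qed.

Lemma Cmod_mult_ge (z w : C) (p q : R) : 0 <= p -> 0 <= q -> p <= Cmod z -> q <= Cmod w -> p * q <= Cmod (z * w).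
Proof. intros. rewrite Cmod_mult. apply Rmult_le_compat; auto. Qed.

Lemma Cmod_mult_le (z w : C) (p q : R) : Cmod z <= p -> Cmod w <= q -> Cmod (z * w) <= p * q.
Proof. intros. rewrite Cmod_mult. apply Rmult_le_compat; auto using Cmod_ge_0. Qed.

Lemma Cmod_triangle_le (z w : C) (p q : R) : Cmod z <= p -> Cmod w <= q -> Cmod (z + w) <= p + q.
Proof. intros. generalize (Cmod_triangle z w). lra. Qed.

Lemma vf_quotient (Z D : C) : Z <> 0 -> (Z + D)%C <> 0 ->
  (vf (Z + D) - vf Z = 2 / (Z * Z) * D - 2 * (D * D) / (Z * Z * (Z + D)))%C.
Proof.
  intros HZ HD. rewrite vf_diff by easy. field. now split.
Qed.

Lemma vf_quotient3 (Z D : C) : Z <> 0 -> (Z + D)%C <> 0 ->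
  (vf (Z + D) - vf Z =
   2 / (Z * Z) * D - 2 / (Z * Z * Z) * (D * D) + 2 * (D * (D * D)) / (Z * Z * Z * (Z + D)))%C.
Proof.
  intros HZ HD. rewrite vf_diff by easy. field. now split.
Qed.

Lemma Cmod_ge_snd (z : C) (m : R) : m <= snd z -> m <= Cmod z.
Proof. intros H. generalize (snd_le_Cmod z) (Rle_abs (snd z)). lra. Qed.

(** Complex differentiability of the flow: the displacement in the direction
    [c] is [c] times the displacement in the direction [1], up to second
    order. *)
Lemma flow_conformal xi a b f g1 gc (c : C) (m K h : R) :
  a <= b -> 0 < m -> 0 <= K -> 0 <= h -> Cmod c = 1 ->
  (forall s, a <= s <= b -> m <= snd (f s) /\ cderive f s (vf (f s - RtoC (xi s))%C)) ->
  (forall s, a <= s <= b -> m / 2 <= snd (g1 s) /\ Cmod (g1 s - f s) <= K * h /\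
     cderive g1 s (vf (g1 s - RtoC (xi s))%C)) ->
  (forall s, a <= s <= b -> m / 2 <= snd (gc s) /\ Cmod (gc s - f s) <= K * h /\
     cderive gc s (vf (gc s - RtoC (xi s))%C)) ->
  (gc b - f b = c * (g1 b - f b))%C ->
  forall s, a <= s <= b ->
  Cmod ((gc s - f s) - c * (g1 s - f s)) <= 8 * K ^ 2 / m ^ 3 * h ^ 2 * exp ((4 / m ^ 2 + 1) * (b - a)).
Proof.
  intros Hab Hm HK Hh Hc Hf Hg1 Hgc E s Hs.
  assert (Hm3 : 0 < m ^ 3) by now apply pow_lt.
  assert (Hm2 : 0 < m ^ 2) by now apply pow_lt.
  replace (4 / m ^ 2) with (2 * (2 / m ^ 2)) by (field; lra).
  apply (cgronwall0 (fun s => (gc s - f s) - c * (g1 s - f s))%C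
    (fun s => (vf (gc s - RtoC (xi s)) - vf (f s - RtoC (xi s))) -
      c * (vf (g1 s - RtoC (xi s)) - vf (f s - RtoC (xi s))))%C).
  - apply Rlt_le, Rdiv_lt_0_compat; lra.
  - apply Rmult_le_pos; [|nra]. apply Rdiv_le_0_compat; nra.
  - easy.
  - rewrite E. ring.
  - intros r Hr. destruct (Hf r Hr) as [_ H1], (Hg1 r Hr) as [_ [_ H2]], (Hgc r Hr) as [_ [_ H3]].
    apply cderive_minus; [now apply cderive_minus|]. now apply cderive_scal, cderive_minus.
  - intros r Hr. destruct (Hf r Hr) as [H1 _], (Hg1 r Hr) as [H2 [H2' _]], (Hgc r Hr) as [H3 [H3' _]].
    set (Z := (f r - RtoC (xi r))%C). set (D := (gc r - f r)%C) in *. set (D1 := (g1 r - f r)%C) in *.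
    replace (gc r - RtoC (xi r))%C with (Z + D)%C by (unfold Z, D; ring).
    replace (g1 r - RtoC (xi r))%C with (Z + D1)%C by (unfold Z, D1; ring).
    assert (HZ : m <= Cmod Z) by (apply Cmod_ge_snd; unfold Z; now rewrite snd_sub_R).
    assert (HD : m / 2 <= Cmod (Z + D)).
    { apply Cmod_ge_snd. replace (Z + D)%C with (gc r - RtoC (xi r))%C by (unfold Z, D; ring). now rewrite snd_sub_R. }
    assert (HD1 : m / 2 <= Cmod (Z + D1)).
    { apply Cmod_ge_snd. replace (Z + D1)%C with (g1 r - RtoC (xi r))%C by (unfold Z, D1; ring). now rewrite snd_sub_R. }
    rewrite !vf_quotient by (eapply Cmod_nonzero; [|eassumption]; lra).
    match goal with |- Cmod ?X <= _ =>
      replace X with (2 / (Z * Z) * (D - c * D1) +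
       (- (2 * (D * D) / (Z * Z * (Z + D))) + c * (2 * (D1 * D1) / (Z * Z * (Z + D1)))))%C by ring end.
    assert (HR : forall D, Cmod D <= K * h -> m / 2 <= Cmod (Z + D) ->
       Cmod (2 * (D * D) / (Z * Z * (Z + D))) <= 4 * K ^ 2 / m ^ 3 * h ^ 2).
    { intros d Hd Hd'. eapply Rle_trans; [apply Cmod_div_le with (p := 2 * (K * h * (K * h))) (q := m * m * (m / 2))|].
      - nra.
      - apply Cmod_mult_le; [rewrite Cmod_R, Rabs_right; lra|]. now apply Cmod_mult_le.
      - apply Cmod_mult_ge; try nra. apply Cmod_mult_ge; lra.
      - right. field. lra. }
    apply Cmod_triangle_le.
    + apply Cmod_mult_le; [|lra].
      eapply Rle_trans; [apply Cmod_div_le with (p := 2) (q := m * m)|].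
      * nra.
      * rewrite Cmod_R, Rabs_right; lra.
      * apply Cmod_mult_ge; lra.
      * right. field. lra.
    + replace (8 * K ^ 2 / m ^ 3 * h ^ 2) with (4 * K ^ 2 / m ^ 3 * h ^ 2 + 4 * K ^ 2 / m ^ 3 * h ^ 2) by (field; lra).
      apply Cmod_triangle_le.
      * rewrite Cmod_opp. now apply HR.
      * rewrite Cmod_mult, Hc, Rmult_1_l. now apply HR.
Qed.

(** The four displacements in the directions [1], [-1], [i], [-i] cancel up to
    third order, because [1 + 1 + i^2 + i^2 = 0]; for the imaginary part this
    is harmonicity in discrete form. *)
Lemma four_point xi a b w :
  (forall s, continuous xi s) -> a <= b -> alive xi a b w ->
  exists M h0, 0 < h0 /\ forall h, 0 < h < h0 ->
    Cmod (bval xi a b (w + RtoC h) + bval xi a b (w - RtoC h)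
        + bval xi a b (w + Ci * RtoC h) + bval xi a b (w - Ci * RtoC h) - 4 * bval xi a b w) <= M * h ^ 3.
Proof.
  intros Hxi Hab [f [Hf E]].
  destruct (alive_stable xi Hxi a b f Hab Hf) as [K [r [HK [Hr Hstab]]]].
  rewrite E in Hstab.
  set (m := snd (f a)). assert (Hm : 0 < m) by (apply Hf; lra).
  assert (Hm3 : 0 < m ^ 3) by now apply pow_lt.
  assert (Hm2 : 0 < m ^ 2) by now apply pow_lt.
  set (Q := exp ((4 / m ^ 2 + 1) * (b - a))). assert (HQ : 0 < Q) by apply exp_pos.
  set (K2 := 8 * K ^ 2 / m ^ 3 * Q).
  assert (HK2 : 0 <= K2).
  { unfold K2. apply Rmult_le_pos; [|lra]. apply Rdiv_le_0_compat; nra. }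
  set (B := 2 / m ^ 3 * (6 * K * K2 + 3 * K2 ^ 2) + 16 * K ^ 3 / m ^ 4).
  exists (B * Q), (Rmin r 1). split; [apply Rmin_glb_lt; lra|].
  intros h [Hh Hh']. assert (Hhr : h < r) by (generalize (Rmin_l r 1); lra).
  assert (Hh1 : h < 1) by (generalize (Rmin_r r 1); lra).
  assert (G : forall c, Cmod c = 1 -> exists g, hsol xi a b g /\ g b = (w + c * RtoC h)%C /\
     forall s, a <= s <= b -> m / 2 <= snd (g s) /\ Cmod (g s - f s) <= K * h /\
       cderive g s (vf (g s - RtoC (xi s))%C)).
  { intros c Hc. destruct (Hstab (w + c * RtoC h)%C) as [g [Hg [Eg Hgs]]].
    - replace (w + c * h - w)%C with (c * RtoC h)%C by ring.
      rewrite Cmod_mult, Hc, Cmod_R, Rabs_right by lra. lra.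
    - exists g. split; [easy|]. split; [easy|]. intros s Hs. destruct (Hgs s Hs) as [H1 H2].
      replace (w + c * h - w)%C with (c * RtoC h)%C in H1 by ring.
      rewrite Cmod_mult, Hc, Cmod_R, Rabs_right, Rmult_1_l in H1 by lra.
      split; [easy|]. split; [easy|]. now apply Hg. }
  assert (Ci1 : Cmod Ci = 1).
  { unfold Cmod. simpl. replace (0 * (0 * 1) + 1 * (1 * 1)) with 1 by ring. apply sqrt_1. }
  destruct (G 1%C) as [g1 [Hg1 [E1 B1]]]; [apply Cmod_1|].
  destruct (G (- (1))%C) as [g2 [Hg2 [E2 B2]]]; [rewrite Cmod_opp; apply Cmod_1|].
  destruct (G Ci) as [g3 [Hg3 [E3 B3]]]; [easy|].
  destruct (G (- Ci)%C) as [g4 [Hg4 [E4 B4]]]; [now rewrite Cmod_opp|].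
  replace (w + RtoC h)%C with (g1 b) by (rewrite E1; ring).
  replace (w - RtoC h)%C with (g2 b) by (rewrite E2; ring).
  replace (w + Ci * RtoC h)%C with (g3 b) by (now rewrite E3).
  replace (w - Ci * RtoC h)%C with (g4 b) by (rewrite E4; ring).
  rewrite <- E. rewrite !bval_eq by auto.
  assert (Bf : forall s, a <= s <= b -> m <= snd (f s) /\ cderive f s (vf (f s - RtoC (xi s))%C)).
  { intros s Hs. split; [apply (hsol_Im_incr xi a b); auto; lra|now apply Hf]. }
  assert (HG : forall c gc, Cmod c = 1 -> gc b = (w + c * RtoC h)%C ->
     (forall s, a <= s <= b -> m / 2 <= snd (gc s) /\ Cmod (gc s - f s) <= K * h /\
       cderive gc s (vf (gc s - RtoC (xi s))%C)) ->
     forall s, a <= s <= b -> Cmod ((gc s - f s) - c * (g1 s - f s)) <= K2 * h ^ 2).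
  { intros c gc Hc Ec Bc s Hs.
    replace (K2 * h ^ 2) with (8 * K ^ 2 / m ^ 3 * h ^ 2 * Q) by (unfold K2; field; lra).
    apply (flow_conformal xi a b f g1 gc c m K h); auto; try lra.
    rewrite Ec, E1, E. ring. }
  assert (G2 := HG (- (1))%C g2 ltac:(rewrite Cmod_opp; apply Cmod_1) E2 B2).
  assert (G3 := HG Ci g3 Ci1 E3 B3).
  assert (G4 := HG (- Ci)%C g4 ltac:(now rewrite Cmod_opp) E4 B4).
  set (D := fun g s => (g s - f s)%C : C).
  replace (g1 a + g2 a + g3 a + g4 a - 4 * f a)%C with (D g1 a + D g2 a + (D g3 a + D g4 a))%C
    by (unfold D; ring).
  replace (B * Q * h ^ 3) with (B * h ^ 3 * exp ((2 * (2 / m ^ 2) + 1) * (b - a))).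
  2: { unfold Q. replace (4 / m ^ 2) with (2 * (2 / m ^ 2)) by (field; lra). ring. }
  assert (HB : 0 <= B).
  { unfold B. apply Rplus_le_le_0_compat.
    - apply Rmult_le_pos; [apply Rlt_le, Rdiv_lt_0_compat; lra|nra].
    - apply Rdiv_le_0_compat; [|now apply pow_lt].
      assert (0 <= K ^ 3) by (apply pow_le; lra). lra. }
  set (W := fun (g : R -> C) s => (vf (g s - RtoC (xi s)) - vf (f s - RtoC (xi s)))%C).
  apply (cgronwall0 (fun s => D g1 s + D g2 s + (D g3 s + D g4 s))%C
    (fun s => W g1 s + W g2 s + (W g3 s + W g4 s))%C).
  - apply Rlt_le, Rdiv_lt_0_compat; lra.
  - apply Rmult_le_pos; [easy|apply pow_le; lra].
  - lra.
  - unfold D. rewrite E1, E2, E3, E4, E. ring.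
  - intros s Hs. destruct (Bf s Hs) as [_ F], (B1 s Hs) as [_ [_ F1]], (B2 s Hs) as [_ [_ F2]],
      (B3 s Hs) as [_ [_ F3]], (B4 s Hs) as [_ [_ F4]].
    apply cderive_plus; apply cderive_plus; now apply cderive_minus.
  - intros s Hs.
    set (Z := (f s - RtoC (xi s))%C).
    assert (HZ : m <= Cmod Z).
    { apply Cmod_ge_snd; unfold Z; rewrite snd_sub_R; now apply Bf. }
    assert (HW : forall g, (forall s, a <= s <= b -> m / 2 <= snd (g s) /\ Cmod (g s - f s) <= K * h /\
       cderive g s (vf (g s - RtoC (xi s))%C)) ->
       exists rem, (W g s = 2 / (Z * Z) * D g s - 2 / (Z * Z * Z) * (D g s * D g s) + rem)%C /\
         Cmod rem <= 4 * K ^ 3 / m ^ 4 * h ^ 3 /\ Cmod (D g s) <= K * h).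
    { intros g Bg. destruct (Bg s Hs) as [P1 [P2 _]].
      exists (2 * (D g s * (D g s * D g s)) / (Z * Z * Z * (Z + D g s)))%C.
      assert (HD : m / 2 <= Cmod (Z + D g s)).
      { apply Cmod_ge_snd. replace (Z + D g s)%C with (g s - RtoC (xi s))%C by (unfold Z, D; ring). now rewrite snd_sub_R. }
      split; [|split; [|easy]].
      - unfold W. replace (g s - RtoC (xi s))%C with (Z + D g s)%C by (unfold Z, D; ring).
        apply vf_quotient3; (eapply Cmod_nonzero; [|eassumption]; lra).
      - eapply Rle_trans; [apply Cmod_div_le with (p := 2 * (K * h * (K * h * (K * h)))) (q := m * m * m * (m / 2))|].
        + assert (0 < m * m * m) by nra. nra.
        + apply Cmod_mult_le; [rewrite Cmod_R, Rabs_right; lra|]. now repeat apply Cmod_mult_le.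
        + apply Cmod_mult_ge; try nra. repeat apply Cmod_mult_ge; nra.
        + right. field. lra. }
    destruct (HW g1 B1) as [r1 [-> [R1 N1]]]. destruct (HW g2 B2) as [r2 [-> [R2 N2]]].
    destruct (HW g3 B3) as [r3 [-> [R3 N3]]]. destruct (HW g4 B4) as [r4 [-> [R4 N4]]].
    set (d1 := D g1 s) in *.
    set (e2 := (D g2 s - - (1) * d1)%C). set (e3 := (D g3 s - Ci * d1)%C). set (e4 := (D g4 s - - Ci * d1)%C).
    assert (P2 : Cmod e2 <= K2 * h ^ 2) by now apply G2.
    assert (P3 : Cmod e3 <= K2 * h ^ 2) by now apply G3.
    assert (P4 : Cmod e4 <= K2 * h ^ 2) by now apply G4.
    set (S2 := (d1 * d1 + D g2 s * D g2 s + D g3 s * D g3 s + D g4 s * D g4 s)%C).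
    assert (HCi : (Ci * Ci = - (1))%C).
    { unfold Ci, Cmult, Copp, RtoC. simpl. f_equal; ring. }
    assert (ES : (S2 = - (2) * (d1 * e2) + (2 * (Ci * (d1 * e3)) + (- (2) * (Ci * (d1 * e4)) + (e2 * e2 + (e3 * e3 + e4 * e4)))))%C).
    { transitivity ((2 + 2 * (Ci * Ci)) * (d1 * d1) +
         (- (2) * (d1 * e2) + (2 * (Ci * (d1 * e3)) + (- (2) * (Ci * (d1 * e4)) + (e2 * e2 + (e3 * e3 + e4 * e4))))))%C.
      - unfold S2, e2, e3, e4. ring.
      - rewrite HCi. ring. }
    assert (HS : Cmod S2 <= (6 * K * K2 + 3 * K2 ^ 2) * h ^ 3).
    { rewrite ES.
      assert (T : forall c e, Cmod c = 2 -> Cmod e <= K2 * h ^ 2 -> Cmod (c * (d1 * e)) <= 2 * (K * h * (K2 * h ^ 2))).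
      { intros c e Hc He. apply Cmod_mult_le; [lra|]. now apply Cmod_mult_le. }
      assert (C2 : Cmod 2 = 2) by (rewrite Cmod_R, Rabs_right; lra).
      assert (T2 : forall e, Cmod e <= K2 * h ^ 2 -> Cmod (e * e) <= K2 ^ 2 * h ^ 3).
      { intros e He. eapply Rle_trans; [apply Cmod_mult_le; exact He|].
        replace (K2 * h ^ 2 * (K2 * h ^ 2)) with (K2 ^ 2 * h ^ 3 * h) by ring.
        assert (0 <= K2 ^ 2 * h ^ 3) by (apply Rmult_le_pos; apply pow_le; lra). nra. }
      eapply Rle_trans; [repeat apply Cmod_triangle_le|].
      - apply T; [rewrite Cmod_opp; exact C2|exact P2].
      - replace (2 * (Ci * (d1 * e3)))%C with (2 * Ci * (d1 * e3))%C by ring.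
        apply T; [rewrite Cmod_mult, Ci1, C2; ring|exact P3].
      - replace (- (2) * (Ci * (d1 * e4)))%C with (- (2) * Ci * (d1 * e4))%C by ring.
        apply T; [rewrite Cmod_mult, Cmod_opp, Ci1, C2; ring|exact P4].
      - apply T2, P2.
      - apply T2, P3.
      - apply T2, P4.
      - right. ring. }
    match goal with |- Cmod ?X <= _ =>
      replace X with (2 / (Z * Z) * (d1 + D g2 s + (D g3 s + D g4 s)) +
        (- (2 / (Z * Z * Z) * S2) + (r1 + (r2 + (r3 + r4)))))%C by (unfold S2; ring) end.
    apply Cmod_triangle_le.
    + apply Cmod_mult_le; [|lra].
      eapply Rle_trans; [apply Cmod_div_le with (p := 2) (q := m * m)|].
      * nra.
      * rewrite Cmod_R, Rabs_right; lra.
      * apply Cmod_mult_ge; lra.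
      * right. field. lra.
    + replace (B * h ^ 3) with (2 / m ^ 3 * ((6 * K * K2 + 3 * K2 ^ 2) * h ^ 3) +
       (4 * K ^ 3 / m ^ 4 * h ^ 3 + (4 * K ^ 3 / m ^ 4 * h ^ 3 + (4 * K ^ 3 / m ^ 4 * h ^ 3 + 4 * K ^ 3 / m ^ 4 * h ^ 3)))).
      2: { unfold B. field. lra. }
      apply Cmod_triangle_le; [|now repeat apply Cmod_triangle_le].
      rewrite Cmod_opp. apply Cmod_mult_le; [|easy].
      eapply Rle_trans; [apply Cmod_div_le with (p := 2) (q := m * m * m)|].
      * assert (0 < m * m) by nra. nra.
      * rewrite Cmod_R, Rabs_right; lra.
      * repeat apply Cmod_mult_ge; nra.
      * right. field. lra.
Qed.

(** * Compactness in the plane and the minimum principle *)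

Definition cbounded (K : C -> Prop) : Prop :=
  exists M, forall w, K w -> Rabs (fst w) <= M /\ Rabs (snd w) <= M.

Definition cclosed (K : C -> Prop) : Prop :=
  forall w, ~ K w -> exists eta, 0 < eta /\ forall w', Cmod (w' - w) < eta -> ~ K w'.

(** Compactness, in the form in which it is used: a property with a positive
    parameter that holds locally with some parameter holds globally with one. *)
Lemma compact_uniform (K : C -> Prop) (P : R -> C -> Prop) :
  cbounded K -> cclosed K ->
  (forall d d' w, 0 < d' <= d -> P d w -> P d' w) ->
  (forall w, K w -> exists eta, 0 < eta /\ forall w', K w' -> Cmod (w' - w) < eta -> P eta w') ->
  exists d, 0 < d /\ forall w, K w -> P d w.
Proof.
  intros [M HM] Hcl Hmon Hloc.
  assert (H : forall w, exists eta : posreal, forall w', K w' -> Cmod (w' - w) < eta -> P eta w').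
  { intros w. destruct (classic (K w)) as [Hw|Hw].
    - destruct (Hloc w Hw) as [eta [He H]]. now exists (mkposreal eta He).
    - destruct (Hcl w Hw) as [eta [He H]]. exists (mkposreal eta He).
      intros w' Hw' Hd. now destruct (H w'). }
  set (eta := fun w => proj1_sig (constructive_indefinite_description _ (H w))).
  assert (Heta : forall w w', K w' -> Cmod (w' - w) < eta w -> P (eta w) w').
  { intros w. apply (proj2_sig (constructive_indefinite_description _ (H w))). }
  destruct (compactness_value_2d (- M) M (- M) M (fun u v => pos_div_2 (eta (u, v)))) as [d Hd].
  exists d. split; [apply cond_pos|]. intros w Hw. destruct (HM w Hw) as [H1 H2].
  apply Rabs_le_between in H1. apply Rabs_le_between in H2.
  assert (HN := NNPP _ (Hd (fst w) (snd w) H1 H2)).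
  destruct HN as [u [v [_ [_ [Hu [Hv Hle]]]]]]. simpl in Hu, Hv, Hle.
  apply (Hmon (eta (u, v))).
  - split; [apply cond_pos|]. generalize (cond_pos (eta (u, v))). lra.
  - apply Heta; [easy|]. eapply Rle_lt_trans; [apply Cmod_le_sum|]. simpl.
    unfold Rminus in *. lra.
Qed.

Definition lsc_on (K : C -> Prop) (f : C -> R) : Prop :=
  forall w, K w -> forall eps, 0 < eps ->
  exists eta, 0 < eta /\ forall w', K w' -> Cmod (w' - w) < eta -> f w - eps < f w'.

Lemma compact_pos (K : C -> Prop) (f : C -> R) :
  cbounded K -> cclosed K -> lsc_on K f -> (forall w, K w -> 0 < f w) ->
  exists m, 0 < m /\ forall w, K w -> m <= f w.
Proof.
  intros Hb Hc Hf Hpos.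
  apply (compact_uniform K (fun m w => m <= f w) Hb Hc).
  - intros d d' w Hd H. lra.
  - intros w Hw. assert (H0 := Hpos w Hw).
    destruct (Hf w Hw (f w / 2) ltac:(lra)) as [eta [He H]].
    exists (Rmin eta (f w / 2)). split; [apply Rmin_glb_lt; lra|].
    intros w' Hw' Hd. generalize (Rmin_l eta (f w / 2)) (Rmin_r eta (f w / 2)). intros.
    generalize (H w' Hw' ltac:(lra)). lra.
Qed.

(** Compactness is applied twice: to bound [f] below, and then to show that an
    infimum that is not attained could be raised. *)
Lemma compact_min (K : C -> Prop) (f : C -> R) (w0 : C) :
  cbounded K -> cclosed K -> lsc_on K f -> K w0 ->
  exists w, K w /\ forall w', K w' -> f w <= f w'.
Proof.
  intros Hb Hc Hf Hw0.
  destruct (compact_uniform K (fun d w => - / d <= f w) Hb Hc) as [d [Hd Hlow]].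
  - intros d d' w Hd H. assert (/ d <= / d') by (apply Rinv_le_contravar; lra). lra.
  - intros w Hw. destruct (Hf w Hw 1 ltac:(lra)) as [eta [He H]].
    set (A := 1 + Rabs (f w - 1)).
    assert (HA : 0 < A) by (unfold A; generalize (Rabs_pos (f w - 1)); lra).
    exists (Rmin eta (/ A)).
    assert (HA' : 0 < / A) by now apply Rinv_0_lt_compat.
    assert (Hm : 0 < Rmin eta (/ A)) by (apply Rmin_glb_lt; lra).
    split; [easy|].
    intros w' Hw' Hd. generalize (Rmin_l eta (/ A)) (Rmin_r eta (/ A)). intros H1 H2.
    apply Rinv_le_contravar in H2; [|easy]. rewrite Rinv_inv in H2.
    generalize (H w' Hw' ltac:(lra)) (Rle_abs (- (f w - 1))). rewrite Rabs_Ropp.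
    assert (EA : A = 1 + Rabs (f w - 1)) by reflexivity. lra.
  - destruct (completeness (fun y => exists w, K w /\ y = - f w)) as [mu [Hub Hlub]].
    { exists (/ d). intros y [w [Hw ->]]. generalize (Hlow w Hw). lra. }
    { now exists (- f w0), w0. }
    apply NNPP. intros Hn.
    assert (Hlt : forall w, K w -> - mu < f w).
    { intros w Hw. destruct (Rle_lt_dec (f w) (- mu)) as [H|H]; [|easy].
      exfalso. apply Hn. exists w. split; [easy|]. intros w' Hw'.
      assert (- f w' <= mu) by (apply Hub; now exists w'). lra. }
    destruct (compact_uniform K (fun d w => - mu + d <= f w) Hb Hc) as [e [He Hlow2]].
    + intros e e' w He H. lra.
    + intros w Hw. assert (H0 := Hlt w Hw).
      destruct (Hf w Hw ((f w + mu) / 2) ltac:(lra)) as [eta [Het H]].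
      exists (Rmin eta ((f w + mu) / 2)). split; [apply Rmin_glb_lt; lra|].
      intros w' Hw' Hdd.
      generalize (Rmin_l eta ((f w + mu) / 2)) (Rmin_r eta ((f w + mu) / 2)). intros.
      generalize (H w' Hw' ltac:(lra)). lra.
    + assert (mu <= mu - e); [|lra].
      apply Hlub. intros y [w [Hw ->]]. generalize (Hlow2 w Hw). lra.
Qed.

Section MinPrinciple.

Variable xi : R -> R.
Hypothesis Hxi : forall s, continuous xi s.

Lemma bval_continuous a b w : a <= b -> alive xi a b w ->
  forall eps, 0 < eps -> exists eta, 0 < eta /\ forall w', Cmod (w' - w) < eta ->
    alive xi a b w' /\ Cmod (bval xi a b w' - bval xi a b w) < eps.
Proof.
  intros Hab [f [Hf E]] eps Heps.
  destruct (alive_stable xi Hxi a b f Hab Hf) as [K [r [HK [Hr Hs]]]]. rewrite E in Hs.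
  exists (Rmin r (eps / K)). split; [apply Rmin_glb_lt; [easy|apply Rdiv_lt_0_compat; lra]|].
  intros w' Hw'. generalize (Rmin_l r (eps / K)) (Rmin_r r (eps / K)). intros H1 H2.
  destruct (Hs w' ltac:(lra)) as [g [Hg [Eg Hgs]]].
  split; [now exists g|].
  rewrite <- Eg, <- E, !bval_eq by auto.
  eapply Rle_lt_trans; [apply Hgs; lra|].
  apply Rlt_le_trans with (K * (eps / K)); [apply Rmult_lt_compat_l; lra|right; field; lra].
Qed.

Lemma bval_Im_lsc (K : C -> Prop) a b : a <= b -> (forall w, K w -> alive xi a b w) ->
  lsc_on K (fun w => snd (bval xi a b w)).
Proof.
  intros Hab HK w Hw eps Heps.
  destruct (bval_continuous a b w Hab (HK w Hw) eps Heps) as [eta [He H]].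
  exists eta. split; [easy|]. intros w' _ Hd. destruct (H w' Hd) as [_ H1].
  assert (H2 := snd_le_Cmod (bval xi a b w' - bval xi a b w)%C). simpl in H2.
  apply Rabs_le_between in H2. lra.
Qed.

Definition quad (q0 q1 q2 al be : R) (w : C) : R :=
  q0 + q1 * fst w + q2 * snd w + al * fst w ^ 2 + be * snd w ^ 2.

Lemma quad_usc q0 q1 q2 al be w eps : 0 < eps ->
  exists eta, 0 < eta /\ forall w', Cmod (w' - w) < eta ->
    quad q0 q1 q2 al be w' < quad q0 q1 q2 al be w + eps.
Proof.
  intros Heps.
  set (A := 1 + (Rabs q1 + Rabs q2 + Rabs al * (2 * Rabs (fst w) + 1) + Rabs be * (2 * Rabs (snd w) + 1))).
  assert (HA : 1 <= A).
  { unfold A. generalize (Rabs_pos q1) (Rabs_pos q2) (Rabs_pos al) (Rabs_pos be)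
      (Rabs_pos (fst w)) (Rabs_pos (snd w)). intros. nra. }
  exists (Rmin 1 (eps / A)). split; [apply Rmin_glb_lt; [lra|apply Rdiv_lt_0_compat; lra]|].
  intros w' Hw'. generalize (Rmin_l 1 (eps / A)) (Rmin_r 1 (eps / A)). intros H1 H2.
  set (d := Cmod (w' - w)) in *. assert (Hd : 0 <= d) by apply Cmod_ge_0.
  set (x := fst w' - fst w). set (y := snd w' - snd w).
  assert (Hx : Rabs x <= d) by apply (fst_le_Cmod (w' - w)%C).
  assert (Hy : Rabs y <= d) by apply (snd_le_Cmod (w' - w)%C).
  assert (HAd : A * d < eps).
  { apply Rlt_le_trans with (A * (eps / A)); [apply Rmult_lt_compat_l; lra|right; field; lra]. }
  enough (Hle : quad q0 q1 q2 al be w' - quad q0 q1 q2 al be w <= A * d) by lra.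
  replace (quad q0 q1 q2 al be w' - quad q0 q1 q2 al be w) with
    (q1 * x + q2 * y + al * ((2 * fst w + x) * x) + be * ((2 * snd w + y) * y)) by (unfold quad, x, y; ring).
  assert (T : forall c u k, 0 <= k -> Rabs u <= k * d -> c * u <= Rabs c * k * d).
  { intros c u k Hk Hu. eapply Rle_trans; [apply Rle_abs|]. rewrite Rabs_mult, Rmult_assoc.
    apply Rmult_le_compat_l; [apply Rabs_pos|easy]. }
  assert (S : forall p u, Rabs u <= d -> Rabs ((2 * p + u) * u) <= (2 * Rabs p + 1) * d).
  { intros p u Hu. rewrite Rabs_mult. apply Rmult_le_compat; try apply Rabs_pos; [|easy].
    eapply Rle_trans; [apply Rabs_triang|]. rewrite Rabs_mult, (Rabs_right 2) by lra. lra. }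
  generalize (T q1 x 1 ltac:(lra) ltac:(lra)) (T q2 y 1 ltac:(lra) ltac:(lra)).
  assert (T3 := T al ((2 * fst w + x) * x) (2 * Rabs (fst w) + 1)
     ltac:(generalize (Rabs_pos (fst w)); lra) (S _ _ Hx)).
  assert (T4 := T be ((2 * snd w + y) * y) (2 * Rabs (snd w) + 1)
     ltac:(generalize (Rabs_pos (snd w)); lra) (S _ _ Hy)).
  unfold A. lra.
Qed.

(** The discrete harmonicity of the imaginary part, against the positive
    Laplacian of the quadratic, excludes an interior minimum of their
    difference. *)
Lemma min_principle (K : C -> Prop) a b q0 q1 q2 al be :
  a <= b -> cbounded K -> cclosed K -> (forall w, K w -> alive xi a b w) ->
  0 < al + be ->
  (forall w, K w -> (exists eta, 0 < eta /\ forall w', Cmod (w' - w) < eta -> K w') \/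
     quad q0 q1 q2 al be w <= snd (bval xi a b w)) ->
  forall w, K w -> quad q0 q1 q2 al be w <= snd (bval xi a b w).
Proof.
  intros Hab Hb Hc HK Hlap Hbd w0 Hw0.
  set (q := quad q0 q1 q2 al be) in *. set (v := fun w => snd (bval xi a b w)).
  destruct (compact_min K (fun w => v w - q w) w0 Hb Hc) as [w [Hw Hmin]]; [|easy|].
  { intros w Hw eps Heps.
    destruct (bval_Im_lsc K a b Hab HK w Hw (eps / 2) ltac:(lra)) as [e1 [He1 H1]].
    destruct (quad_usc q0 q1 q2 al be w (eps / 2) ltac:(lra)) as [e2 [He2 H2]].
    exists (Rmin e1 e2). split; [now apply Rmin_glb_lt|].
    intros w' Hw' Hd. generalize (Rmin_l e1 e2) (Rmin_r e1 e2). intros.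
    generalize (H1 w' Hw' ltac:(lra)) (H2 w' ltac:(lra)). unfold v, q. lra. }
  enough (0 <= v w - q w) by (generalize (Hmin w0 Hw0); unfold v in *; lra).
  destruct (Rle_lt_dec 0 (v w - q w)) as [Hge|Hneg]; [easy|exfalso].
  (* at an interior minimum the four-point sum of [v] is at least that of [q],
     which is [2 (al + be) h ^ 2], against [four_point] *)
  destruct (Hbd w Hw) as [[eta [Heta Hint]]|H]; [|unfold v in Hneg; lra].
  destruct (four_point xi a b w Hxi Hab (HK w Hw)) as [M [h0 [Hh0 H4]]].
  set (A := Rabs M + 1). assert (HA : 0 < A) by (unfold A; generalize (Rabs_pos M); lra).
  set (h := Rmin (Rmin h0 eta) (2 * (al + be) / A) / 2).
  assert (Hh : 0 < h /\ h < h0 /\ h < eta /\ h < 2 * (al + be) / A).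
  { assert (0 < Rmin (Rmin h0 eta) (2 * (al + be) / A)).
    { repeat apply Rmin_glb_lt; try easy. apply Rdiv_lt_0_compat; lra. }
    generalize (Rmin_l (Rmin h0 eta) (2 * (al + be) / A)) (Rmin_r (Rmin h0 eta) (2 * (al + be) / A))
     (Rmin_l h0 eta) (Rmin_r h0 eta). unfold h. lra. }
  clearbody h. destruct Hh as [Hh1 [Hh2 [Hh3 Hh5]]].
  assert (HhM : M * h ^ 3 < 2 * (al + be) * h ^ 2).
  { apply (Rmult_lt_compat_l A) in Hh5; [|easy].
    replace (A * (2 * (al + be) / A)) with (2 * (al + be)) in Hh5 by (field; lra).
    assert (M <= A) by (unfold A; generalize (Rle_abs M); lra).
    replace (M * h ^ 3) with (M * h * h ^ 2) by ring.
    apply Rmult_lt_compat_r; [now apply pow_lt|]. nra. }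
  assert (Hs := H4 h (conj Hh1 Hh2)).
  assert (Hn : forall c, Cmod c = 1 -> v w - q w <= v (w + c * RtoC h)%C - q (w + c * RtoC h)%C).
  { intros c Hc1. apply Hmin, Hint. replace (w + c * h - w)%C with (c * RtoC h)%C by ring.
    rewrite Cmod_mult, Hc1, Cmod_R, Rabs_right; lra. }
  assert (Ci1 : Cmod Ci = 1).
  { unfold Cmod. simpl. replace (0 * (0 * 1) + 1 * (1 * 1)) with 1 by ring. apply sqrt_1. }
  assert (N1 := Hn 1%C Cmod_1).
  assert (N2 := Hn (- (1))%C ltac:(rewrite Cmod_opp; apply Cmod_1)).
  assert (N3 := Hn Ci Ci1).
  assert (N4 := Hn (- Ci)%C ltac:(now rewrite Cmod_opp)).
  replace (w + 1 * RtoC h)%C with (w + RtoC h)%C in N1 by ring.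
  replace (w + - (1) * RtoC h)%C with (w - RtoC h)%C in N2 by ring.
  replace (w + - Ci * RtoC h)%C with (w - Ci * RtoC h)%C in N4 by ring.
  assert (Hq : q (w + RtoC h)%C + q (w - RtoC h)%C + q (w + Ci * RtoC h)%C + q (w - Ci * RtoC h)%C
     = 4 * q w + 2 * (al + be) * h ^ 2).
  { unfold q, quad. simpl. ring. }
  set (Sm := (bval xi a b (w + RtoC h) + bval xi a b (w - RtoC h)
        + bval xi a b (w + Ci * RtoC h) + bval xi a b (w - Ci * RtoC h) - 4 * bval xi a b w)%C) in *.
  assert (HS : snd Sm = v (w + RtoC h)%C + v (w - RtoC h)%C + v (w + Ci * RtoC h)%C + v (w - Ci * RtoC h)%C - 4 * v w).
  { unfold Sm, v. simpl. ring. }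
  assert (HS2 : snd Sm <= M * h ^ 3).
  { eapply Rle_trans; [apply Rle_abs|]. eapply Rle_trans; [apply snd_le_Cmod|exact Hs]. }
  lra.
Qed.

End MinPrinciple.

(** * Displacement by the flow over short times *)

Lemma cmvt (f f' : R -> C) (a b M : R) : a <= b ->
  (forall s, a <= s <= b -> cderive f s (f' s)) ->
  (forall s, a <= s <= b -> Cmod (f' s) <= M) ->
  Cmod (f b - f a) <= 2 * M * (b - a).
Proof.
  intros Hab Hd HM.
  assert (H : forall u u' : R -> R, (forall s, a <= s <= b -> is_derive u s (u' s)) ->
    (forall s, a <= s <= b -> Rabs (u' s) <= M) -> Rabs (u b - u a) <= M * (b - a)).
  { intros u u' Hu HuM. apply Rabs_le. split.
    - rewrite <- Ropp_mult_distr_l_reverse. apply (mvt_ge u u'); auto.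
      intros s Hs. now destruct (proj1 (Rabs_le_between _ _) (HuM s Hs)).
    - apply (mvt_le u u'); auto.
      intros s Hs. now destruct (proj1 (Rabs_le_between _ _) (HuM s Hs)). }
  eapply Rle_trans; [apply Cmod_le_sum|]. simpl.
  replace (2 * M * (b - a)) with (M * (b - a) + M * (b - a)) by ring.
  apply Rplus_le_compat.
  - apply (H (fun s => fst (f s)) (fun s => fst (f' s))).
    + intros s Hs. now apply Hd.
    + intros s Hs. eapply Rle_trans; [apply fst_le_Cmod|now apply HM].
  - apply (H (fun s => snd (f s)) (fun s => snd (f' s))).
    + intros s Hs. now apply Hd.
    + intros s Hs. eapply Rle_trans; [apply snd_le_Cmod|now apply HM].
Qed.

Lemma Cmod_sub_continuity (f : R -> C) (c : R -> R) (s : R) (l : C) :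
  cderive f s l -> continuous c s -> continuity_pt (fun s => Cmod (f s - RtoC (c s))) s.
Proof.
  intros [H1 H2] Hc. apply is_derive_continuity_pt in H1. apply is_derive_continuity_pt in H2.
  apply (continuity_pt_comp (fun s => fst (f s - RtoC (c s))%C ^ 2 + snd (f s - RtoC (c s))%C ^ 2) sqrt).
  - assert (Sq : forall u : R -> R, continuity_pt u s -> continuity_pt (fun s => u s ^ 2) s).
    { intros u Hu. apply (continuity_pt_comp u (fun x => x ^ 2)); [easy|].
      apply derivable_continuous_pt, derivable_pt_pow. }
    apply continuity_pt_plus; apply Sq.
    + apply continuity_pt_filterlim in Hc.
      apply continuity_pt_ext with (fun s => fst (f s) - c s); [intros; now rewrite fst_sub_R|].
      now apply continuity_pt_minus.
    + apply continuity_pt_ext with (fun s => snd (f s)); [intros; now rewrite snd_sub_R|easy].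
  - apply continuity_pt_sqrt. nra.
Qed.

(** While the driver stays within [R0] of [c], points at distance at least
    [3 R0] from [c] move at speed at most [1 / R0], hence by at most [R0 / 2]
    in time [R0 ^ 2 / 4].  So backward solutions neither come in from outside
    [4 R0] to [3 R0] nor leave from [4 R0] to [5 R0]. *)
Section Displacement.

Variable xi : R -> R.
Hypothesis Hxi : forall s, continuous xi s.
Variables (a b c R0 : R).
Hypothesis Hab : a <= b.
Hypothesis HR : 0 < R0.
Hypothesis Hshort : 4 * (b - a) <= R0 ^ 2.
Hypothesis Hosc : forall s, a <= s <= b -> Rabs (xi s - c) <= R0.

Lemma driver_dist z s : a <= s <= b -> Cmod (z - RtoC c) - R0 <= Cmod (z - RtoC (xi s)).
Proof.
  intros Hs. assert (H := Hosc s Hs).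
  assert (H1 := Cmod_triangle (z - RtoC (xi s)) (RtoC (xi s - c))).
  rewrite Cmod_R in H1.
  replace (z - RtoC (xi s) + RtoC (xi s - c))%C with (z - RtoC c)%C in H1
    by (rewrite RtoC_minus; ring).
  lra.
Qed.

Lemma displacement_far f s0 s1 s2 : a <= s0 -> hsol xi s0 b f -> s0 <= s1 -> s1 <= s2 -> s2 <= b ->
  (forall s, s1 <= s <= s2 -> 3 * R0 <= Cmod (f s - RtoC c)) -> Cmod (f s2 - f s1) <= R0 / 2.
Proof.
  intros Ha Hf H1 H12 H2 Hfar.
  apply Rle_trans with (2 * (/ R0) * (s2 - s1)).
  - apply (cmvt f (fun s => vf (f s - RtoC (xi s))%C)); [easy| |].
    + intros s Hs. apply Hf. lra.
    + intros s Hs. assert (D := driver_dist (f s) s ltac:(lra)).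
      assert (F := Hfar s Hs). rewrite vf_mod by (eapply Cmod_nonzero with (m := R0); lra).
      apply Rle_trans with (2 / (2 * R0)); [|right; field; lra].
      apply Rmult_le_compat_l; [lra|]. apply Rinv_le_contravar; lra.
  - apply Rle_trans with (2 * / R0 * (R0 ^ 2 / 4)); [|right; field; lra].
    apply Rmult_le_compat_l; [|lra]. generalize (Rinv_0_lt_compat R0 HR). lra.
Qed.

Lemma hsol_dist_continuity f s0 k s : hsol xi s0 b f -> s0 <= s <= b ->
  continuity_pt (fun s => Cmod (f s - RtoC c) - k) s.
Proof.
  intros Hf Hs. apply continuity_pt_minus; [|apply continuity_pt_const; now intros ? ?].
  apply (Cmod_sub_continuity f (fun _ => c) s (vf (f s - RtoC (xi s))%C)).
  - now apply Hf.
  - apply continuous_const.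
Qed.

Lemma stays_far f s0 s : a <= s0 -> hsol xi s0 b f -> 4 * R0 <= Cmod (f b - RtoC c) ->
  s0 <= s <= b -> 3 * R0 <= Cmod (f s - RtoC c).
Proof.
  intros Ha Hf Hb Hs. destruct (Rle_lt_dec (3 * R0) (Cmod (f s - RtoC c))) as [H|H]; [easy|exfalso].
  destruct (last_zero (fun s => Cmod (f s - RtoC c) - 3 * R0) s b) as [z [Hz [Hz0 Hzp]]]; try lra.
  { intros r Hr. apply (hsol_dist_continuity f s0); auto. lra. }
  assert (D := displacement_far f s0 z b Ha Hf ltac:(lra) ltac:(lra) ltac:(lra)).
  assert (D' : Cmod (f b - f z) <= R0 / 2).
  { apply D. intros r Hr. destruct (Req_dec r z) as [->|Hne]; [lra|].
    generalize (Hzp r ltac:(lra)). lra. }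
  assert (T := Cmod_triangle (f z - RtoC c) (f b - f z)).
  replace (f z - RtoC c + (f b - f z))%C with (f b - RtoC c)%C in T by ring. lra.
Qed.

Lemma stays_near f s : hsol xi a b f -> Cmod (f b - RtoC c) <= 4 * R0 -> a <= s <= b ->
  Cmod (f s - RtoC c) <= 5 * R0.
Proof.
  intros Hf Hb Hs. destruct (Rle_lt_dec (Cmod (f s - RtoC c)) (5 * R0)) as [H|H]; [easy|exfalso].
  destruct (first_zero (fun s => Cmod (f s - RtoC c) - 4 * R0) s b) as [z [Hz [Hz0 Hzp]]]; try lra.
  { intros r Hr. apply (hsol_dist_continuity f a); auto. lra. }
  assert (D := displacement_far f a s z ltac:(lra) Hf ltac:(lra) ltac:(lra) ltac:(lra)).
  assert (D' : Cmod (f z - f s) <= R0 / 2).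
  { apply D. intros r Hr. destruct (Req_dec r z) as [->|Hne]; [lra|].
    generalize (Hzp r ltac:(lra)). lra. }
  assert (T := Cmod_triangle (f z - RtoC c) (- (f z - f s))).
  rewrite Cmod_opp in T.
  replace (f z - RtoC c + - (f z - f s))%C with (f s - RtoC c)%C in T by ring. lra.
Qed.

Lemma far_alive w : 0 < snd w -> 4 * R0 <= Cmod (w - RtoC c) -> alive xi a b w.
Proof.
  intros Hw Hfar.
  apply (alive_continuation xi Hxi (fun w' => w' = w) a b (snd w / 2)); auto; try lra.
  - now intros ? ->.
  - intros s Hs _ f Hf E.
    assert (G := mvt_le (fun s => snd (f s)) (fun s => snd (vf (f s - RtoC (xi s))%C)) s b
      (snd w / (2 * R0 ^ 2)) ltac:(lra)).
    assert (HG : snd (f b) - snd (f s) <= snd w / (2 * R0 ^ 2) * (b - s)).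
    { apply G; intros r Hr; [now apply Hf|].
      assert (S := stays_far f s r ltac:(lra) Hf ltac:(now rewrite E) Hr).
      assert (D := driver_dist (f r) r ltac:(lra)).
      assert (HI : 0 < snd (f r) <= snd w).
      { split; [now apply Hf|]. rewrite <- E. apply (hsol_Im_incr xi s b f); auto; lra. }
      rewrite vf_snd, snd_sub_R, <- (snd_sub_R (f r) (xi r)) at 1.
      replace (snd (f r) ^ 2) with (snd (f r - RtoC (xi r))%C ^ 2) by (now rewrite snd_sub_R).
      rewrite <- Cmod_sq, snd_sub_R.
      apply Rle_trans with (2 * snd w / (4 * R0 ^ 2)); [|right; field; lra].
      assert (0 < R0 ^ 2) by now apply pow_lt.
      unfold Rdiv. apply Rmult_le_compat; try lra.
      - apply Rlt_le, Rinv_0_lt_compat, pow_lt. lra.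
      - apply Rinv_le_contravar; [nra|].
        assert (2 * R0 <= Cmod (f r - RtoC (xi r))) by lra. nra. }
    rewrite E in HG.
    assert (snd w / (2 * R0 ^ 2) * (b - s) <= snd w / (2 * R0 ^ 2) * (R0 ^ 2 / 4)).
    { apply Rmult_le_compat_l; [|lra]. apply Rlt_le, Rdiv_lt_0_compat; nra. }
    replace (snd w / (2 * R0 ^ 2) * (R0 ^ 2 / 4)) with (snd w / 8) in H by (field; lra). lra.
Qed.

End Displacement.

(** * A boundary estimate of Hopf type *)

Lemma bval_Im_pos xi a b w : a <= b -> alive xi a b w -> 0 < snd (bval xi a b w).
Proof.
  intros Hab [f [Hf <-]]. rewrite bval_eq by auto. apply Hf. lra.
Qed.

Definition rect (x0 x1 y0 y1 : R) (w : C) : Prop := x0 <= fst w <= x1 /\ y0 <= snd w <= y1.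

Lemma rect_bounded x0 x1 y0 y1 : cbounded (rect x0 x1 y0 y1).
Proof.
  exists (Rabs x0 + Rabs x1 + Rabs y0 + Rabs y1). intros w [H1 H2].
  generalize (Rle_abs x0) (Rle_abs x1) (Rle_abs y0) (Rle_abs y1)
    (Rle_abs (- x0)) (Rle_abs (- x1)) (Rle_abs (- y0)) (Rle_abs (- y1)).
  rewrite !Rabs_Ropp. intros.
  generalize (Rabs_pos x0) (Rabs_pos x1) (Rabs_pos y0) (Rabs_pos y1). intros.
  split; apply Rabs_le; lra.
Qed.

Lemma close_coordinates (w w' : C) (eta : R) : Cmod (w' - w) < eta ->
  fst w - eta < fst w' < fst w + eta /\ snd w - eta < snd w' < snd w + eta.
Proof.
  intros H. assert (H1 := fst_le_Cmod (w' - w)%C). assert (H2 := snd_le_Cmod (w' - w)%C).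
  simpl in H1, H2. apply Rabs_le_between in H1. apply Rabs_le_between in H2. lra.
Qed.

Lemma rect_closed x0 x1 y0 y1 : cclosed (rect x0 x1 y0 y1).
Proof.
  intros w Hw.
  assert (H : fst w < x0 \/ x1 < fst w \/ snd w < y0 \/ y1 < snd w).
  { apply NNPP. intros Hn. apply Hw. unfold rect. lra. }
  destruct H as [H|[H|[H|H]]];
    [exists (x0 - fst w)|exists (fst w - x1)|exists (y0 - snd w)|exists (snd w - y1)];
    (split; [lra|]); intros w' Hc; apply close_coordinates in Hc; unfold rect; lra.
Qed.

Lemma rect_interior x0 x1 y0 y1 w : x0 < fst w < x1 -> y0 < snd w < y1 ->
  exists eta, 0 < eta /\ forall w', Cmod (w' - w) < eta -> rect x0 x1 y0 y1 w'.
Proof.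
  intros Hx Hy.
  exists (Rmin (Rmin (fst w - x0) (x1 - fst w)) (Rmin (snd w - y0) (y1 - snd w))).
  split; [repeat apply Rmin_glb_lt; lra|].
  intros w' Hc. apply close_coordinates in Hc.
  generalize (Rmin_l (Rmin (fst w - x0) (x1 - fst w)) (Rmin (snd w - y0) (y1 - snd w)))
    (Rmin_r (Rmin (fst w - x0) (x1 - fst w)) (Rmin (snd w - y0) (y1 - snd w)))
    (Rmin_l (fst w - x0) (x1 - fst w)) (Rmin_r (fst w - x0) (x1 - fst w))
    (Rmin_l (snd w - y0) (y1 - snd w)) (Rmin_r (snd w - y0) (y1 - snd w)).
  unfold rect. lra.
Qed.

(** The minimum principle on the rectangles [d <= y <= r / 4] around a point
    [p'], compared with a multiple of the quadratic
    [y - d + A (y - d)^2 - B (x - p')^2], which is nonpositive on the bottom and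
    on the sides and, as [A > B], strictly subharmonic; finally [d] tends
    to [0]. *)
Lemma hopf xi a b p r :
  (forall s, continuous xi s) -> a <= b -> 0 < r ->
  (forall w, Rabs (fst w - p) <= r -> 0 < snd w <= r -> alive xi a b w) ->
  exists kappa, 0 < kappa <= 1 /\ forall w, Rabs (fst w - p) <= r / 2 -> 0 < snd w <= r / 4 ->
    kappa * snd w <= snd (bval xi a b w).
Proof.
  intros Hxi Hab Hr Hal.
  destruct (compact_pos (rect (p - r) (p + r) (r / 4) (r / 4)) (fun w => snd (bval xi a b w)))
    as [k0 [Hk0 Htop]].
  - apply rect_bounded.
  - apply rect_closed.
  - apply bval_Im_lsc; auto. intros w [H1 H2]. apply Hal; [apply Rabs_le|]; lra.
  - intros w [H1 H2]. apply bval_Im_pos; auto. apply Hal; [apply Rabs_le|]; lra.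
  - (* with this factor the barrier is at most [k0] on the top edge *)
    set (k := 2 * k0 / r). assert (Hk : 0 < k) by (apply Rdiv_lt_0_compat; lra).
    exists (Rmin k 1). split; [split; [apply Rmin_glb_lt; lra|apply Rmin_r]|].
    intros w Hw1 Hw2. apply Rle_trans with (k * snd w).
    { apply Rmult_le_compat_r; [lra|apply Rmin_l]. }
    assert (Hd : forall d, 0 < d < snd w -> k * (snd w - d) <= snd (bval xi a b w)).
    { intros d Hd.
      set (q := fun w' => k * ((snd w' - d) + 4 / r * (snd w' - d) ^ 2 - 2 / r * (fst w' - fst w) ^ 2)).
      assert (Eq : forall w', quad (k * (- d + 4 / r * d ^ 2 - 2 / r * fst w ^ 2)) (k * (4 / r * fst w))
         (k * (1 - 8 / r * d)) (- (k * (2 / r))) (k * (4 / r)) w' = q w').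
      { intros w'. unfold quad, q. field. lra. }
      apply Rabs_le_between in Hw1.
      assert (Hq : q w <= snd (bval xi a b w)).
      { rewrite <- Eq.
        apply (min_principle xi Hxi (rect (fst w - r / 2) (fst w + r / 2) d (r / 4))); auto.
        - apply rect_bounded.
        - apply rect_closed.
        - intros w' [H1 H2]. apply Hal; [apply Rabs_le|]; lra.
        - replace (- (k * (2 / r)) + k * (4 / r)) with (k * 2 / r) by (field; lra).
          apply Rdiv_lt_0_compat; lra.
        - intros w' Hw'. rewrite Eq. destruct Hw' as [H1 H2].
          assert (Hv : 0 < snd (bval xi a b w')).
          { apply bval_Im_pos; auto. apply Hal; [apply Rabs_le|]; lra. }
          assert (Hi : 0 < / r) by now apply Rinv_0_lt_compat.
          set (t := snd w' - d). assert (Ht : 0 <= t <= r / 4) by (unfold t; lra).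
          assert (Ht2 : t + 4 / r * t ^ 2 <= r / 2).
          { assert (t ^ 2 <= (r / 4) ^ 2) by (apply pow_incr; lra).
            assert (4 / r * t ^ 2 <= 4 / r * (r / 4) ^ 2) by (apply Rmult_le_compat_l; [unfold Rdiv; nra|easy]).
            replace (4 / r * (r / 4) ^ 2) with (r / 4) in H0 by (field; lra). lra. }
          assert (Hx2 : 0 <= 2 / r * (fst w' - fst w) ^ 2).
          { apply Rmult_le_pos; [unfold Rdiv; nra|apply pow2_ge_0]. }
          destruct (Rle_lt_dec (snd w') d) as [Hbot|Hbot].
          { right. unfold q. replace (snd w' - d) with 0 by lra.
            apply Rle_trans with 0; [|lra]. simpl (0 ^ 2). nra. }
          destruct (Rle_lt_dec (r / 4) (snd w')) as [Htp|Htp].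
          { right. apply Rle_trans with k0.
            - unfold q. fold t. replace k0 with (k * (r / 2)) by (unfold k; field; lra).
              apply Rmult_le_compat_l; lra.
            - apply Htop. unfold rect. lra. }
          destruct (Rle_lt_dec (r / 2) (Rabs (fst w' - fst w))) as [Hs|Hs].
          { right. apply Rle_trans with 0; [|lra]. unfold q. fold t.
            assert (r / 2 <= 2 / r * (fst w' - fst w) ^ 2); [|nra].
            rewrite <- (pow2_abs (fst w' - fst w)).
            apply Rle_trans with (2 / r * (r / 2) ^ 2); [right; field; lra|].
            apply Rmult_le_compat_l; [unfold Rdiv; nra|]. apply pow_incr; lra. }
          left. apply Rabs_def2 in Hs. apply rect_interior; lra.
        - unfold rect. lra. }
      eapply Rle_trans; [|exact Hq]. unfold q.
      rewrite Rminus_diag. assert (Hi : 0 < / r) by now apply Rinv_0_lt_compat.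
      apply Rmult_le_compat_l; [lra|].
      assert (0 <= 4 / r * (snd w - d) ^ 2).
      { apply Rmult_le_pos; [unfold Rdiv; nra|apply pow2_ge_0]. }
      simpl (0 ^ 2). lra. }
    destruct (Rle_lt_dec (k * snd w) (snd (bval xi a b w))) as [H|H]; [easy|exfalso].
    set (v := snd (bval xi a b w)) in *.
    assert (Hv : 0 < v).
    { apply bval_Im_pos; auto. apply Hal; [|lra]. lra. }
    (* a [d] small enough to contradict [Hd] if the bound failed at [d = 0] *)
    set (d := (snd w - v / k) / 2).
    assert (Hvk : v / k < snd w).
    { apply Rmult_lt_reg_l with k; [easy|]. replace (k * (v / k)) with v by (field; lra). lra. }
    assert (0 < v / k) by now apply Rdiv_lt_0_compat.
    assert (Hc := Hd d ltac:(unfold d; lra)).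
    replace (snd w - d) with (v / k + d) in Hc by (unfold d; field; lra).
    rewrite Rmult_plus_distr_l in Hc. replace (k * (v / k)) with v in Hc by (field; lra).
    assert (0 < k * d) by (apply Rmult_lt_0_compat; [|unfold d]; lra). lra.
Qed.

(** * A driver cannot run into a surviving stretch of the boundary *)

Lemma is_derive_pair (X1 Y1 X2 Y2 : R -> R) (s l1 m1 l2 m2 : R) :
  is_derive X1 s l1 -> is_derive Y1 s m1 -> is_derive X2 s l2 -> is_derive Y2 s m2 ->
  0 < Y1 s -> 0 < Y2 s ->
  is_derive (fun s => ((X1 s - X2 s) ^ 2 + (Y1 s - Y2 s) ^ 2) * (Y1 s * Y2 s)) s
    (2 * ((X1 s - X2 s) * (l1 - l2) + (Y1 s - Y2 s) * (m1 - m2)) * (Y1 s * Y2 s) +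
     ((X1 s - X2 s) ^ 2 + (Y1 s - Y2 s) ^ 2) * (m1 * Y2 s + Y1 s * m2)) /\
  is_derive (fun s => ((X1 s - X2 s) ^ 2 + (Y1 s - Y2 s) ^ 2) / (Y1 s * Y2 s)) s
    (2 * ((X1 s - X2 s) * (l1 - l2) + (Y1 s - Y2 s) * (m1 - m2)) / (Y1 s * Y2 s) -
     ((X1 s - X2 s) ^ 2 + (Y1 s - Y2 s) ^ 2) * (m1 * Y2 s + Y1 s * m2) / (Y1 s * Y2 s) ^ 2).
Proof.
  intros D1 D2 D3 D4 H1 H2.
  assert (E1 : ex_derive X1 s) by now exists l1.
  assert (E2 : ex_derive Y1 s) by now exists m1.
  assert (E3 : ex_derive X2 s) by now exists l2.
  assert (E4 : ex_derive Y2 s) by now exists m2.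
  apply is_derive_unique in D1, D2, D3, D4.
  split.
  - auto_derive; [tauto|].
    change (fun x : R => X1 x) with X1. change (fun x : R => X2 x) with X2.
    change (fun x : R => Y1 x) with Y1. change (fun x : R => Y2 x) with Y2.
    rewrite D1, D2, D3, D4. ring.
  - auto_derive.
    + assert (Y1 s * Y2 s <> 0) by (apply Rgt_not_eq; nra). tauto.
    + change (fun x : R => X1 x) with X1. change (fun x : R => X2 x) with X2.
      change (fun x : R => Y1 x) with Y1. change (fun x : R => Y2 x) with Y2.
      rewrite D1, D2, D3, D4. field. lra.
Qed.

Section PairAlgebra.

Variables (a1 b1 a2 b2 : R).
Hypothesis (Hb1 : 0 < b1) (Hb2 : 0 < b2).

Let S1 := a1 ^ 2 + b1 ^ 2.
Let S2 := a2 ^ 2 + b2 ^ 2.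
Let N := (a1 - a2) ^ 2 + (b1 - b2) ^ 2.
Let T := (a1 - a2) * (-2 * a1 / S1 - -2 * a2 / S2) + (b1 - b2) * (2 * b1 / S1 - 2 * b2 / S2).

Lemma pair_sums_pos : 0 < S1 /\ 0 < S2.
Proof. unfold S1, S2. generalize (pow2_ge_0 a1) (pow2_ge_0 a2). split; nra. Qed.

Lemma pair_T : T = 2 * N * (a1 * a2 - b1 * b2) / (S1 * S2).
Proof.
  destruct pair_sums_pos as [H1 H2]. unfold T, N, S1, S2 in *. field. split; lra.
Qed.

Lemma pair_increasing :
  0 <= 2 * T * (b1 * b2) + N * (2 * b1 / S1 * b2 + b1 * (2 * b2 / S2)).
Proof.
  destruct pair_sums_pos as [H1 H2]. rewrite pair_T.
  replace (_ + _) with (2 * N * (b1 * b2) * ((a1 + a2) ^ 2 + (b1 - b2) ^ 2) / (S1 * S2))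
    by (unfold S1, S2 in *; field; lra).
  assert (0 <= N) by (apply Rplus_le_le_0_compat; apply pow2_ge_0).
  apply Rdiv_le_0_compat; [|now apply Rmult_lt_0_compat].
  assert (0 < b1 * b2) by now apply Rmult_lt_0_compat.
  apply Rmult_le_pos; [apply Rmult_le_pos; lra|apply Rplus_le_le_0_compat; apply pow2_ge_0].
Qed.

Lemma pair_decreasing :
  2 * T / (b1 * b2) - N * (2 * b1 / S1 * b2 + b1 * (2 * b2 / S2)) / (b1 * b2) ^ 2 <= 0.
Proof.
  destruct pair_sums_pos as [H1 H2]. rewrite pair_T.
  replace (_ - _) with (- (2 * N * ((a1 - a2) ^ 2 + (b1 + b2) ^ 2) / (S1 * S2 * (b1 * b2))))
    by (unfold S1, S2 in *; field; lra).
  assert (0 <= N) by (apply Rplus_le_le_0_compat; apply pow2_ge_0).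
  assert (0 < b1 * b2) by now apply Rmult_lt_0_compat.
  assert (0 <= 2 * N * ((a1 - a2) ^ 2 + (b1 + b2) ^ 2) / (S1 * S2 * (b1 * b2))); [|lra].
  apply Rdiv_le_0_compat.
  - apply Rmult_le_pos; [lra|apply Rplus_le_le_0_compat; apply pow2_ge_0].
  - repeat apply Rmult_lt_0_compat; easy.
Qed.

End PairAlgebra.

(** With [Z], [W] the positions relative to the driver, the logarithmic
    derivative of the distance is [2 Re (1 / (Z W))], and those of the imaginary
    parts are [2 / |Z|^2] and [2 / |W|^2].  So the distance changes at most by
    the factors by which the imaginary parts change. *)
Lemma hsol_distortion xi a b f g s : hsol xi a b f -> hsol xi a b g -> a <= s <= b ->
  Cmod (f s - g s) ^ 2 * (snd (f s) * snd (g s)) <= Cmod (f b - g b) ^ 2 * (snd (f b) * snd (g b)) /\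
  Cmod (f b - g b) ^ 2 / (snd (f b) * snd (g b)) <= Cmod (f s - g s) ^ 2 / (snd (f s) * snd (g s)).
Proof.
  intros Hf Hg Hs.
  assert (D := fun r (Hr : a <= r <= b) => is_derive_pair (fun s => fst (f s)) (fun s => snd (f s))
     (fun s => fst (g s)) (fun s => snd (g s)) r _ _ _ _
     (proj1 (proj2 (Hf r Hr))) (proj2 (proj2 (Hf r Hr)))
     (proj1 (proj2 (Hg r Hr))) (proj2 (proj2 (Hg r Hr)))
     (proj1 (Hf r Hr)) (proj1 (Hg r Hr))).
  rewrite !Cmod_sq. cbn [fst snd Cminus Cplus Copp].
  assert (E : forall r, fst (f r) - fst (g r) = (fst (f r) - xi r) - (fst (g r) - xi r)) by (intros; ring).
  split.
  - match goal with |- _ <= ?R => enough (0 * (b - s) <= R -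
      ((fst (f s) + - fst (g s)) ^ 2 + (snd (f s) + - snd (g s)) ^ 2) * (snd (f s) * snd (g s))) by lra end.
    apply (mvt_ge (fun s => ((fst (f s) + - fst (g s)) ^ 2 + (snd (f s) + - snd (g s)) ^ 2) * (snd (f s) * snd (g s)))
      (fun r => 2 * ((fst (f r) - fst (g r)) * (fst (vf (f r - RtoC (xi r))) - fst (vf (g r - RtoC (xi r)))) +
        (snd (f r) - snd (g r)) * (snd (vf (f r - RtoC (xi r))) - snd (vf (g r - RtoC (xi r))))) * (snd (f r) * snd (g r)) +
       ((fst (f r) - fst (g r)) ^ 2 + (snd (f r) - snd (g r)) ^ 2) *
        (snd (vf (f r - RtoC (xi r))) * snd (g r) + snd (f r) * snd (vf (g r - RtoC (xi r)))))); [lra| |].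
    + intros r Hr. exact (proj1 (D r ltac:(lra))).
    + intros r Hr. rewrite !vf_fst, !vf_snd, !snd_sub_R, !fst_sub_R, E.
      apply pair_increasing; [apply Hf|apply Hg]; lra.
  - match goal with |- ?L <= _ => enough (L - ((fst (f s) + - fst (g s)) ^ 2 + (snd (f s) + - snd (g s)) ^ 2) / (snd (f s) * snd (g s)) <= 0 * (b - s)) by lra end.
    apply (mvt_le (fun s => ((fst (f s) + - fst (g s)) ^ 2 + (snd (f s) + - snd (g s)) ^ 2) / (snd (f s) * snd (g s)))
      (fun r => 2 * ((fst (f r) - fst (g r)) * (fst (vf (f r - RtoC (xi r))) - fst (vf (g r - RtoC (xi r)))) +
        (snd (f r) - snd (g r)) * (snd (vf (f r - RtoC (xi r))) - snd (vf (g r - RtoC (xi r))))) / (snd (f r) * snd (g r)) -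
       ((fst (f r) - fst (g r)) ^ 2 + (snd (f r) - snd (g r)) ^ 2) *
        (snd (vf (f r - RtoC (xi r))) * snd (g r) + snd (f r) * snd (vf (g r - RtoC (xi r)))) / (snd (f r) * snd (g r)) ^ 2)); [lra| |].
    + intros r Hr. exact (proj2 (D r ltac:(lra))).
    + intros r Hr. rewrite !vf_fst, !vf_snd, !snd_sub_R, !fst_sub_R, E.
      apply pair_decreasing; [apply Hf|apply Hg]; lra.
Qed.

Lemma sum_n_ge_term (u : nat -> R) (N i : nat) : (forall k, (k <= N)%nat -> 0 <= u k) -> (i <= N)%nat ->
  u i <= sum_n u N.
Proof.
  intros Hp. revert i. induction N as [|N IH]; intros i Hi.
  - rewrite sum_O. replace i with 0%nat by lia. lra.
  - rewrite sum_Sn. change plus with Rplus.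
    destruct (Nat.eq_dec i (S N)) as [->|Hne].
    + assert (u 0%nat <= sum_n u N) by (apply IH; [intros; apply Hp; lia|lia]).
      generalize (Hp 0%nat ltac:(lia)). lra.
    + assert (u i <= sum_n u N) by (apply IH; [intros; apply Hp; lia|lia]).
      generalize (Hp (S N) ltac:(lia)). lra.
Qed.

Lemma sum_n_diff_le (u v : nat -> R) (N : nat) (L : R) : (forall k, (k <= N)%nat -> u k - v k <= L) ->
  sum_n u N - sum_n v N <= INR (S N) * L.
Proof.
  induction N as [|N IH]; intros H.
  - rewrite !sum_O. simpl. generalize (H 0%nat (le_n _)). lra.
  - rewrite !sum_Sn. change plus with Rplus. rewrite S_INR.
    generalize (H (S N) (le_n _)) (IH (fun k Hk => H k (le_S _ _ Hk))). lra.
Qed.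

Lemma discrete_crossing (g : nat -> R) (x : R) (N : nat) : g 0%nat <= x -> x < g N ->
  exists i, (i < N)%nat /\ g i <= x < g (S i).
Proof.
  intros H0. induction N as [|N IH]; intros HN; [lra|].
  destruct (Rlt_le_dec x (g N)) as [H|H].
  - destruct (IH H) as [i [Hi Hg]]. exists i. split; [lia|easy].
  - exists N. split; [lia|lra].
Qed.

Section Local.

Variable xi : R -> R.
Hypothesis Hxi : forall s, continuous xi s.

(** By [hsol_distortion] the distance of two solutions started at the same
    small height stays large compared with their heights, so the difference of
    their real parts cannot change sign. *)
Lemma hsol_order a b f g kappa y l s : hsol xi a b f -> hsol xi a b g -> a <= s <= b ->
  0 < kappa -> 0 < l -> 0 < y <= kappa * l / 2 ->
  snd (f b) = y -> snd (g b) = y -> fst (g b) - fst (f b) = l ->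
  kappa * y <= snd (f a) -> kappa * y <= snd (g a) ->
  kappa * l / 2 <= fst (g s) - fst (f s).
Proof.
  intros Hf Hg Hs Hk Hl Hy Ef Eg El Hfa Hga.
  assert (Hd : forall s, a <= s <= b -> kappa * l / 2 <= Rabs (fst (g s) - fst (f s))).
  { clear s Hs. intros s Hs.
    destruct (hsol_distortion xi a b g f s Hg Hf Hs) as [_ H].
    rewrite Ef, Eg in H.
    assert (F1 : kappa * y <= snd (f s) <= y).
    { rewrite <- Ef at 2. split; [apply Rle_trans with (1 := Hfa)|];
      apply (hsol_Im_incr xi a b f); auto; lra. }
    assert (G1 : kappa * y <= snd (g s) <= y).
    { rewrite <- Eg at 2. split; [apply Rle_trans with (1 := Hga)|];
      apply (hsol_Im_incr xi a b g); auto; lra. }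
    assert (Hky : 0 < kappa * y) by (apply Rmult_lt_0_compat; lra).
    assert (Hb : Cmod (g b - f b) ^ 2 = l ^ 2).
    { rewrite Cmod_sq. simpl fst. simpl snd. rewrite Ef, Eg. rewrite <- El. ring. }
    assert (Hyy : 0 < y * y) by (apply Rmult_lt_0_compat; lra).
    assert (Hfg : 0 < snd (g s) * snd (f s)) by (apply Rmult_lt_0_compat; lra).
    assert (H2 : (kappa * l) ^ 2 <= Cmod (g s - f s) ^ 2).
    { apply Rle_trans with (l ^ 2 / (y * y) * (snd (g s) * snd (f s))).
      - replace ((kappa * l) ^ 2) with (l ^ 2 / (y * y) * ((kappa * y) * (kappa * y))) by (field; lra).
        apply Rmult_le_compat_l; [apply Rdiv_le_0_compat; [apply pow2_ge_0|easy]|].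
        apply Rmult_le_compat; lra.
      - rewrite Hb in H. apply (Rmult_le_compat_r (snd (g s) * snd (f s))) in H; [|lra].
        eapply Rle_trans; [exact H|]. right. field. lra. }
    rewrite Cmod_sq in H2. simpl fst in H2. simpl snd in H2.
    assert (H3 : (snd (g s) + - snd (f s)) ^ 2 <= (kappa * l / 2) ^ 2).
    { rewrite <- (pow2_abs (snd (g s) + - snd (f s))). apply pow_incr.
      split; [apply Rabs_pos|]. apply Rabs_le. lra. }
    apply sq_le; [apply Rabs_pos|]. rewrite pow2_abs.
    change (fst (g s) - fst (f s)) with (fst (g s) + - fst (f s)). nra. }
  assert (Hkl : 0 < kappa * l) by now apply Rmult_lt_0_compat.
  destruct (Rle_lt_dec (fst (g s) - fst (f s)) 0) as [Hneg|Hpos].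
  - exfalso. destruct (last_zero (fun s => fst (g s) - fst (f s)) s b) as [z [Hz [Hz0 _]]]; try lra.
    + intros r Hr.
      destruct (Hg r ltac:(lra)) as [_ [Dg _]]. destruct (Hf r ltac:(lra)) as [_ [Df _]].
      apply (continuity_pt_minus (fun s => fst (g s)) (fun s => fst (f s)));
        [exact (is_derive_continuity_pt _ _ _ Dg)|exact (is_derive_continuity_pt _ _ _ Df)].
    + generalize (Hd z ltac:(lra)). rewrite Hz0, Rabs_R0. lra.
  - generalize (Hd s Hs). rewrite Rabs_right; lra.
Qed.

(** Suppose that a whole rectangle standing on the real axis around [p]
    survives backwards.  By [hopf], all imaginary parts over its middle half
    shrink at most by a constant factor, so by [hsol_distortion] a grid of
    mesh [r / N] of points at small height keeps a mesh of order [1 / N] and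
    keeps its order.  While the driver is inside the moving grid, it is at
    distance [O(1 / N)] from some grid point, whose logarithm of the imaginary
    part then changes at a rate of order [N ^ 2].  As the sum of these [N + 1]
    logarithms can change by no more than [O(N)], the driver cannot stay inside
    the grid for a positive time. *)
Lemma surviving_stretch_avoids_driver a b p r : a <= b -> 0 < r ->
  (forall w, Rabs (fst w - p) <= r -> 0 < snd w <= r -> alive xi a b w) ->
  (forall rho, 0 < rho -> exists s1 s2 y0, a <= s1 /\ s1 < s2 /\ s2 <= b /\ 0 < y0 /\
     forall y f, 0 < y < y0 -> hsol xi a b f -> f b = (p, y) ->
       forall s, s1 <= s <= s2 -> Cmod (f s - RtoC (xi s)) <= rho) ->
  False.
Proof.
  intros Hab Hr Hal Hnear.
  destruct (hopf xi a b p r Hxi Hab Hr Hal) as [kappa [[Hk Hk1] Hhopf]].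
  set (Lam := - ln kappa).
  assert (HLam : 0 <= Lam).
  { unfold Lam. assert (ln kappa <= ln 1); [|rewrite ln_1 in *; lra].
    destruct Hk1 as [Hk1| ->]; [left; now apply ln_increasing|lra]. }
  assert (Hkr : 0 < kappa * r) by now apply Rmult_lt_0_compat.
  destruct (Hnear (kappa * r / 8) ltac:(lra)) as [s1 [s2 [y0 [Hs1 [Hs12 [Hs2 [Hy0 Hcl]]]]]]].
  set (c := kappa ^ 2 / r ^ 2).
  assert (Hc : 0 < c) by (apply Rdiv_lt_0_compat; now apply pow_lt).
  destruct (INR_unbounded (1 + 2 * Lam / ((s2 - s1) * c))) as [N HN].
  assert (Hsc : 0 < (s2 - s1) * c) by (apply Rmult_lt_0_compat; lra).
  assert (HN1 : 1 < INR N) by (generalize (Rdiv_le_0_compat (2 * Lam) _ ltac:(lra) Hsc); lra).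
  assert (HNL : 2 * Lam < (s2 - s1) * c * INR N).
  { apply Rlt_le_trans with ((s2 - s1) * c * (1 + 2 * Lam / ((s2 - s1) * c))).
    - rewrite Rmult_plus_distr_l.
      replace ((s2 - s1) * c * (2 * Lam / ((s2 - s1) * c))) with (2 * Lam).
      + lra.
      + field. split; apply Rgt_not_eq; [easy|lra].
    - apply Rmult_le_compat_l; lra. }
  set (mesh := r / INR N). assert (Hmesh : 0 < mesh) by (apply Rdiv_lt_0_compat; lra).
  (* the bounds on [y] serve the closeness to the driver, [hopf], [hsol_order] and
     the final distance estimate *)
  set (y := Rmin (Rmin (y0 / 2) (r / 4)) (Rmin (kappa * r / 4) (mesh / kappa))).
  assert (Hy : 0 < y /\ y < y0 /\ y <= r / 4 /\ y <= kappa * r / 4 /\ y <= mesh / kappa).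
  { assert (0 < mesh / kappa) by now apply Rdiv_lt_0_compat.
    generalize (Rmin_l (Rmin (y0 / 2) (r / 4)) (Rmin (kappa * r / 4) (mesh / kappa)))
      (Rmin_r (Rmin (y0 / 2) (r / 4)) (Rmin (kappa * r / 4) (mesh / kappa)))
      (Rmin_l (y0 / 2) (r / 4)) (Rmin_r (y0 / 2) (r / 4))
      (Rmin_l (kappa * r / 4) (mesh / kappa)) (Rmin_r (kappa * r / 4) (mesh / kappa)).
    fold y. assert (0 < y) by (unfold y; repeat apply Rmin_glb_lt; lra). lra. }
  clearbody y. destruct Hy as [Hyp [Hyy0 [Hyr [Hykr Hym]]]].
  set (x := fun i : nat => p - r / 2 + INR i * mesh).
  assert (HxN : x N = p + r / 2) by (unfold x, mesh; field; lra).
  assert (Hx0 : x 0%nat = p - r / 2) by (unfold x; simpl; ring).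
  assert (Hx : forall i, (i <= N)%nat -> p - r / 2 <= x i <= p + r / 2).
  { intros i Hi. rewrite <- HxN. unfold x. apply le_INR in Hi.
    generalize (pos_INR i). intros. split; [nra|]. apply Rplus_le_compat_l, Rmult_le_compat_r; lra. }
  assert (HF : forall i, exists f, (i <= N)%nat -> hsol xi a b f /\ f b = (x i, y)).
  { intros i. destruct (Compare_dec.le_dec i N) as [Hi|Hi].
    - destruct (Hal (x i, y)) as [f Hf]; simpl; [|lra|].
      + generalize (Hx i Hi). intros. apply Rabs_le. lra.
      + now exists f.
    - exists (fun _ => RtoC 0). easy. }
  set (F := fun i => proj1_sig (constructive_indefinite_description _ (HF i))).
  assert (HFs : forall i, (i <= N)%nat -> hsol xi a b (F i) /\ F i b = (x i, y)).
  { intros i. apply (proj2_sig (constructive_indefinite_description _ (HF i))). }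
  clearbody F.
  destruct (Hal (p, y)) as [fc [Hfc Efc]]; simpl; [rewrite Rminus_diag, Rabs_R0; lra|lra|].
  assert (HIm : forall f xx, hsol xi a b f -> f b = (xx, y) -> p - r / 2 <= xx <= p + r / 2 ->
     kappa * y <= snd (f a) /\ forall s, a <= s <= b -> kappa * y <= snd (f s) <= y).
  { intros f xx Hf Ef Hxx.
    assert (H : kappa * y <= snd (f a)).
    { rewrite <- (bval_eq xi a b f Hab Hf), Ef. apply (Hhopf (xx, y)); simpl; [apply Rabs_le|]; lra. }
    split; [easy|]. intros s Hs. split.
    - apply Rle_trans with (1 := H). apply (hsol_Im_incr xi a b); auto; lra.
    - replace y with (snd (f b)) by now rewrite Ef. apply (hsol_Im_incr xi a b); auto; lra. }
  assert (HImF : forall i, (i <= N)%nat -> kappa * y <= snd (F i a) /\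
      forall s, a <= s <= b -> kappa * y <= snd (F i s) <= y).
  { intros i Hi. destruct (HFs i Hi) as [H1 H2]. apply (HIm _ (x i)); auto. }
  assert (HImc := HIm fc p Hfc Efc ltac:(lra)).
  assert (Hky : 0 < kappa * y) by (apply Rmult_lt_0_compat; lra).
  assert (Hclose : forall s, s1 <= s <= s2 -> exists i, (i <= N)%nat /\
     c * INR N ^ 2 <= 2 / Cmod (F i s - RtoC (xi s)) ^ 2).
  { intros s Hs.
    assert (Hc0 := Hcl y fc (conj Hyp Hyy0) Hfc Efc s Hs).
    assert (Hc1 := fst_le_Cmod (fc s - RtoC (xi s))%C). rewrite fst_sub_R in Hc1.
    assert (Hc2 : - (kappa * r / 8) <= fst (fc s) - xi s <= kappa * r / 8).
    { apply Rabs_le_between. lra. }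
    destruct (HFs 0%nat ltac:(lia)) as [F0 F0b]. destruct (HFs N ltac:(lia)) as [FN FNb].
    assert (O1 := hsol_order a b (F 0%nat) fc kappa y (r / 2) s F0 Hfc ltac:(lra) Hk ltac:(lra) ltac:(lra)
      ltac:(now rewrite F0b) ltac:(now rewrite Efc) ltac:(rewrite F0b, Efc; simpl; lra)
      (proj1 (HImF 0%nat ltac:(lia))) (proj1 HImc)).
    assert (O2 := hsol_order a b fc (F N) kappa y (r / 2) s Hfc FN ltac:(lra) Hk ltac:(lra) ltac:(lra)
      ltac:(now rewrite Efc) ltac:(now rewrite FNb) ltac:(rewrite FNb, Efc; simpl; lra)
      (proj1 HImc) (proj1 (HImF N ltac:(lia)))).
    destruct (discrete_crossing (fun i => fst (F i s)) (xi s) N) as [i [Hi Hcr]]; [lra|lra|].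
    exists i. split; [lia|].
    destruct (HFs i ltac:(lia)) as [Fi Fib]. destruct (HFs (S i) ltac:(lia)) as [Fj Fjb].
    destruct (hsol_distortion xi a b (F i) (F (S i)) s Fi Fj ltac:(lra)) as [D _].
    assert (I1 := proj2 (HImF i ltac:(lia)) s ltac:(lra)).
    assert (I2 := proj2 (HImF (S i) ltac:(lia)) s ltac:(lra)).
    rewrite Fib, Fjb in D.
    assert (E : Cmod ((x i, y) - (x (S i), y)) ^ 2 = mesh ^ 2).
    { rewrite Cmod_sq. simpl fst. simpl snd. unfold x. rewrite S_INR. ring. }
    rewrite E in D. simpl snd in D.
    assert (D2 : Cmod (F i s - F (S i) s) ^ 2 <= (mesh / kappa) ^ 2).
    { apply Rmult_le_reg_r with ((kappa * y) * (kappa * y)); [now apply Rmult_lt_0_compat|].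
      replace ((mesh / kappa) ^ 2 * (kappa * y * (kappa * y))) with (mesh ^ 2 * (y * y)) by (field; lra).
      eapply Rle_trans; [|exact D]. apply Rmult_le_compat_l; [apply pow2_ge_0|].
      apply Rmult_le_compat; lra. }
    assert (D3 : fst (F (S i) s) - fst (F i s) <= mesh / kappa).
    { assert (0 < mesh / kappa) by now apply Rdiv_lt_0_compat.
      apply sq_le; [lra|]. rewrite Cmod_sq in D2. simpl fst in D2. simpl snd in D2.
      generalize (pow2_ge_0 (snd (F i s) + - snd (F (S i) s))). nra. }
    assert (D4 : Cmod (F i s - RtoC (xi s)) ^ 2 <= 2 * (mesh / kappa) ^ 2).
    { rewrite Cmod_sq, fst_sub_R, snd_sub_R.
      assert ((fst (F i s) - xi s) ^ 2 <= (mesh / kappa) ^ 2).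
      { replace ((fst (F i s) - xi s) ^ 2) with ((xi s - fst (F i s)) ^ 2) by ring.
        apply pow_incr. lra. }
      assert (snd (F i s) ^ 2 <= (mesh / kappa) ^ 2) by (apply pow_incr; lra).
      lra. }
    replace (c * INR N ^ 2) with (2 / (2 * (mesh / kappa) ^ 2)) by (unfold c, mesh; field; lra).
    apply Rmult_le_compat_l; [lra|]. apply Rinv_le_contravar; [|easy].
    apply pow_lt. apply Cmod_gt_0. intros E0.
    assert (E1 : snd (F i s - RtoC (xi s))%C = 0) by now rewrite E0.
    rewrite snd_sub_R in E1. lra. }
  assert (Hpos : forall i s, (i <= N)%nat -> a <= s <= b -> 0 < snd (F i s)).
  { intros i s Hi Hs. now apply (HFs i Hi). }
  assert (HS := mvt_ge (fun s => sum_n (fun i => ln (snd (F i s))) N)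
    (fun s => sum_n (fun i => 2 / Cmod (F i s - RtoC (xi s)) ^ 2) N) s1 s2 (c * INR N ^ 2) ltac:(lra)).
  assert (HS1 : c * INR N ^ 2 * (s2 - s1) <= INR (S N) * Lam).
  { eapply Rle_trans; [apply HS|].
    - intros s Hs. apply (is_derive_sum_n (fun i s => ln (snd (F i s)))).
      intros i Hi. assert (Hp := Hpos i s Hi ltac:(lra)).
      destruct (proj1 (HFs i Hi) s ltac:(lra)) as [_ [_ Hd]].
      rewrite Cmod_sq, snd_sub_R.
      replace (2 / (fst (F i s - RtoC (xi s))%C ^ 2 + snd (F i s) ^ 2)) with
        (snd (vf (F i s - RtoC (xi s))%C) * / snd (F i s)).
      2: { rewrite vf_snd, snd_sub_R. field. split; [|lra].
           apply Rgt_not_eq. generalize (pow2_ge_0 (fst (F i s - RtoC (xi s))%C)). nra. }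
      apply (is_derive_comp (V := R_NormedModule) ln (fun s => snd (F i s))); [|easy].
      apply is_derive_Reals. now apply derivable_pt_lim_ln.
    - intros s Hs. destruct (Hclose s Hs) as [i [Hi Hci]].
      eapply Rle_trans; [exact Hci|].
      apply (sum_n_ge_term (fun i => 2 / Cmod (F i s - RtoC (xi s)) ^ 2)); [|easy].
      intros k Hk0. apply Rdiv_le_0_compat; [lra|]. rewrite Cmod_sq, snd_sub_R.
      generalize (Hpos k s Hk0 ltac:(lra)) (pow2_ge_0 (fst (F k s - RtoC (xi s))%C)). nra.
    - apply (sum_n_diff_le (fun i => ln (snd (F i s2))) (fun i => ln (snd (F i s1)))).
      intros k Hk0.
      assert (I1 := proj2 (HImF k Hk0) s1 ltac:(lra)).
      assert (I2 := proj2 (HImF k Hk0) s2 ltac:(lra)).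
      assert (L1 : ln (kappa * y) <= ln (snd (F k s1))).
      { destruct (proj1 I1) as [H|H]; [left; now apply ln_increasing|right; now rewrite H]. }
      assert (L2 : ln (snd (F k s2)) <= ln y).
      { destruct (proj2 I2) as [H|H]; [left; apply ln_increasing; lra|right; now rewrite H]. }
      rewrite ln_mult in L1 by lra. unfold Lam. lra. }
  rewrite S_INR in HS1.
  assert (H2 : c * INR N ^ 2 * (s2 - s1) <= 2 * INR N * Lam).
  { eapply Rle_trans; [exact HS1|]. apply Rmult_le_compat_r; lra. }
  assert (H3 : (s2 - s1) * c * INR N * INR N <= 2 * Lam * INR N).
  { replace ((s2 - s1) * c * INR N * INR N) with (c * INR N ^ 2 * (s2 - s1)) by ring. lra. }
  apply Rmult_le_reg_r in H3; lra.
Qed.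

(** A time window before [b] that is as short as the estimates of displacement
    over the scale [R0] require. *)
Lemma driver_window a b R0 : a < b -> 0 < R0 ->
  exists t, a <= t < b /\ 4 * (b - t) <= R0 ^ 2 /\ forall s, t <= s <= b -> Rabs (xi s - xi b) <= R0.
Proof.
  intros Hab HR.
  assert (Hcont : continuity_pt xi b) by apply continuity_pt_filterlim, Hxi.
  destruct (Hcont R0 HR) as [d [Hd Hdl]].
  assert (HR2 : 0 < R0 ^ 2) by now apply pow_lt.
  set (m := Rmin (d / 2) (R0 ^ 2 / 4)).
  assert (Hm : 0 < m) by (apply Rmin_glb_lt; lra).
  assert (Hm1 : m <= d / 2) by apply Rmin_l. assert (Hm2 : m <= R0 ^ 2 / 4) by apply Rmin_r.
  exists (Rmax a (b - m)). generalize (Rmax_l a (b - m)) (Rmax_r a (b - m)). intros M1 M2.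
  split; [split; [easy|apply Rmax_lub_lt; lra]|]. split; [lra|].
  intros s Hs. destruct (Req_dec b s) as [<-|Hne]; [rewrite Rminus_diag, Rabs_R0; lra|].
  left. apply (Hdl s). split; [split; [exact I|easy]|]. simpl. unfold R_dist.
  rewrite Rabs_left1; lra.
Qed.

(** If all points survived, those just above the final position of the driver
    would be kept close to it by [stays_near], against
    [surviving_stretch_avoids_driver]. *)
Lemma swallowed_exists a b : a < b -> exists w, 0 < snd w /\ ~ alive xi a b w.
Proof.
  intros Hab. apply NNPP. intros Hn.
  assert (Hal : forall w, 0 < snd w -> alive xi a b w).
  { intros w Hw. apply NNPP. intros H. apply Hn. now exists w. }
  apply (surviving_stretch_avoids_driver a b (xi b) 1); [lra|lra| |].
  { intros w _ Hw. apply Hal. lra. }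
  intros rho Hrho. set (R0 := rho / 6). assert (HR : 0 < R0) by (unfold R0; lra).
  destruct (driver_window a b R0 Hab HR) as [s1 [Hs1 [Hs1R Hosc]]].
  exists s1, b, (4 * R0). repeat split; try lra.
  intros y f Hy Hf Ef s Hs.
  assert (Hf1 : hsol xi s1 b f) by (apply (hsol_sub xi a b); auto; lra).
  assert (N1 : Cmod (f s - RtoC (xi b)) <= 5 * R0).
  { apply (stays_near xi s1 b (xi b) R0); auto; try lra.
    rewrite Ef. eapply Rle_trans; [apply Cmod_le_sum|]. simpl.
    replace (xi b + - xi b) with 0 by ring. replace (y + - 0) with y by ring.
    rewrite Rabs_R0, Rabs_right; lra. }
  assert (N2 := Hosc s Hs).
  assert (T := Cmod_triangle (f s - RtoC (xi b)) (RtoC (xi b - xi s))).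
  rewrite Cmod_R, Rabs_minus_sym in T.
  replace (f s - RtoC (xi b) + RtoC (xi b - xi s))%C with (f s - RtoC (xi s))%C in T
    by (rewrite RtoC_minus; ring).
  unfold R0 in *. lra.
Qed.

End Local.

(** * Swallowed points when the driver generates a simple curve *)

(** The form in which the simple curve is used: its points are those from which
    the backward flow does not reach time [0]. *)
Definition slit_curve (xi : R -> R) (T : R) (gamma : R -> C) : Prop :=
  (forall r eps, 0 < eps -> exists eta, 0 < eta /\
     forall r', Rabs (r' - r) < eta -> Cmod (gamma r' - gamma r) < eps) /\
  (forall r r', 0 <= r <= T -> 0 <= r' <= T -> gamma r = gamma r' -> r = r') /\
  (forall r, 0 < r <= T -> 0 < snd (gamma r)) /\
  (forall w, 0 < snd w -> alive xi 0 T w <-> ~ exists r, 0 < r <= T /\ gamma r = w).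

Section SlitCurve.

Variables (xi : R -> R) (T : R) (gamma : R -> C).
Hypothesis Hxi : forall s, continuous xi s.
Hypothesis Hslit : slit_curve xi T gamma.

Let gamma_cont := proj1 Hslit.
Let gamma_inj := proj1 (proj2 Hslit).
Let gamma_pos := proj1 (proj2 (proj2 Hslit)).
Let gamma_alive := proj2 (proj2 (proj2 Hslit)).

Lemma gamma_norm_lsc (K : C -> Prop) : lsc_on K (fun z => - Cmod (gamma (snd z))).
Proof.
  intros z _ eps Heps. destruct (gamma_cont (snd z) eps Heps) as [eta [He H]].
  exists eta. split; [easy|]. intros z' _ Hd.
  assert (H1 := H (snd z') ltac:(generalize (snd_le_Cmod (z' - z)%C); simpl; unfold Rminus; lra)).
  assert (H2 := Cmod_triangle (gamma (snd z') - gamma (snd z)) (gamma (snd z))).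
  replace (gamma (snd z') - gamma (snd z) + gamma (snd z))%C with (gamma (snd z')) in H2 by ring. lra.
Qed.

Lemma gamma_Im_lsc (K : C -> Prop) : lsc_on K (fun z => snd (gamma (snd z))).
Proof.
  intros z _ eps Heps. destruct (gamma_cont (snd z) eps Heps) as [eta [He H]].
  exists eta. split; [easy|]. intros z' _ Hd.
  assert (H1 := H (snd z') ltac:(generalize (snd_le_Cmod (z' - z)%C); simpl; unfold Rminus; lra)).
  assert (H2 := snd_le_Cmod (gamma (snd z') - gamma (snd z))%C). simpl in H2.
  apply Rabs_le_between in H2. lra.
Qed.

Lemma gamma_dist_lsc (K : C -> Prop) : lsc_on K (fun z => Cmod (gamma (fst z) - gamma (snd z))).
Proof.
  intros z _ eps Heps.
  destruct (gamma_cont (fst z) (eps / 2) ltac:(lra)) as [e1 [He1 H1]].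
  destruct (gamma_cont (snd z) (eps / 2) ltac:(lra)) as [e2 [He2 H2]].
  exists (Rmin e1 e2). split; [now apply Rmin_glb_lt|]. intros z' _ Hd.
  generalize (Rmin_l e1 e2) (Rmin_r e1 e2). intros.
  assert (G1 := H1 (fst z') ltac:(generalize (fst_le_Cmod (z' - z)%C); simpl; unfold Rminus; lra)).
  assert (G2 := H2 (snd z') ltac:(generalize (snd_le_Cmod (z' - z)%C); simpl; unfold Rminus; lra)).
  assert (T1 := Cmod_triangle (gamma (fst z') - gamma (snd z'))
    (- (gamma (fst z') - gamma (fst z)) + (gamma (snd z') - gamma (snd z)))).
  assert (T2 := Cmod_triangle (- (gamma (fst z') - gamma (fst z))) (gamma (snd z') - gamma (snd z))).
  rewrite Cmod_opp in T2.
  replace (gamma (fst z') - gamma (snd z') + (- (gamma (fst z') - gamma (fst z)) + (gamma (snd z') - gamma (snd z))))%C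
    with (gamma (fst z) - gamma (snd z))%C in T1 by ring. lra.
Qed.

Lemma gamma_alive_open t r : t <= T -> alive xi t T (gamma r) ->
  exists eta, 0 < eta /\ forall r', Rabs (r' - r) < eta -> alive xi t T (gamma r').
Proof.
  intros Ht Ha. destruct (bval_continuous xi Hxi t T (gamma r) Ht Ha 1 Rlt_0_1) as [e [He H]].
  destruct (gamma_cont r e He) as [eta [Heta H1]].
  exists eta. split; [easy|]. intros r' Hr'. now apply H, H1.
Qed.

(** If [gamma r1] survives, the swallowed points beyond it form a compact set
    [gamma E] at positive distance from the real axis and from the other
    swallowed points.  By the minimum principle on the closed
    [eps]-neighbourhood [K] of [gamma E], the imaginary part over [K] is bounded
    below by its values on the boundary of [K], which consists of surviving
    points; so it cannot tend to [0] anywhere in [K]. *)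
Lemma swallowed_initial t r1 r2 : 0 <= t <= T -> 0 < r1 < r2 -> r2 <= T ->
  ~ alive xi t T (gamma r2) -> ~ alive xi t T (gamma r1).
Proof.
  intros Ht Hr1 Hr2 Hd2 Ha1. apply Hd2.
  set (E := fun r => r1 <= r <= T /\ ~ alive xi t T (gamma r)).
  assert (HE : E r2) by (split; [lra|easy]).
  destruct (compact_pos (fun z => 0 <= fst z <= r1 /\ E (snd z)) (fun z => Cmod (gamma (fst z) - gamma (snd z))))
    as [m1 [Hm1 Hdist]].
  { exists T. intros z [H1 [H2 _]]. split; apply Rabs_le; lra. }
  { intros z Hz.
    destruct (classic (rect 0 r1 r1 T z)) as [Hin|Hout].
    - assert (Ha : alive xi t T (gamma (snd z))).
      { apply NNPP. intros Hn. apply Hz. split; [apply Hin|]. split; [apply Hin|easy]. }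
      destruct (gamma_alive_open t (snd z) (proj2 Ht) Ha) as [eta [He H]].
      exists eta. split; [easy|]. intros z' Hd [_ [_ Hn]]. apply Hn, H.
      generalize (snd_le_Cmod (z' - z)%C); simpl; unfold Rminus; lra.
    - destruct (rect_closed 0 r1 r1 T z Hout) as [eta [He H]].
      exists eta. split; [easy|]. intros z' Hd [H1 [H2 _]]. now apply (H z' Hd). }
  { apply gamma_dist_lsc. }
  { intros z [H1 [H2 Hn]]. apply Cmod_gt_0. intros Ez.
    assert (Eg : gamma (fst z) = gamma (snd z)).
    { replace (gamma (fst z)) with (gamma (fst z) - gamma (snd z) + gamma (snd z))%C by ring.
      rewrite Ez. ring. }
    apply gamma_inj in Eg; try lra. apply Hn. now replace (snd z) with r1 by lra. }
  destruct (compact_pos (rect 0 0 r1 T) (fun z => snd (gamma (snd z)))) as [m2 [Hm2 Hheight]].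
  { apply rect_bounded. } { apply rect_closed. } { apply gamma_Im_lsc. }
  { intros z [_ H]. apply gamma_pos. lra. }
  destruct (compact_min (rect 0 0 r1 T) (fun z => - Cmod (gamma (snd z))) (0, r1)) as [z0 [_ Hmax]].
  { apply rect_bounded. } { apply rect_closed. } { apply gamma_norm_lsc. }
  { unfold rect; simpl; lra. }
  set (eps := Rmin m1 m2 / 3).
  assert (Heps : 0 < eps /\ 3 * eps <= m1 /\ 3 * eps <= m2).
  { generalize (Rmin_l m1 m2) (Rmin_r m1 m2) (Rmin_glb_lt m1 m2 0 Hm1 Hm2). unfold eps. lra. }
  clearbody eps. destruct Heps as [Heps [Hem1 Hem2]].
  assert (HEh : forall r, E r -> 3 * eps <= snd (gamma r)).
  { intros r [Hr _]. generalize (Hheight (0, r)). unfold rect. simpl. lra. }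
  set (K := fun w => forall eta, 0 < eta -> exists r, E r /\ Cmod (w - gamma r) < eps + eta).
  set (inside := fun w => exists r, E r /\ Cmod (w - gamma r) < eps).
  set (M := Cmod (gamma (snd z0)) + 2 * eps).
  assert (HM : forall w, K w -> Cmod w <= M).
  { intros w Hw. destruct (Hw eps Heps) as [r [[Hr _] Hd]].
    assert (H := Hmax (0, r) ltac:(unfold rect; simpl; lra)). simpl in H.
    assert (H1 := Cmod_triangle (w - gamma r) (gamma r)).
    replace (w - gamma r + gamma r)%C with w in H1 by ring. unfold M. lra. }
  assert (HKb : cbounded K).
  { exists M. intros w Hw. generalize (HM w Hw) (fst_le_Cmod w) (snd_le_Cmod w). lra. }
  assert (tri : forall w w' z, Cmod (w' - z) <= Cmod (w' - w) + Cmod (w - z)).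
  { intros w w' z. replace (w' - z)%C with ((w' - w) + (w - z))%C by ring. apply Cmod_triangle. }
  assert (HKc : cclosed K).
  { intros w Hw. apply not_all_ex_not in Hw. destruct Hw as [eta Hw].
    apply imply_to_and in Hw. destruct Hw as [He Hw].
    exists (eta / 2). split; [lra|]. intros w' Hd Hw'.
    destruct (Hw' (eta / 2) ltac:(lra)) as [r [Hr Hdr]]. apply Hw. exists r. split; [easy|].
    generalize (tri w' w (gamma r)).
    replace (w - w')%C with (- (w' - w))%C by ring. rewrite Cmod_opp. lra. }
  assert (HKpos : forall w, K w -> eps < snd w).
  { intros w Hw. destruct (Hw eps Heps) as [r [Hr Hd]].
    generalize (HEh r Hr) (close_coordinates (gamma r) w _ Hd). lra. }
  assert (Hout : forall w, K w -> ~ inside w -> alive xi t T w).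
  { intros w Hw Hni. assert (Hwp := HKpos w Hw).
    destruct (classic (exists r, 0 < r <= T /\ gamma r = w)) as [[r [Hr Er]]|Hoff].
    - destruct (Rle_lt_dec r1 r) as [H1|H1].
      + apply NNPP. intros Hn. apply Hni. exists r. rewrite Er. split.
        * split; [lra|]. now rewrite Er.
        * replace (w - w)%C with (RtoC 0) by ring. now rewrite Cmod_0.
      + exfalso. destruct (Hw eps Heps) as [r' [Hr' Hd]].
        assert (H := Hdist (r, r')). simpl in H. rewrite Er in H.
        assert (m1 <= Cmod (w - gamma r')) by (apply H; split; [lra|easy]). lra.
    - apply alive_sub with 0; [lra|]. apply gamma_alive; [lra|easy]. }
  assert (Hint : forall w, inside w -> exists eta, 0 < eta /\ forall w', Cmod (w' - w) < eta -> inside w').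
  { intros w [r [Hr Hd]]. exists (eps - Cmod (w - gamma r)). split; [lra|].
    intros w' Hd'. exists r. split; [easy|]. generalize (tri w w' (gamma r)). lra. }
  assert (HinK : forall w, inside w -> K w).
  { intros w [r [Hr Hd]] eta He. exists r. split; [easy|lra]. }
  destruct (compact_pos (fun w => K w /\ ~ inside w) (fun w => snd (bval xi t T w))) as [m [Hm Hbd]].
  { destruct HKb as [M' HM']. exists M'. intros w [Hw _]. now apply HM'. }
  { intros w Hw. destruct (classic (K w)) as [HK|HK].
    - destruct (classic (inside w)) as [Hi|Hi]; [|now destruct Hw].
      destruct (Hint w Hi) as [eta [He H]]. exists eta. split; [easy|].
      intros w' Hd [_ Hn]. now apply Hn, H.
    - destruct (HKc w HK) as [eta [He H]]. exists eta. split; [easy|].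
      intros w' Hd [Hn _]. now apply (H w' Hd). }
  { apply bval_Im_lsc; [easy|lra|]. intros w [H1 H2]. now apply Hout. }
  { intros w [H1 H2]. apply bval_Im_pos; [lra|now apply Hout]. }
  assert (HM0 : 0 <= M) by (unfold M; generalize (Cmod_ge_0 (gamma (snd z0))); lra).
  apply (alive_continuation xi Hxi K t T (m / 2)); try lra.
  - intros w Hw. generalize (HKpos w Hw). lra.
  - intros s Hs HKs f Hf Hfb.
    rewrite <- (bval_eq xi s T f (proj2 Hs) Hf).
    (* the small quadratic term makes the constant barrier strictly subharmonic *)
    set (e := m / (2 * (M ^ 2 + 1))).
    assert (HM1 : 0 < M ^ 2 + 1) by nra.
    assert (He : 0 < e) by (apply Rdiv_lt_0_compat; lra).
    assert (HeM : e * (M ^ 2 + 1) = m / 2) by (unfold e; field; lra).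
    apply Rle_trans with (quad (m / 2) 0 0 e e (f T)).
    { unfold quad. generalize (pow2_ge_0 (fst (f T))) (pow2_ge_0 (snd (f T))). nra. }
    apply (min_principle xi Hxi K s T); auto; try lra.
    intros w Hw. destruct (classic (inside w)) as [Hi|Hi].
    { left. destruct (Hint w Hi) as [eta [Het H]]. exists eta. split; [easy|]. auto. }
    right. apply Rle_trans with m.
    + unfold quad. assert (H := HM w Hw).
      assert (Cmod w ^ 2 <= M ^ 2) by (apply pow_incr; split; [apply Cmod_ge_0|easy]).
      rewrite Cmod_sq in H0. nra.
    + destruct (Hout w Hw Hi) as [g [Hg Eg]].
      apply Rle_trans with (1 := Hbd w (conj Hw Hi)). rewrite <- Eg.
      rewrite (bval_eq xi t T g) by (auto; lra).
      rewrite (bval_eq xi s T g); [|lra|apply (hsol_sub xi t T); auto; lra].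
      apply (hsol_Im_incr xi t T); auto; lra.
  - apply HinK. exists r2. split; [easy|].
    replace (gamma r2 - gamma r2)%C with (RtoC 0) by ring. now rewrite Cmod_0.
Qed.

(** Flowing forward to time [T] moves a swallowed point to the curve, by
    uniqueness of the flow. *)
Lemma swallowed_on_curve t ts w : 0 <= t -> t <= ts -> ts <= T -> 0 < snd w -> ~ alive xi t ts w ->
  exists r, 0 < r <= T /\ alive xi ts T (gamma r) /\ ~ alive xi t T (gamma r) /\
    bval xi ts T (gamma r) = w.
Proof.
  intros Ht Hts HT Hw Hd.
  destruct (forward_exists xi Hxi ts T w Hw HT) as [f [Hf Ef]].
  assert (Hn : ~ alive xi t T (f T)).
  { intros [g [Hg Eg]]. apply Hd. exists g. split; [now apply (hsol_sub xi t T)|].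
    rewrite <- Ef. apply (hsol_unique xi ts T g f T ts); auto; try lra.
    apply (hsol_sub xi t T); auto; lra. }
  assert (Hp : 0 < snd (f T)) by (apply Hf; lra).
  destruct (classic (exists r, 0 < r <= T /\ gamma r = f T)) as [[r [Hr Er]]|Hoff].
  - exists r. rewrite Er. split; [easy|]. split; [now exists f|]. split; [easy|].
    now rewrite bval_eq.
  - exfalso. apply Hn. apply alive_sub with 0; [easy|]. now apply gamma_alive.
Qed.

(** Points swallowed shortly before [ts] are close to [xi ts], hence away from
    [p]; those swallowed earlier come from the rest of the curve, beyond some
    [gamma r'], which the backward flow to time [ts] keeps at a positive height
    by compactness. *)
Lemma alive_near_real ts p : 0 < ts <= T -> p <> xi ts ->
  exists r, 0 < r /\ forall w, Rabs (fst w - p) <= r -> 0 < snd w <= r -> alive xi 0 ts w.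
Proof.
  intros Hts Hp.
  set (R0 := Rabs (p - xi ts) / 8).
  assert (HR : 0 < R0).
  { assert (0 < Rabs (p - xi ts)) by (apply Rabs_pos_lt; lra). unfold R0. lra. }
  destruct (driver_window xi Hxi 0 ts R0 (proj1 Hts) HR) as [t [Ht [HtR Hosc]]].
  destruct (swallowed_exists xi Hxi t ts (proj2 Ht)) as [w0 [Hw0 Hd0]].
  destruct (swallowed_on_curve t ts w0) as [r' [Hr' [Ha' [Hn' _]]]]; auto; try lra.
  assert (Hbeyond : forall r, r' <= r <= T -> alive xi ts T (gamma r)).
  { intros r Hr. destruct (Req_dec r r') as [->|Hne]; [easy|].
    apply NNPP. intros Hn. revert Ha'. apply (swallowed_initial ts r' r); auto; lra. }
  destruct (compact_pos (rect 0 0 r' T) (fun z => snd (bval xi ts T (gamma (snd z))))) as [m [Hm0 Hlow]].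
  { apply rect_bounded. } { apply rect_closed. }
  { intros z [_ Hz] eps Heps.
    destruct (bval_continuous xi Hxi ts T (gamma (snd z)) (proj2 Hts) (Hbeyond _ Hz) eps Heps) as [e [He H]].
    destruct (gamma_cont (snd z) e He) as [eta [Het H1]].
    exists eta. split; [easy|]. intros z' _ Hdz.
    assert (H2 := H1 (snd z') ltac:(generalize (snd_le_Cmod (z' - z)%C); simpl; unfold Rminus; lra)).
    destruct (H _ H2) as [_ H3].
    assert (H4 := snd_le_Cmod (bval xi ts T (gamma (snd z')) - bval xi ts T (gamma (snd z)))%C).
    simpl in H4. apply Rabs_le_between in H4. lra. }
  { intros z [_ Hz]. apply bval_Im_pos; [lra|now apply Hbeyond]. }
  exists (Rmin (m / 2) R0). split; [apply Rmin_glb_lt; lra|].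
  generalize (Rmin_l (m / 2) R0) (Rmin_r (m / 2) R0). intros Hmin1 Hmin2.
  intros w Hw1 Hw2. apply NNPP. intros Hn.
  destruct (swallowed_on_curve 0 ts w) as [r [Hr [Ha [Hn0 Eb]]]]; auto; try lra.
  destruct (Rle_lt_dec r' r) as [Hrr|Hrr].
  - assert (H := Hlow (0, r)). unfold rect in H. simpl in H. rewrite Eb in H. lra.
  - assert (Hnt : ~ alive xi t T (gamma r)) by (apply (swallowed_initial t r r'); auto; lra).
    apply Hnt. destruct Ha as [f [Hf Ef]]. rewrite <- Ef.
    apply alive_concat with ts; auto; try lra.
    assert (Efw : f ts = w) by (rewrite <- Eb, <- Ef, bval_eq; auto; lra).
    rewrite Efw. apply (far_alive xi Hxi t ts (xi ts) R0); auto; try lra.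
    assert (H1 := fst_le_Cmod (w - RtoC (xi ts))%C). rewrite fst_sub_R in H1.
    assert (H2 := Rabs_triang (fst w - xi ts) (- (fst w - p))). rewrite Rabs_Ropp in H2.
    replace (fst w - xi ts + - (fst w - p)) with (p - xi ts) in H2 by ring.
    unfold R0 in *. lra.
Qed.

End SlitCurve.

(** * Real solutions *)

Definition rsol (xi : R -> R) (a b : R) (u : R -> R) : Prop :=
  forall s, a <= s <= b -> xi s < u s /\ is_derive u s (-2 / (u s - xi s)).

Definition aliveR (xi : R -> R) (x t : R) : Prop :=
  exists u, rsol xi 0 t u /\ u 0 = x.

Definition trunc_flow (xi : R -> R) (d a b : R) (u : R -> R) : Prop :=
  forall s, a <= s <= b -> is_derive u s (-2 / Rmax (u s - xi s) d).

Lemma trunc_lip (x y d : R) : 0 < d ->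
  Rabs (-2 / Rmax x d - -2 / Rmax y d) <= 2 / d ^ 2 * Rabs (x - y).
Proof.
  intros Hd. generalize (Rmax_r x d) (Rmax_r y d) (Rmax_lip x y d).
  set (p := Rmax x d). set (q := Rmax y d). intros Hp Hq Hl.
  replace (-2 / p - -2 / q) with (2 * (p - q) / (p * q)) by (field; lra).
  unfold Rdiv. rewrite Rabs_mult, Rabs_mult, (Rabs_right 2) by lra.
  assert (Hpq : d ^ 2 <= p * q) by nra.
  assert (0 < d ^ 2) by now apply pow_lt.
  rewrite (Rabs_right (/ (p * q))) by (apply Rle_ge, Rlt_le, Rinv_0_lt_compat; lra).
  apply Rle_trans with (2 * Rabs (x - y) * / d ^ 2); [|right; ring].
  apply Rmult_le_compat.
  - generalize (Rabs_pos (p - q)). lra.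
  - apply Rlt_le, Rinv_0_lt_compat. lra.
  - lra.
  - now apply Rinv_le_contravar.
Qed.

Lemma trunc_flow_exists (xi : R -> R) (d t0 x : R) :
  (forall s, continuous xi s) -> 0 < d ->
  exists u : R -> R, u t0 = x /\ forall a b, trunc_flow xi d a b u.
Proof.
  intros Hxi Hd.
  assert (Hd2 : 0 < 2 / d ^ 2) by (apply Rdiv_lt_0_compat; [lra|now apply pow_lt]).
  destruct (picard_solution (fun s x _ => -2 / Rmax (x - xi s) d) (fun _ _ _ => 0)
     (2 / d ^ 2) (2 / d) t0 x 0) as [u [v [Hu [_ Huv]]]].
  - easy.
  - intros u v Hu _ s. apply continuity_pt_filterlim, continuity_pt_div.
    + apply continuity_pt_const. now intros ? ?.
    + apply continuity_pt_filterlim, (continuous_Rmax_const (fun s => u s - xi s)).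
      intros r. apply (continuous_minus (V := R_NormedModule)); [apply Hu|apply Hxi].
    + generalize (Rmax_r (u s - xi s) d). lra.
  - intros u v _ _ s. apply continuous_const.
  - intros s y _. generalize (Rmax_r (y - xi s) d). intros Hm.
    unfold Rdiv. rewrite Rabs_mult, (Rabs_left (-2)) by lra.
    rewrite Rabs_right by (apply Rle_ge, Rlt_le, Rinv_0_lt_compat; lra).
    replace (- -2) with 2 by ring. apply Rmult_le_compat_l; [lra|]. now apply Rinv_le_contravar.
  - intros s y _. rewrite Rabs_R0. apply Rlt_le, Rdiv_lt_0_compat; lra.
  - intros s y z y' z'. eapply Rle_trans; [now apply trunc_lip|].
    apply Rmult_le_compat_l; [lra|].
    replace (y - xi s - (y' - xi s)) with (y - y') by ring.
    generalize (Rabs_pos (z - z')). lra.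
  - intros s y z y' z'. rewrite Rminus_diag, Rabs_R0.
    apply Rmult_le_pos; [lra|]. generalize (Rabs_pos (y - y')) (Rabs_pos (z - z')). lra.
  - exists u. split; [easy|]. intros a b s _. apply Huv.
Qed.

Lemma cderive_RtoC (u : R -> R) (s l : R) : is_derive u s l -> cderive (fun s => RtoC (u s)) s (RtoC l).
Proof. intros H. split; simpl; [easy|]. apply is_derive_Reals, derivable_pt_lim_const. Qed.

Lemma trunc_flow_dep (xi : R -> R) (d a b : R) (u v : R -> R) (s1 s2 : R) :
  0 < d -> trunc_flow xi d a b u -> trunc_flow xi d a b v ->
  a <= s1 <= b -> a <= s2 <= b ->
  (u s2 - v s2) ^ 2 <= (u s1 - v s1) ^ 2 * exp ((4 / d ^ 2 + 1) * (b - a)).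
Proof.
  intros Hd Hu Hv Hs1 Hs2.
  assert (HL : 0 < 2 / d ^ 2) by (apply Rdiv_lt_0_compat; [lra|now apply pow_lt]).
  assert (H := cgronwall (fun s => RtoC (u s - v s))
    (fun s => RtoC (-2 / Rmax (u s - xi s) d - -2 / Rmax (v s - xi s) d)) a b (2 / d ^ 2) 0 s1 s2).
  cbv beta in H. rewrite !Cmod_R, !pow2_abs in H.
  replace (4 / d ^ 2) with (2 * (2 / d ^ 2)) by (field; lra).
  replace ((u s1 - v s1) ^ 2) with ((u s1 - v s1) ^ 2 + 0 ^ 2) by ring.
  apply H; try lra.
  - intros s Hs. apply (cderive_RtoC (fun s => u s - v s)).
    apply (is_derive_minus (V := R_NormedModule) u v); [now apply Hu|now apply Hv].
  - intros s Hs. rewrite !Cmod_R, Rplus_0_r. eapply Rle_trans; [now apply trunc_lip|].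
    replace (u s - xi s - (v s - xi s)) with (u s - v s) by ring. lra.
Qed.

Lemma trunc_flow_unique (xi : R -> R) (d a b : R) (u v : R -> R) (s1 s2 : R) :
  0 < d -> trunc_flow xi d a b u -> trunc_flow xi d a b v ->
  a <= s1 <= b -> a <= s2 <= b -> u s1 = v s1 -> u s2 = v s2.
Proof.
  intros Hd Hu Hv Hs1 Hs2 E.
  assert (H := trunc_flow_dep xi d a b u v s1 s2 Hd Hu Hv Hs1 Hs2).
  rewrite E, Rminus_diag, pow_i, Rmult_0_l in H by lia. nra.
Qed.

Section RealFlow.

Variable xi : R -> R.
Hypothesis Hxi : forall s, continuous xi s.

Lemma xi_cont s : continuity_pt xi s.
Proof. apply continuity_pt_filterlim, Hxi. Qed.

Lemma gap_cont u s l : is_derive u s l -> continuity_pt (fun s => u s - xi s) s.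
Proof.
  intros H. apply continuity_pt_minus; [now apply is_derive_continuity_pt with l|apply xi_cont].
Qed.

Lemma rsol_sub a b a' b' u : a <= a' -> b' <= b -> rsol xi a b u -> rsol xi a' b' u.
Proof. intros Ha Hb H s Hs. apply H. lra. Qed.

Lemma aliveR_sub x t t' : t' <= t -> aliveR xi x t -> aliveR xi x t'.
Proof. intros Ht [u [Hu E]]. exists u. split; [|easy]. apply (rsol_sub 0 t); auto; lra. Qed.

Lemma aliveR_start x t : 0 <= t -> aliveR xi x t -> xi 0 < x.
Proof. intros Ht [u [Hu <-]]. apply Hu. lra. Qed.

Lemma rsol_gap a b u : a <= b -> rsol xi a b u ->
  exists d, 0 < d /\ forall s, a <= s <= b -> d <= u s - xi s.
Proof.
  intros Hab Hu. destruct (continuity_ab_min (fun s => u s - xi s) a b Hab) as [m [Hm Hmab]].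
  - intros s Hs. apply (gap_cont u s (-2 / (u s - xi s))). now apply Hu.
  - exists (u m - xi m). split; [|easy]. generalize (Hu m Hmab). lra.
Qed.

Lemma rsol_trunc d a b u : rsol xi a b u -> (forall s, a <= s <= b -> d <= u s - xi s) ->
  trunc_flow xi d a b u.
Proof. intros Hu Hd s Hs. rewrite Rmax_left by auto. now apply Hu. Qed.

Lemma trunc_rsol d a b u : 0 < d -> trunc_flow xi d a b u ->
  (forall s, a <= s <= b -> d <= u s - xi s) -> rsol xi a b u.
Proof.
  intros H0 Hu Hd s Hs. generalize (Hu s Hs) (Hd s Hs). intros H1 H2.
  rewrite Rmax_left in H1 by easy. split; [lra|easy].
Qed.

Lemma rsol_unique a b u v s1 s2 : rsol xi a b u -> rsol xi a b v ->
  a <= s1 <= b -> a <= s2 <= b -> u s1 = v s1 -> u s2 = v s2.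
Proof.
  intros Hu Hv H1 H2 E.
  destruct (rsol_gap a b u ltac:(lra) Hu) as [d1 [Hd1 G1]].
  destruct (rsol_gap a b v ltac:(lra) Hv) as [d2 [Hd2 G2]].
  assert (Hd : 0 < Rmin d1 d2) by now apply Rmin_glb_lt.
  generalize (Rmin_l d1 d2) (Rmin_r d1 d2). intros L1 L2.
  apply (trunc_flow_unique xi (Rmin d1 d2) a b u v s1); auto; apply rsol_trunc; auto;
    intros s Hs; [generalize (G1 s Hs)|generalize (G2 s Hs)]; lra.
Qed.

Lemma rsol_decreasing a b u s1 s2 : rsol xi a b u -> a <= s1 -> s1 <= s2 -> s2 <= b -> u s2 <= u s1.
Proof.
  intros Hu H1 H12 H2.
  assert (H := mvt_le u (fun s => -2 / (u s - xi s)) s1 s2 0 H12).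
  enough (u s2 - u s1 <= 0 * (s2 - s1)) by lra. apply H.
  - intros s Hs. apply Hu. lra.
  - intros s Hs. destruct (Hu s ltac:(lra)) as [Hp _].
    assert (0 < / (u s - xi s)) by (apply Rinv_0_lt_compat; lra). unfold Rdiv. lra.
Qed.

(** The flow of the field truncated at distance [d / 2] agrees with the given
    flows on [[0, t)], and by continuity it is not affected by the truncation
    until a little after [t]. *)
Lemma rsol_continue x t d : 0 <= t -> 0 < d ->
  (forall s, 0 <= s < t -> exists u, rsol xi 0 s u /\ u 0 = x /\ forall r, 0 <= r <= s -> d <= u r - xi r) ->
  d <= x - xi 0 ->
  exists t', t < t' /\ aliveR xi x t'.
Proof.
  intros Ht Hd Hs Hx0.
  assert (Hd2 : 0 < d / 2) by lra.
  destruct (trunc_flow_exists xi (d / 2) 0 x Hxi Hd2) as [v [Ev Hv]].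
  assert (Hlt : forall s, 0 <= s < t -> d <= v s - xi s).
  { intros s Hst. destruct (Hs s Hst) as [u [Hu [Eu Hgap]]].
    replace (v s) with (u s); [apply Hgap; lra|].
    apply (trunc_flow_unique xi (d / 2) 0 s u v 0); auto; try lra.
    apply rsol_trunc; [easy|]. intros r Hr. generalize (Hgap r Hr). lra. }
  assert (Hcont : continuity_pt (fun s => v s - xi s) t) by (eapply gap_cont, (Hv t t); lra).
  assert (Hvt : 3 * d / 4 <= v t - xi t).
  { destruct (Rle_lt_dec (3 * d / 4) (v t - xi t)) as [H|H]; [easy|exfalso].
    destruct (Req_dec t 0) as [->|Hne]; [lra|].
    destruct (Hcont (d / 4) ltac:(lra)) as [e [He Hel]].
    set (s := Rmax 0 (t - e / 2)).
    assert (Hst : 0 <= s < t /\ t - e / 2 <= s).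
    { unfold s. split; [split; [apply Rmax_l|apply Rmax_lub_lt; lra]|apply Rmax_r]. }
    assert (HR : Rabs ((v s - xi s) - (v t - xi t)) < d / 4).
    { apply (Hel s). split; [split; [exact I|lra]|]. simpl. unfold R_dist. rewrite Rabs_left; lra. }
    apply Rabs_def2 in HR. generalize (Hlt s (proj1 Hst)). lra. }
  destruct (Hcont (d / 4) ltac:(lra)) as [e [He Hel]].
  exists (t + e / 2). split; [lra|]. exists v. split; [|easy].
  apply (trunc_rsol (d / 2)); auto.
  intros s Hst. destruct (Rlt_le_dec s t) as [H|H]; [generalize (Hlt s); lra|].
  destruct (Req_dec t s) as [<-|Hne]; [lra|].
  assert (HR : Rabs ((v s - xi s) - (v t - xi t)) < d / 4).
  { apply (Hel s). split; [split; [exact I|easy]|]. simpl. unfold R_dist. rewrite Rabs_right; lra. }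
  apply Rabs_def2 in HR. lra.
Qed.

Lemma aliveR_extend x t : 0 <= t -> aliveR xi x t -> exists t', t < t' /\ aliveR xi x t'.
Proof.
  intros Ht [u [Hu Eu]]. destruct (rsol_gap 0 t u Ht Hu) as [d [Hd Hg]].
  apply (rsol_continue x t d); auto.
  - intros s Hs. exists u. split; [apply (rsol_sub 0 t); auto; lra|]. split; [easy|].
    intros r Hr. apply Hg. lra.
  - rewrite <- Eu. apply Hg. lra.
Qed.

Lemma aliveR_0 x : xi 0 < x -> aliveR xi x 0.
Proof.
  intros Hx. destruct (rsol_continue x 0 (x - xi 0)) as [t' [Ht' Ha]]; try lra.
  - intros s Hs. lra.
  - apply (aliveR_sub x t'); [lra|easy].
Qed.

Lemma aliveR_open x t : 0 <= t -> aliveR xi x t ->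
  exists eta, 0 < eta /\ forall x', Rabs (x' - x) < eta -> aliveR xi x' t.
Proof.
  intros Ht [u [Hu Eu]]. destruct (rsol_gap 0 t u Ht Hu) as [d [Hd Hg]].
  set (Q := exp ((4 / (d / 2) ^ 2 + 1) * (t - 0))). assert (HQ : 0 < Q) by apply exp_pos.
  assert (HQ1 : 0 < sqrt Q) by now apply sqrt_lt_R0.
  exists (d / 2 / sqrt Q). split; [apply Rdiv_lt_0_compat; lra|].
  intros x' Hx'. assert (Hd2 : 0 < d / 2) by lra.
  destruct (trunc_flow_exists xi (d / 2) 0 x' Hxi Hd2) as [v [Ev Hv]].
  exists v. split; [|easy]. apply (trunc_rsol (d / 2)); auto.
  intros s Hs. assert (HD := trunc_flow_dep xi (d / 2) 0 t v u 0 s Hd2 (Hv 0 t)).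
  assert (Hu2 : trunc_flow xi (d / 2) 0 t u).
  { apply rsol_trunc; auto. intros r Hr. generalize (Hg r Hr). lra. }
  specialize (HD Hu2 ltac:(lra) Hs). rewrite Ev, Eu in HD. fold Q in HD.
  assert (HD2 : Rabs (v s - u s) <= d / 2).
  { apply sq_le; [lra|]. rewrite pow2_abs. apply Rle_trans with (1 := HD).
    rewrite <- (pow2_abs (x' - x)).
    apply Rle_trans with ((d / 2 / sqrt Q) ^ 2 * Q).
    - apply Rmult_le_compat_r; [lra|]. apply pow_incr. split; [apply Rabs_pos|lra].
    - rewrite <- (sqrt_sqrt Q) at 2 by lra. right. field. lra. }
  apply Rabs_le_between in HD2. generalize (Hg s Hs). lra.
Qed.

(** The failure time is the supremum of the survival times; survival already
    fails there because it extends beyond any time up to which it holds. *)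
Lemma aliveR_dichotomy x t : 0 <= t -> xi 0 < x -> ~ aliveR xi x t ->
  exists t', 0 < t' <= t /\ ~ aliveR xi x t' /\ forall s, 0 <= s < t' -> aliveR xi x s.
Proof.
  intros Ht Hx Hn.
  assert (Hbd : forall s, aliveR xi x s -> s <= t).
  { intros s Hs. destruct (Rle_lt_dec s t); [easy|]. exfalso. apply Hn.
    apply (aliveR_sub x s); [lra|easy]. }
  destruct (completeness (aliveR xi x)) as [t' [Hub Hlub]].
  { exists t. exact Hbd. }
  { exists 0. now apply aliveR_0. }
  assert (Hn' : 0 <= t' -> ~ aliveR xi x t').
  { intros H0 H. destruct (aliveR_extend x t' H0 H) as [t2 [H2 Ha]].
    generalize (Hub t2 Ha). lra. }
  assert (H0 : 0 <= t') by (apply Hub; now apply aliveR_0).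
  exists t'. split; [|split; [auto|]].
  - split; [|now apply Hlub]. destruct H0 as [H0| <-]; [easy|].
    exfalso. apply Hn'; [lra|now apply aliveR_0].
  - intros s Hs. apply NNPP. intros Hns. assert (t' <= s); [|lra].
    apply Hlub. intros r Hr. destruct (Rle_lt_dec r s); [easy|].
    exfalso. apply Hns. apply (aliveR_sub x r); [lra|easy].
Qed.

End RealFlow.

(** The difference of the two solutions cannot decrease as long as it exceeds
    [e]; the strict inequality at time [0] avoids any Lipschitz estimate. *)
Lemma rsol_compare xi eta e t u v s :
  (forall s, continuous xi s) -> (forall s, continuous eta s) ->
  rsol xi 0 t u -> rsol eta 0 t v -> (forall s, 0 <= s <= t -> eta s <= xi s + e) ->
  u 0 + e < v 0 -> 0 <= s <= t -> u s + e < v s.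
Proof.
  intros Hxi Heta Hu Hv He H0 Hs.
  set (D := fun s => v s - u s - e).
  assert (HD : forall s, 0 <= s <= t -> is_derive D s (-2 / (v s - eta s) - -2 / (u s - xi s))).
  { intros r Hr. destruct (Hu r Hr) as [_ Du], (Hv r Hr) as [_ Dv].
    replace (-2 / (v r - eta r) - -2 / (u r - xi r)) with
      (-2 / (v r - eta r) - -2 / (u r - xi r) - 0) by ring.
    apply (is_derive_minus (V := R_NormedModule) (fun s => v s - u s) (fun _ => e)).
    - now apply (is_derive_minus (V := R_NormedModule) v u).
    - apply is_derive_Reals, derivable_pt_lim_const. }
  assert (HDpos : forall s, 0 <= s <= t -> 0 < D s -> 0 <= -2 / (v s - eta s) - -2 / (u s - xi s)).
  { intros r Hr Hp. destruct (Hu r Hr) as [Hp1 _], (Hv r Hr) as [Hp2 _]. generalize (He r Hr). intros Her.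
    unfold D in Hp. assert (/ (v r - eta r) <= / (u r - xi r)) by (apply Rinv_le_contravar; lra).
    unfold Rdiv. lra. }
  assert (H : 0 < D s); [|unfold D in H; lra].
  destruct (Rlt_le_dec 0 (D s)) as [H|H]; [easy|exfalso].
  destruct (first_zero D 0 s) as [z [Hz [Hz0 Hzp]]]; try lra.
  { intros r Hr. eapply is_derive_continuity_pt, HD. lra. }
  { unfold D. lra. }
  assert (G := mvt_ge D (fun s => -2 / (v s - eta s) - -2 / (u s - xi s)) 0 z 0 ltac:(lra)).
  assert (G' : 0 * (z - 0) <= D z - D 0).
  { apply G.
    - intros r Hr. apply HD. lra.
    - intros r Hr. destruct (Req_dec r z) as [->|Hne]; [|apply HDpos; [lra|apply Hzp; lra]].
      destruct (Hu z ltac:(lra)) as [Hp1 _], (Hv z ltac:(lra)) as [Hp2 _].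
      generalize (He z ltac:(lra)). intros Hez. unfold D in Hz0.
      assert (/ (v z - eta z) <= / (u z - xi z)) by (apply Rinv_le_contravar; lra).
      unfold Rdiv. lra. }
  assert (0 < D 0) by (unfold D; lra). lra.
Qed.

(** Were the second flow the first to hit its driver, [rsol_compare] would keep
    it away from the driver until then. *)
Lemma aliveR_compare xi eta e x y t :
  (forall s, continuous xi s) -> (forall s, continuous eta s) -> 0 <= t -> 
  (forall s, 0 <= s <= t -> eta s <= xi s + e) -> x + e < y -> aliveR xi x t -> aliveR eta y t.
Proof.
  intros Hxi Heta Ht He Hxy [u [Hu Eu]]. apply NNPP. intros Hn.
  assert (Hy : eta 0 < y).
  { generalize (He 0 ltac:(lra)). destruct (Hu 0 ltac:(lra)) as [H _]. rewrite Eu in H. lra. }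
  destruct (aliveR_dichotomy eta Heta y t Ht Hy Hn) as [t' [Ht' [Hn' Hal]]].
  destruct (rsol_gap xi Hxi 0 t u Ht Hu) as [d [Hd Hg]].
  apply Hn'.
  destruct (rsol_continue eta Heta y t' d) as [t2 [Ht2 Ha2]]; try lra.
  - intros s Hs. destruct (Hal s Hs) as [v [Hv Ev]]. exists v. split; [easy|]. split; [easy|].
    intros r Hr.
    assert (C := rsol_compare xi eta e s u v r Hxi Heta ltac:(apply (rsol_sub xi 0 t); auto; lra) Hv
      ltac:(intros; apply He; lra) ltac:(rewrite Eu, Ev; lra) Hr).
    generalize (Hg r ltac:(lra)) (He r ltac:(lra)). lra.
  - generalize (Hg 0 ltac:(lra)) (He 0 ltac:(lra)). rewrite Eu. lra.
  - apply (aliveR_sub eta y t2); [lra|easy].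
Qed.

Lemma aliveR_mono xi x y t : (forall s, continuous xi s) -> 0 <= t -> x <= y ->
  aliveR xi x t -> aliveR xi y t.
Proof.
  intros Hxi Ht [Hxy| ->]; [|easy]. apply aliveR_compare with (e := 0); auto; [|lra].
  intros s _. lra.
Qed.

(** * Real points other than the driver survive backwards *)

Lemma vf_RtoC (x : R) : x <> 0 -> vf (RtoC x) = RtoC (-2 / x).
Proof.
  intros Hx. unfold vf. now rewrite RtoC_div.
Qed.

(** Complex solutions started just above a real one follow it as long as it
    keeps a distance [d] from the driver: while they are within [d / 2] of it,
    Gronwall's inequality shows that they are much closer. *)
Lemma flow_near_real xi V sg ts p d eps :
  (forall s, continuous xi s) -> sg <= ts -> 0 < d -> 0 < eps -> V ts = p ->
  (forall s, sg <= s <= ts -> d <= Rabs (V s - xi s) /\ is_derive V s (-2 / (V s - xi s))) ->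
  exists y0, 0 < y0 /\ forall y f, 0 < y < y0 -> hsol xi sg ts f -> f ts = (p, y) ->
    forall s, sg <= s <= ts -> Cmod (f s - RtoC (V s)) <= eps.
Proof.
  intros Hxi Hsg Hd Heps EV HV.
  set (L := 4 / d ^ 2). assert (HL : 0 < L) by (apply Rdiv_lt_0_compat; [lra|now apply pow_lt]).
  set (Q := exp ((2 * L + 1) * (ts - sg))). assert (HQ : 0 < Q) by apply exp_pos.
  assert (HQ1 : 1 <= Q).
  { unfold Q. apply Rle_trans with (exp 0); [rewrite exp_0; lra|].
    apply exp_increasing_le, Rmult_le_pos; lra. }
  set (m := Rmin (d / 2) eps). assert (Hm : 0 < m) by (apply Rmin_glb_lt; lra).
  exists (m / Q). split; [now apply Rdiv_lt_0_compat|].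
  intros y f Hy Hf Ef s Hs.
  assert (HyQ : y * Q < m).
  { apply Rlt_le_trans with (m / Q * Q); [apply Rmult_lt_compat_r; lra|right; field; lra]. }
  assert (Hym : y < m) by nra.
  assert (Hdist : Cmod (f ts - RtoC (V ts)) = y).
  { rewrite Ef, EV. unfold Cmod. simpl. replace (_ + _) with (y * y) by ring. apply sqrt_square. lra. }
  apply Rle_trans with m; [|apply Rmin_r].
  destruct (Rle_lt_dec (Cmod (f s - RtoC (V s))) m) as [H|H]; [easy|exfalso].
  assert (Hcd : forall r, sg <= r <= ts -> cderive (fun s => f s - RtoC (V s))%C r
     (vf (f r - RtoC (xi r)) - vf (RtoC (V r - xi r)))%C).
  { intros r Hr. destruct (HV r Hr) as [HV1 HV2]. apply cderive_minus; [now apply Hf|].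
    rewrite vf_RtoC; [now apply cderive_RtoC|]. intros E. rewrite E, Rabs_R0 in HV1. lra. }
  destruct (last_zero (fun s => m - Cmod (f s - RtoC (V s))) s ts) as [z [Hz [Hz0 Hzp]]]; try lra.
  { intros r Hr. apply continuity_pt_minus; [apply continuity_pt_const; now intros ? ?|].
    apply continuity_pt_ext with (fun s => Cmod ((fun s => f s - RtoC (V s))%C s - RtoC 0)).
    { intros x. f_equal. ring. }
    apply (Cmod_sub_continuity (fun s => f s - RtoC (V s))%C (fun _ => 0) r _ (Hcd r ltac:(lra))).
    apply continuous_const. }
  assert (G := cgronwall (fun s => f s - RtoC (V s))%C
    (fun r => vf (f r - RtoC (xi r)) - vf (RtoC (V r - xi r)))%C z ts L 0 ts z ltac:(lra) ltac:(lra) ltac:(lra) ltac:(lra)).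
  assert (G' : Cmod (f z - RtoC (V z)) ^ 2 <= (Cmod (f ts - RtoC (V ts)) ^ 2 + 0 ^ 2) * exp ((2 * L + 1) * (ts - z))).
  { apply G.
    - intros r Hr. apply Hcd. lra.
    - intros r Hr. destruct (HV r ltac:(lra)) as [HV1 _].
      assert (Hr1 : Cmod (f r - RtoC (V r)) <= d / 2).
      { apply Rle_trans with m; [|apply Rmin_l].
        destruct (Req_dec r z) as [->|Hne]; [lra|]. generalize (Hzp r ltac:(lra)). lra. }
      assert (HZ2 : d <= Cmod (RtoC (V r - xi r))) by now rewrite Cmod_R.
      assert (HZ1 : d / 2 <= Cmod (f r - RtoC (xi r))).
      { assert (T := Cmod_triangle (f r - RtoC (xi r)) (- (f r - RtoC (V r)))).
        rewrite Cmod_opp in T.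
        replace (f r - RtoC (xi r) + - (f r - RtoC (V r)))%C with (RtoC (V r - xi r)) in T
          by (rewrite RtoC_minus; ring). lra. }
      rewrite vf_diff; [|eapply Cmod_nonzero; [|exact HZ1]; lra|eapply Cmod_nonzero; [|exact HZ2]; lra].
      replace (f r - RtoC (xi r) - RtoC (V r - xi r))%C with (f r - RtoC (V r))%C
        by (rewrite RtoC_minus; ring).
      rewrite Rplus_0_r.
      eapply Rle_trans; [apply Cmod_div_le with (p := 2 * Cmod (f r - RtoC (V r))) (q := d / 2 * d)|].
      + nra.
      + apply Cmod_mult_le; [rewrite Cmod_R, Rabs_right; lra|apply Rle_refl].
      + apply Cmod_mult_ge; lra.
      + unfold L. right. field. lra. }
  rewrite Hdist in G'.
  assert (exp ((2 * L + 1) * (ts - z)) <= Q).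
  { apply exp_increasing_le, Rmult_le_compat_l; lra. }
  assert (Cmod (f z - RtoC (V z)) ^ 2 <= (y * Q) ^ 2).
  { apply Rle_trans with (1 := G'). rewrite Rpow_mult_distr.
    replace (y ^ 2 + 0 ^ 2) with (y ^ 2) by ring. apply Rmult_le_compat_l; [apply pow2_ge_0|]. nra. }
  replace (Cmod (f z - RtoC (V z))) with m in H1 by lra.
  apply sq_le in H1; nra.
Qed.

(** If the backward flow of a real point [p] met the driver, the complex flows
    started just above [p] would be close to the driver for a positive time,
    although by [alive_near_real] a rectangle around [p] survives.  The two
    sides of the driver are treated together: [e] is [1] or [-1], and reflection
    exchanges the sides. *)
Lemma backward_survival xi T gamma e ts p :
  (forall s, continuous xi s) -> slit_curve xi T gamma -> e = 1 \/ e = -1 ->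
  0 < ts <= T -> 0 < e * (p - xi ts) ->
  exists u, rsol (fun s => e * xi s) 0 ts u /\ u ts = e * p.
Proof.
  intros Hxi Hslit He Hts Hp.
  assert (Hee : e * e = 1) by (destruct He as [->| ->]; ring).
  set (eta := fun s => e * xi s).
  assert (Heta : forall s, continuous eta s).
  { intros s. apply (continuous_scal_r (V := R_NormedModule) e xi), Hxi. }
  apply NNPP. intros Hno.
  assert (Hpne : p <> xi ts) by (intros E; rewrite E, Rminus_diag in Hp; lra).
  destruct (alive_near_real xi T gamma Hxi Hslit ts p Hts Hpne) as [r [Hr Hal]].
  apply (surviving_stretch_avoids_driver xi Hxi 0 ts p r); [lra|easy|easy|].
  intros rho Hrho.
  set (d := Rmin (rho / 4) (e * (p - xi ts) / 2)).
  assert (Hd : 0 < d) by (apply Rmin_glb_lt; lra).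
  assert (Hd1 : d <= rho / 4) by apply Rmin_l.
  assert (Hd2 : d < e * p - eta ts).
  { apply Rle_lt_trans with (1 := Rmin_r _ _). unfold eta. lra. }
  destruct (trunc_flow_exists eta d ts (e * p) Heta Hd) as [V [EV HV]].
  assert (Hlow : exists s, 0 <= s <= ts /\ V s - eta s < d).
  { apply NNPP. intros Hn. apply Hno. exists V. split; [|easy].
    apply (trunc_rsol eta d); auto. intros s Hs.
    destruct (Rle_lt_dec d (V s - eta s)); [easy|]. exfalso. apply Hn. now exists s. }
  destruct Hlow as [s0 [Hs0 Hlow]].
  assert (HVc : forall s, continuity_pt (fun s => V s - eta s) s).
  { intros s. eapply gap_cont; [easy|]. apply (HV s s). lra. }
  destruct (last_zero (fun s => V s - eta s - d) s0 ts) as [z [Hz [Hz0 Hzp]]]; try lra.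
  { intros s Hs. apply continuity_pt_minus; [apply HVc|]. apply continuity_pt_const. now intros ? ?. }
  assert (Hge : forall s, z <= s <= ts -> d <= V s - eta s).
  { intros s Hs. destruct (Req_dec s z) as [->|Hne]; [lra|]. generalize (Hzp s ltac:(lra)). lra. }
  destruct (flow_near_real xi (fun s => e * V s) z ts p d d Hxi ltac:(lra) Hd Hd) as [y0 [Hy0 Hnear]].
  { rewrite EV, <- Rmult_assoc, Hee. ring. }
  { intros s Hs. assert (G := Hge s Hs).
    assert (E : e * V s - xi s = e * (V s - eta s)).
    { unfold eta. replace (e * (V s - e * xi s)) with (e * V s - (e * e) * xi s) by ring. rewrite Hee. ring. }
    split.
    - rewrite E. destruct He as [->| ->]; [rewrite Rabs_right|rewrite Rabs_left]; lra.
    - rewrite E. replace (-2 / (e * (V s - eta s))) with (e * (-2 / (V s - eta s))).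
      + apply (is_derive_scal V). generalize (HV s s s ltac:(lra)). now rewrite Rmax_left.
      + destruct He as [->| ->]; field; lra. }
  destruct (HVc z d Hd) as [h [Hh Hhl]].
  exists z, (Rmin (z + h / 2) ts), y0.
  split; [lra|]. split; [apply Rmin_glb_lt; lra|]. split; [apply Rmin_r|]. split; [easy|].
  intros y f Hy Hf Ef s [Hs1 Hs2].
  generalize (Rmin_l (z + h / 2) ts) (Rmin_r (z + h / 2) ts). intros M1 M2.
  assert (N := Hnear y f Hy ltac:(apply (hsol_sub xi 0 ts); auto; lra) Ef s ltac:(lra)).
  assert (HVs : Rabs (e * V s - xi s) <= 2 * d).
  { replace (e * V s - xi s) with (e * (V s - eta s)).
    2: { unfold eta. replace (e * (V s - e * xi s)) with (e * V s - (e * e) * xi s) by ring. rewrite Hee. ring. }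
    assert (G := Hge s ltac:(lra)).
    replace (Rabs (e * (V s - eta s))) with (V s - eta s)
      by (destruct He as [->| ->]; [rewrite Rabs_right|rewrite Rabs_left]; lra).
    destruct (Req_dec z s) as [<-|Hne]; [lra|].
    assert (HR : Rabs ((V s - eta s) - (V z - eta z)) < d).
    { apply (Hhl s). split; [split; [exact I|easy]|]. simpl. unfold R_dist. rewrite Rabs_right; lra. }
    apply Rabs_def2 in HR. lra. }
  assert (Tr := Cmod_triangle (f s - RtoC (e * V s)) (RtoC (e * V s - xi s))).
  rewrite Cmod_R in Tr.
  replace (f s - RtoC (e * V s) + RtoC (e * V s - xi s))%C with (f s - RtoC (xi s))%C in Tr
    by (rewrite RtoC_minus; ring).
  lra.
Qed.

(** * Hitting times do not jump *)

Section NoGap.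

Variable xi : R -> R.
Hypothesis Hxi : forall s, continuous xi s.
Variables t0 t1 x0 : R.
Hypothesis Ht : 0 <= t0 < t1.
Hypothesis Hback : forall ts p, 0 < ts <= t1 -> xi ts < p -> exists u, rsol xi 0 ts u /\ u ts = p.
Hypothesis Hdead : ~ aliveR xi x0 t0.

Lemma flows_descend t eps : 0 < t -> t0 <= t <= t1 -> 0 < eps ->
  exists y, x0 < y /\ forall u, rsol xi 0 t1 u -> u 0 < y -> u t <= xi t + eps.
Proof.
  intros Htp Ht' Heps.
  destruct (Hback t (xi t + eps) ltac:(lra) ltac:(lra)) as [v [Hv Ev]].
  exists (v 0). split.
  - destruct (Rlt_le_dec x0 (v 0)) as [H|H]; [easy|]. exfalso. apply Hdead.
    apply (aliveR_sub xi x0 t); [lra|].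
    apply (aliveR_mono xi (v 0)); auto; [lra|]. now exists v.
  - intros u Hu H0.
    assert (C := rsol_compare xi xi 0 t u v t Hxi Hxi ltac:(apply (rsol_sub xi 0 t1); auto; lra) Hv
      ltac:(intros; lra) ltac:(lra) ltac:(lra)). lra.
Qed.

Lemma flows_descend_finite (sg : nat -> R) (N : nat) eps : 0 < eps ->
  (forall i, (i <= N)%nat -> 0 < sg i /\ t0 <= sg i <= t1) ->
  exists y, x0 < y /\ forall u, rsol xi 0 t1 u -> u 0 < y ->
    forall i, (i <= N)%nat -> u (sg i) <= xi (sg i) + eps.
Proof.
  intros Heps. induction N as [|N IH]; intros Hsg.
  - destruct (Hsg 0%nat (le_n _)) as [H1 H2].
    destruct (flows_descend (sg 0%nat) eps H1 H2 Heps) as [y [Hy H]].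
    exists y. split; [easy|]. intros u Hu H0 i Hi. replace i with 0%nat by lia. now apply H.
  - destruct (Hsg (S N) (le_n _)) as [H1 H2].
    destruct (flows_descend (sg (S N)) eps H1 H2 Heps) as [y [Hy H]].
    destruct IH as [y' [Hy' H']]; [intros i Hi; apply Hsg; lia|].
    exists (Rmin y y'). split; [now apply Rmin_glb_lt|].
    generalize (Rmin_l y y') (Rmin_r y y'). intros M1 M2 u Hu H0 i Hi.
    destruct (Nat.eq_dec i (S N)) as [->|Hne]; [apply H|apply H']; auto; try lra; lia.
Qed.

(** If all points to the right of [x0] survived to time [t1], their flows
    would decrease to the driver, uniformly on a time interval of positive
    length because they are monotone in time; but close to the driver their
    speed is too large for that. *)
Lemma no_gap : exists x, x0 < x /\ ~ aliveR xi x t1.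
Proof.
  apply NNPP. intros Hn.
  assert (Hal : forall x, x0 < x -> aliveR xi x t1).
  { intros x Hx. apply NNPP. intros H. apply Hn. now exists x. }
  set (s0 := (t0 + t1) / 2). assert (Hs0 : t0 < s0 < t1) by (unfold s0; lra).
  assert (Hs0p : 0 < s0) by lra. clearbody s0.
  set (A := Rabs (xi s0 + 1 - xi t1) + 1).
  assert (HA : 0 < A) by (unfold A; generalize (Rabs_pos (xi s0 + 1 - xi t1)); lra).
  (* so close to the driver that the speed exceeds what [u] can descend, [A] *)
  set (eps := Rmin 1 ((t1 - s0) / A)).
  assert (Heps : 0 < eps) by (apply Rmin_glb_lt; [lra|apply Rdiv_lt_0_compat; lra]).
  assert (HepsA : A * eps <= t1 - s0).
  { apply Rle_trans with (A * ((t1 - s0) / A)).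
    - apply Rmult_le_compat_l; [lra|apply Rmin_r].
    - right. field. lra. }
  assert (Heps1 : eps <= 1) by apply Rmin_l. clearbody eps.
  destruct (unifcont_1d xi s0 t1 (fun x _ => Hxi x) (mkposreal eps Heps)) as [dl Hdl].
  assert (Hosc : forall x y, s0 <= x <= t1 -> s0 <= y <= t1 -> Rabs (y - x) < dl -> Rabs (xi y - xi x) < eps).
  { intros x y Hx Hy Hxy. exact (NNPP _ (Hdl x y Hx Hy Hxy)). }
  destruct (INR_unbounded ((t1 - s0) / dl)) as [N HN].
  assert (Hdlp := cond_pos dl).
  assert (HN0 : 0 < INR N).
  { assert (0 < (t1 - s0) / dl) by (apply Rdiv_lt_0_compat; lra). lra. }
  set (h := (t1 - s0) / INR N).
  assert (Hh : 0 < h < dl).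
  { split; [apply Rdiv_lt_0_compat; lra|]. unfold h.
    apply Rmult_lt_reg_r with (INR N); [easy|].
    replace ((t1 - s0) / INR N * INR N) with (t1 - s0) by (field; lra).
    apply (Rmult_lt_compat_r dl) in HN; [|easy].
    replace ((t1 - s0) / dl * dl) with (t1 - s0) in HN by (field; lra). lra. }
  set (sg := fun i : nat => s0 + INR i * h).
  assert (HsgN : sg N = t1) by (unfold sg, h; field; lra).
  assert (Hsg0 : sg 0%nat = s0) by (unfold sg; simpl; ring).
  assert (Hsg : forall i, (i <= N)%nat -> s0 <= sg i <= t1).
  { intros i Hi. rewrite <- HsgN. unfold sg. apply le_INR in Hi. generalize (pos_INR i). intros.
    split; [nra|]. apply Rplus_le_compat_l, Rmult_le_compat_r; lra. }
  destruct (flows_descend_finite sg N eps Heps) as [y [Hy Hdesc]].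
  { intros i Hi. generalize (Hsg i Hi). lra. }
  destruct (Hal ((x0 + y) / 2) ltac:(lra)) as [u [Hu Eu]].
  assert (Hd := Hdesc u Hu ltac:(rewrite Eu; lra)).
  assert (Hclose : forall s, s0 <= s <= t1 -> u s - xi s <= 2 * eps).
  { intros s Hs. destruct (Req_dec s t1) as [->|Hne].
    - generalize (Hd N (le_n _)). rewrite HsgN. lra.
    - destruct (discrete_crossing sg s N) as [i [Hi Hcr]]; [lra|lra|].
      assert (Hsi := Hsg i ltac:(lia)).
      assert (D := rsol_decreasing xi 0 t1 u (sg i) s Hu ltac:(lra) ltac:(lra) ltac:(lra)).
      assert (O := Hosc (sg i) s Hsi Hs).
      assert (sg (S i) = sg i + h) by (unfold sg; rewrite S_INR; ring).
      rewrite Rabs_right in O by lra. specialize (O ltac:(lra)). apply Rabs_def2 in O.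
      generalize (Hd i ltac:(lia)). lra. }
  assert (G := mvt_le u (fun s => -2 / (u s - xi s)) s0 t1 (- / eps) ltac:(lra)).
  assert (G' : u t1 - u s0 <= - / eps * (t1 - s0)).
  { apply G.
    - intros s Hs. apply Hu. lra.
    - intros s Hs. destruct (Hu s ltac:(lra)) as [Hp _]. assert (C := Hclose s Hs).
      assert (/ (2 * eps) <= / (u s - xi s)) by (apply Rinv_le_contravar; lra).
      rewrite Rinv_mult in H by lra. unfold Rdiv. lra. }
  assert (H1 := Hd 0%nat ltac:(lia)). rewrite Hsg0 in H1.
  destruct (Hu t1 ltac:(lra)) as [H2 _].
  assert (H3 : A <= / eps * (t1 - s0)).
  { apply Rle_trans with (/ eps * (A * eps)); [right; field; lra|].
    apply Rmult_le_compat_l; [|easy]. now apply Rlt_le, Rinv_0_lt_compat. }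
  unfold A in H3. generalize (Rle_abs (xi s0 + 1 - xi t1)). lra.
Qed.

End NoGap.

(** * One-sided derivatives *)

Lemma derive_within_eps (D : R -> Prop) (f : R -> R) (s l : R) : D s ->
  is_derive_within (V := R_NormedModule) D f s l <->
  forall eps, 0 < eps -> exists delta, 0 < delta /\ forall y, D y -> Rabs (y - s) < delta ->
    Rabs (f y - f s - (y - s) * l) <= eps * Rabs (y - s).
Proof.
  intros HD. split.
  - intros [_ H] eps Heps.
    destruct (H s) with (eps := mkposreal eps Heps) as [delta Hd].
    { intros P [e He]. exists e. intros y Hy _. now apply He. }
    exists delta. split; [apply cond_pos|]. intros y HDy Hy. exact (Hd y Hy HDy).
  - intros H. split; [apply (is_linear_scal_l (V := R_NormedModule))|].
    intros x Hx.
    assert (Exs : x = s).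
    { destruct (Req_dec x s) as [E|Hne]; [easy|exfalso].
      assert (Hp : 0 < Rabs (x - s)) by (apply Rabs_pos_lt; lra).
      destruct (Hx (fun y => Rabs (y - x) < Rabs (x - s))) as [e He].
      - exists (mkposreal _ Hp). intros y Hy. exact Hy.
      - specialize (He s (ball_center s e) HD). simpl in He. rewrite Rabs_minus_sym in He. lra. }
    subst x. intros eps. destruct (H eps (cond_pos eps)) as [delta [Hd Hdl]].
    exists (mkposreal delta Hd). intros y Hy HDy. exact (Hdl y HDy Hy).
Qed.

Lemma derive_eps (f : R -> R) (s l : R) :
  is_derive f s l <->
  forall eps, 0 < eps -> exists delta, 0 < delta /\ forall y, Rabs (y - s) < delta ->
    Rabs (f y - f s - (y - s) * l) <= eps * Rabs (y - s).
Proof.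
  split.
  - intros [_ H] eps Heps.
    destruct (H s) with (eps := mkposreal eps Heps) as [delta Hd].
    { now intros P HP. }
    exists delta. split; [apply cond_pos|]. intros y Hy. exact (Hd y Hy).
  - intros H. split; [apply (is_linear_scal_l (V := R_NormedModule))|].
    intros x Hx. apply (is_filter_lim_locally_unique (V := R_NormedModule)) in Hx. subst x.
    intros eps. destruct (H eps (cond_pos eps)) as [delta [Hd Hdl]].
    exists (mkposreal delta Hd). intros y Hy. exact (Hdl y Hy).
Qed.

(** Affine continuation outside [[a, b]], which turns one-sided derivatives
    at the endpoints into derivatives. *)
Definition affine_ext (a b : R) (f f' : R -> R) (s : R) : R :=
  if Rlt_dec s a then f a + f' a * (s - a)
  else if Rlt_dec b s then f b + f' b * (s - b) else f s.

Lemma affine_ext_in a b f f' s : a <= s <= b -> affine_ext a b f f' s = f s.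
Proof.
  intros Hs. unfold affine_ext. destruct (Rlt_dec s a); [lra|]. destruct (Rlt_dec b s); [lra|easy].
Qed.

Lemma affine_ext_derive a b (f f' : R -> R) :
  (forall s, a <= s <= b -> is_derive_within (V := R_NormedModule) (fun r => a <= r <= b) f s (f' s)) ->
  forall s, a <= s <= b -> is_derive (affine_ext a b f f') s (f' s).
Proof.
  intros H s Hs. apply derive_eps. intros eps Heps.
  destruct (proj1 (derive_within_eps _ f s (f' s) Hs) (H s Hs) eps Heps) as [d [Hd Hdl]].
  set (da := if Req_EM_T s a then 1 else s - a). set (db := if Req_EM_T s b then 1 else b - s).
  assert (Hda : 0 < da) by (unfold da; destruct (Req_EM_T s a); lra).
  assert (Hdb : 0 < db) by (unfold db; destruct (Req_EM_T s b); lra).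
  exists (Rmin d (Rmin da db)). split; [repeat apply Rmin_glb_lt; easy|].
  intros y Hy. generalize (Rmin_l d (Rmin da db)) (Rmin_r d (Rmin da db)) (Rmin_l da db) (Rmin_r da db).
  intros M1 M2 M3 M4. rewrite (affine_ext_in a b f f' s Hs).
  assert (Hz : 0 <= eps * Rabs (y - s)) by (apply Rmult_le_pos; [lra|apply Rabs_pos]).
  unfold affine_ext. destruct (Rlt_dec y a) as [Ha|Ha]; [|destruct (Rlt_dec b y) as [Hb|Hb]].
  - unfold da in *. destruct (Req_EM_T s a) as [->|Hne].
    + replace (_ - _ - _) with 0 by ring. now rewrite Rabs_R0.
    + rewrite Rabs_left in Hy by lra. lra.
  - unfold db in *. destruct (Req_EM_T s b) as [->|Hne].
    + replace (_ - _ - _) with 0 by ring. now rewrite Rabs_R0.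
    + rewrite Rabs_right in Hy by lra. lra.
  - apply Hdl; lra.
Qed.

Lemma derive_within_sub (D D' : R -> Prop) (f : R -> R) (s l : R) : D s -> D' s ->
  (forall y, D' y -> D y) ->
  is_derive_within (V := R_NormedModule) D f s l -> is_derive_within (V := R_NormedModule) D' f s l.
Proof.
  intros Hs Hs' Hsub H. apply derive_within_eps; [easy|]. intros eps Heps.
  destruct (proj1 (derive_within_eps D f s l Hs) H eps Heps) as [d [Hd Hdl]].
  exists d. split; [easy|]. auto.
Qed.

(** * Hitting times in terms of survival *)

Lemma real_solution_rsol xi x t u b : (forall s, continuous xi s) -> xi 0 < x ->
  is_real_solution xi x t u -> 0 <= b < t ->
  exists v, rsol xi 0 b v /\ v 0 = x /\ forall s, 0 <= s <= b -> v s = u s.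
Proof.
  intros Hxi Hx [Hu0 Hu] Hb.
  set (v := affine_ext 0 b u (fun s => -2 / (u s - xi s))).
  assert (Ev : forall s, 0 <= s <= b -> v s = u s) by (intros s Hs; now apply affine_ext_in).
  assert (Dv : forall s, 0 <= s <= b -> is_derive v s (-2 / (v s - xi s))).
  { intros s Hs. rewrite (Ev s Hs).
    apply (affine_ext_derive 0 b u (fun s => -2 / (u s - xi s))); [|easy].
    intros r Hr. apply derive_within_sub with (fun r => 0 <= r < t); [lra|easy|intros; lra|].
    apply Hu. lra. }
  exists v. split; [|split; [rewrite Ev by lra; easy|easy]].
  intros s Hs. split; [|now apply Dv].
  destruct (Rlt_le_dec (xi s) (v s)) as [H|H]; [easy|exfalso].
  destruct (first_zero (fun s => v s - xi s) 0 s) as [z [Hz [Hz0 _]]]; try lra.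
  - intros r Hr. eapply gap_cont; [easy|]. apply Dv. lra.
  - rewrite Ev, Hu0 by lra. lra.
  - destruct (Hu z ltac:(lra)) as [Hne _]. apply Hne. rewrite <- Ev by lra. lra.
Qed.

Lemma LimInf_left_pos f t m : LimInf_left f t = Finite 0 -> 0 < m -> ~ at_left t (fun s => m <= f s).
Proof.
  intros H Hm Hat. unfold LimInf_left in H.
  destruct (Lub_Rbar_correct (fun m => at_left t (fun s => m <= f s))) as [Hub _].
  rewrite H in Hub. specialize (Hub m Hat). simpl in Hub. lra.
Qed.

Lemma LimInf_left_zero f t : (forall s, 0 <= f s) ->
  (forall m, 0 < m -> ~ at_left t (fun s => m <= f s)) -> LimInf_left f t = Finite 0.
Proof.
  intros Hf H. apply is_lub_Rbar_unique. split.
  - intros m Hm. simpl. destruct (Rle_lt_dec m 0); [easy|]. exfalso. now apply (H m).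
  - intros b Hb. apply (Hb 0). apply filter_forall. apply Hf.
Qed.

(** A solution on [[0, t)] whose distance to the driver had a positive lower
    limit at [t] would extend beyond [t].  The solutions on the intervals
    [[0, s]] with [s < t] are glued to one on [[0, t)] by uniqueness. *)
Lemma hits_iff xi x t : (forall s, continuous xi s) -> xi 0 < x -> 0 < t ->
  (exists u, is_real_solution xi x t u /\ LimInf_left (fun s => Rabs (u s - xi s)) t = Finite 0) <->
  (~ aliveR xi x t /\ forall s, 0 <= s < t -> aliveR xi x s).
Proof.
  intros Hxi Hx Ht. split.
  - intros [u [Hu Hl]]. split.
    + intros [w [Hw Ew]]. destruct (rsol_gap xi Hxi 0 t w ltac:(lra) Hw) as [d [Hd Hg]].
      apply (LimInf_left_pos _ _ d Hl Hd).
      exists (mkposreal t Ht). intros s Hs Hst.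
      change (Rabs (s - t) < t) in Hs. rewrite Rabs_left in Hs by lra.
      destruct (real_solution_rsol xi x t u s Hxi Hx Hu ltac:(lra)) as [v [Hv [Ev Euv]]].
      rewrite <- Euv by lra.
      replace (v s) with (w s).
      * assert (G := Hg s ltac:(lra)). rewrite Rabs_right; lra.
      * apply (rsol_unique xi Hxi 0 s w v 0); try lra; [apply (rsol_sub xi 0 t); auto; lra|easy].
    + intros s Hs. destruct (real_solution_rsol xi x t u s Hxi Hx Hu Hs) as [v [Hv [Ev _]]].
      now exists v.
  - intros [Hn Hal].
    assert (HU : forall sg, exists w, 0 <= sg < t -> rsol xi 0 sg w /\ w 0 = x).
    { intros sg. destruct (classic (0 <= sg < t)) as [Hsg|Hsg].
      - destruct (Hal sg Hsg) as [w Hw]. now exists w.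
      - now exists (fun _ => 0). }
    set (U := fun sg => proj1_sig (constructive_indefinite_description _ (HU sg))).
    assert (HUs : forall sg, 0 <= sg < t -> rsol xi 0 sg (U sg) /\ U sg 0 = x).
    { intros sg. apply (proj2_sig (constructive_indefinite_description _ (HU sg))). }
    clearbody U.
    assert (Hagree : forall s1 s2 r, 0 <= r -> r <= s1 < t -> r <= s2 < t -> U s1 r = U s2 r).
    { intros s1 s2 r Hr H1 H2. destruct (HUs s1 ltac:(lra)) as [A1 B1], (HUs s2 ltac:(lra)) as [A2 B2].
      apply (rsol_unique xi Hxi 0 r (U s1) (U s2) 0); try lra.
      - apply (rsol_sub xi 0 s1); auto; lra.
      - apply (rsol_sub xi 0 s2); auto; lra. }
    set (u := fun s => U ((s + t) / 2) s).
    assert (Hu : forall sg r, 0 <= r -> r <= sg < t -> u r = U sg r).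
    { intros sg r Hr Hsg. unfold u. apply Hagree; lra. }
    assert (Hupos : forall s, 0 <= s < t -> xi s < u s).
    { intros s Hs. rewrite (Hu s s) by lra. apply (HUs s Hs). lra. }
    exists u. split.
    + split.
      * rewrite (Hu 0 0) by lra. apply HUs. lra.
      * intros s Hs. split; [generalize (Hupos s Hs); lra|].
        apply derive_within_eps; [easy|]. intros eps Heps.
        set (sg := (s + t) / 2).
        destruct (HUs sg ltac:(unfold sg; lra)) as [HUsg _].
        destruct (HUsg s ltac:(unfold sg; lra)) as [_ Dsg].
        destruct (proj1 (derive_eps _ _ _) Dsg eps Heps) as [d [Hd Hdl]].
        exists (Rmin d (sg - s)). split; [apply Rmin_glb_lt; [easy|unfold sg; lra]|].
        intros y Hy Hys. generalize (Rmin_l d (sg - s)) (Rmin_r d (sg - s)) (Rle_abs (y - s)). intros.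
        rewrite (Hu sg s), (Hu sg y) by (unfold sg in *; lra). apply Hdl. lra.
    + apply LimInf_left_zero; [intros; apply Rabs_pos|].
      intros m Hm [e He].
      assert (Hfar : forall s, 0 <= s < t -> t - e < s -> m <= u s - xi s).
      { intros s Hs Hse. generalize (Hupos s Hs). intros.
        assert (G := He s). rewrite Rabs_right in G by lra. apply G; [|lra].
        change (Rabs (s - t) < e). rewrite Rabs_left; lra. }
      assert (Hep := cond_pos e).
      set (b := Rmax 0 (t - e / 2)).
      assert (Hb : 0 <= b < t /\ t - e / 2 <= b).
      { unfold b. split; [split; [apply Rmax_l|apply Rmax_lub_lt; lra]|apply Rmax_r]. }
      clearbody b. destruct (HUs b (proj1 Hb)) as [Hrb Eb].
      destruct (rsol_gap xi Hxi 0 b (U b) ltac:(lra) Hrb) as [d [Hd Hg]].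
      destruct (rsol_continue xi Hxi x t (Rmin m d)) as [t' [Ht' Ha]].
      * lra.
      * now apply Rmin_glb_lt.
      * intros s Hs. destruct (HUs s Hs) as [H1 H2]. exists (U s). split; [easy|]. split; [easy|].
        intros r Hr. generalize (Rmin_l m d) (Rmin_r m d). intros.
        destruct (Rle_lt_dec r b) as [Hrb'|Hrb'].
        -- rewrite (Hagree s b r) by lra. generalize (Hg r ltac:(lra)). lra.
        -- rewrite <- (Hu s r) by lra. generalize (Hfar r ltac:(lra) ltac:(lra)). lra.
      * generalize (Hg 0 ltac:(lra)) (Rmin_r m d). rewrite Eb. lra.
      * apply Hn. apply (aliveR_sub xi x t'); [lra|easy].
Qed.

Lemma hitting_time_spec T xi x : (forall s, continuous xi s) -> xi 0 < x ->
  (exists t, hitting_time T xi x = Finite t /\ 0 < t /\ Rbar_le t T /\ ~ aliveR xi x t /\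
     forall s, 0 <= s < t -> aliveR xi x s) \/
  (hitting_time T xi x = p_infty /\ forall t, time_interval T t -> aliveR xi x t).
Proof.
  intros Hxi Hx. unfold hitting_time. destruct (Req_EM_T x (xi 0)) as [E|_]; [lra|].
  destruct (classic (exists t, time_interval T t /\ ~ aliveR xi x t)) as [[t1 [[Ht1 HtT] Hn1]]|Hno].
  - left. destruct (aliveR_dichotomy xi Hxi x t1 Ht1 Hx Hn1) as [t [Ht [Hn Hal]]].
    assert (HtT' : Rbar_le t T) by (apply Rbar_le_trans with t1; [simpl; lra|easy]).
    exists t. split; [|repeat split; auto; lra].
    apply is_glb_Rbar_unique. split.
    + intros s [Hs [_ Hex]]. apply hits_iff in Hex; auto. destruct Hex as [Hns _].
      simpl. destruct (Rle_lt_dec t s); [easy|]. exfalso. apply Hns, Hal. lra.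
    + intros b Hb. apply Hb. split; [lra|]. split; [easy|]. apply hits_iff; auto. lra.
  - right.
    assert (Hal : forall t, time_interval T t -> aliveR xi x t).
    { intros t Ht. apply NNPP. intros Hn. apply Hno. now exists t. }
    split; [|easy]. apply is_glb_Rbar_unique. split.
    + intros s [Hs [HsT Hex]]. apply hits_iff in Hex; auto. destruct Hex as [Hns _].
      exfalso. apply Hns, Hal. split; [lra|easy].
    + intros b _. now destruct b.
Qed.

Lemma real_solution_neg xi x t u : is_real_solution xi x t u ->
  is_real_solution (fun s => - xi s) (- x) t (fun s => - u s).
Proof.
  intros [H0 H]. split; [now rewrite H0|]. intros s Hs. destruct (H s Hs) as [Hne Hd].
  split; [lra|]. apply derive_within_eps; [easy|]. intros eps Heps.
  destruct (proj1 (derive_within_eps _ _ _ _ Hs) Hd eps Heps) as [d [Hdp Hdl]].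
  exists d. split; [easy|]. intros y Hy Hys. specialize (Hdl y Hy Hys).
  rewrite <- Rabs_Ropp.
  replace (- (- u y - - u s - (y - s) * (-2 / (- u s - - xi s)))) with
    (u y - u s - (y - s) * (-2 / (u s - xi s))); [easy|].
  field. lra.
Qed.

Lemma hitting_time_neg T xi x : hitting_time T (fun s => - xi s) (- x) = hitting_time T xi x.
Proof.
  unfold hitting_time. destruct (Req_EM_T (- x) (- xi 0)), (Req_EM_T x (xi 0)); try lra; [easy|].
  assert (HL : forall u v : R -> R, (forall s, Rabs (u s) = Rabs (v s)) -> forall t,
    LimInf_left (fun s => Rabs (u s)) t = LimInf_left (fun s => Rabs (v s)) t).
  { intros u v E t. apply Lub_Rbar_eqset. intros m. split; apply filter_imp; intros s; now rewrite E. }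
  apply Glb_Rbar_eqset. intros t. split; intros [Ht [HtT [u [Hu Hl]]]]; (split; [easy|]; split; [easy|]).
  - exists (fun s => - u s). split.
    + apply real_solution_neg in Hu. rewrite Ropp_involutive in Hu.
      destruct Hu as [H0 H]. split; [easy|]. intros s Hs. specialize (H s Hs).
      now rewrite Ropp_involutive in H.
    + rewrite <- Hl. apply (HL (fun s => - u s - xi s) (fun s => u s - - xi s)).
      intros s. rewrite <- Rabs_Ropp. f_equal. ring.
  - exists (fun s => - u s). split; [now apply real_solution_neg|].
    rewrite <- Hl. apply (HL (fun s => - u s - - xi s) (fun s => u s - xi s)).
    intros s. rewrite <- Rabs_Ropp. f_equal. ring.
Qed.

Lemma hitting_time_ext T xi eta x : Rbar_lt 0 T -> (forall s, time_interval T s -> xi s = eta s) ->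
  hitting_time T xi x = hitting_time T eta x.
Proof.
  intros HT E.
  assert (H1 : forall xi eta t, (forall s, time_interval T s -> xi s = eta s) ->
    0 < t /\ Rbar_le t T /\ (exists u, is_real_solution xi x t u /\
       LimInf_left (fun s => Rabs (u s - xi s)) t = Finite 0) ->
    0 < t /\ Rbar_le t T /\ (exists u, is_real_solution eta x t u /\
       LimInf_left (fun s => Rabs (u s - eta s)) t = Finite 0)).
  { clear. intros xi eta t E [Ht [HtT [u [[Hu0 Hu] Hl]]]]. split; [easy|]. split; [easy|].
    assert (E' : forall s, 0 <= s < t -> xi s = eta s).
    { intros s Hs. apply E. split; [lra|]. apply Rbar_le_trans with t; [simpl; lra|easy]. }
    exists u. split.
    - split; [easy|]. intros s Hs. rewrite <- (E' s Hs). now apply Hu.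
    - rewrite <- Hl. apply Lub_Rbar_eqset. intros m.
      assert (Hloc : at_left t (fun s => xi s = eta s)).
      { exists (mkposreal t Ht). intros s Hs Hst.
        change (Rabs (s - t) < t) in Hs. rewrite Rabs_left in Hs by lra. apply E'. lra. }
      split; intros Hm; generalize (filter_and _ _ Hloc Hm); apply filter_imp; intros s [Es Hs];
        [now rewrite Es|now rewrite <- Es]. }
  unfold hitting_time. rewrite (E 0).
  - destruct (Req_EM_T x (eta 0)); [easy|]. apply Glb_Rbar_eqset. intros t. split; apply H1; auto.
    intros s Hs. symmetry. now apply E.
  - split; [lra|]. now apply Rbar_lt_le.
Qed.

(** * From the simple curve to the survival statements *)

Definition clamp (T : Rbar) (s : R) : R :=
  Rmax 0 (match T with Finite T' => Rmin s T' | _ => s end).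

Lemma clamp_in T s : Rbar_lt 0 T -> time_interval T (clamp T s).
Proof.
  intros HT. split; [apply Rmax_l|]. unfold clamp. destruct T as [T| |]; simpl in *; try easy.
  apply Rmax_lub; [lra|apply Rmin_r].
Qed.

Lemma clamp_id T s : time_interval T s -> clamp T s = s.
Proof.
  intros [H0 HT]. unfold clamp. destruct T as [T| |]; simpl in HT.
  - rewrite Rmin_left by easy. now apply Rmax_right.
  - now apply Rmax_right.
  - easy.
Qed.

Lemma clamp_lip T s s' : Rabs (clamp T s' - clamp T s) <= Rabs (s' - s).
Proof.
  unfold clamp. rewrite (Rmax_comm 0), (Rmax_comm 0). eapply Rle_trans; [apply Rmax_lip|].
  destruct T as [T| |]; try apply Rle_refl.
  unfold Rmin. destruct (Rle_dec s' T), (Rle_dec s T); unfold Rabs; repeat destruct Rcase_abs; lra.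
Qed.

Lemma clamp_continuous {U : UniformSpace} T (f : R -> U) : Rbar_lt 0 T ->
  continuous_on (time_interval T) f -> forall s, continuous (fun s => f (clamp T s)) s.
Proof.
  intros HT Hf s. eapply filterlim_comp; [|exact (Hf (clamp T s) (clamp_in T s HT))].
  intros P [e HP]. exists e. intros y Hy. apply HP; [|now apply clamp_in].
  change (Rabs (clamp T y - clamp T s) < e). change (Rabs (y - s) < e) in Hy.
  generalize (clamp_lip T s y). lra.
Qed.

Lemma driver_continuous_on T xi : simple_curve_driver T xi -> continuous_on (time_interval T) xi.
Proof.
  destruct T as [T| |]; simpl; [intros [H _]; exact H| |easy].
  intros H x [Hx _]. destruct (H (x + 1) ltac:(lra)) as [Hd _].
  assert (Hx1 : time_interval (x + 1) x) by (split; [easy|simpl; lra]).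
  intros P HP. destruct (Hd x Hx1 P HP) as [e He].
  assert (He1 : 0 < Rmin e 1) by (apply Rmin_glb_lt; [apply cond_pos|lra]).
  exists (mkposreal _ He1). intros y Hy [Hy0 _].
  change (Rabs (y - x) < Rmin e 1) in Hy.
  generalize (Rmin_l e 1) (Rmin_r e 1) (Rle_abs (y - x)). intros.
  apply He; [change (Rabs (y - x) < e); lra|]. split; [easy|simpl; lra].
Qed.

Lemma derive_within_components (D : R -> Prop) (f : R -> C) (s : R) (l : C) :
  is_derive_within (V := C_R_NormedModule) D f s l ->
  is_derive_within (V := R_NormedModule) D (fun r => fst (f r)) s (fst l) /\
  is_derive_within (V := R_NormedModule) D (fun r => snd (f r)) s (snd l).
Proof.
  intros H. split.
  - exact (filterdiff_comp (V := C_R_NormedModule) (W := R_NormedModule) f (fun z : C => fst z) _ _ H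
      (filterdiff_linear _ (is_linear_fst (U := R_NormedModule) (V := R_NormedModule)))).
  - exact (filterdiff_comp (V := C_R_NormedModule) (W := R_NormedModule) f (fun z : C => snd z) _ _ H
      (filterdiff_linear _ (is_linear_snd (U := R_NormedModule) (V := R_NormedModule)))).
Qed.

Lemma loewner_flow_hsol (T : R) xi eta h z : 0 < T ->
  (forall s, time_interval T s -> xi s = eta s) ->
  is_loewner_flow T xi h -> upper_half_plane z ->
  exists f, hsol eta 0 T f /\ forall s, 0 <= s <= T -> f s = h s z.
Proof.
  intros HT E Hh Hz. destruct (Hh z Hz) as [_ Hd].
  set (F := fun s => vf (h s z - RtoC (xi s))%C).
  set (f := fun s => (affine_ext 0 T (fun s => fst (h s z)) (fun s => fst (F s)) s,
                      affine_ext 0 T (fun s => snd (h s z)) (fun s => snd (F s)) s) : C).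
  assert (Ef : forall s, 0 <= s <= T -> f s = h s z).
  { intros s Hs. unfold f. rewrite !affine_ext_in by easy. now destruct (h s z). }
  assert (Hw : forall s, 0 <= s <= T ->
     is_derive_within (V := R_NormedModule) (fun r => 0 <= r <= T) (fun s => fst (h s z)) s (fst (F s)) /\
     is_derive_within (V := R_NormedModule) (fun r => 0 <= r <= T) (fun s => snd (h s z)) s (snd (F s))).
  { intros s Hs. destruct (Hd s Hs) as [_ Hds]. now apply derive_within_components in Hds. }
  exists f. split; [|easy]. intros s Hs. rewrite (Ef s Hs).
  split; [now apply Hd|]. rewrite <- (E s) by easy. split.
  - apply (affine_ext_derive 0 T (fun s => fst (h s z)) (fun s => fst (F s))); [|easy].
    intros r Hr. now apply Hw.
  - apply (affine_ext_derive 0 T (fun s => snd (h s z)) (fun s => snd (F s))); [|easy].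
    intros r Hr. now apply Hw.
Qed.

Lemma simple_curve_slit (T : R) xi eta : 0 < T -> (forall s, time_interval T s -> xi s = eta s) ->
  generates_simple_curve T xi -> exists gamma, slit_curve eta T gamma.
Proof.
  intros HT E [h [gamma [Hh [Hgc [Hinj [_ [Hgp [_ [_ Honto]]]]]]]]].
  assert (Hcl : forall r, 0 <= r <= T -> clamp T r = r) by (intros r Hr; now apply clamp_id).
  exists (fun r => gamma (clamp T r)). split; [|split; [|split]].
  - intros r eps Heps. assert (Heps2 : 0 < eps / 2) by lra.
    destruct (proj1 (filterlim_locally _ _) (clamp_continuous (U := C_UniformSpace) T gamma HT Hgc r) (mkposreal _ Heps2)) as [e He].
    exists e. split; [apply cond_pos|]. intros r' Hr'. destruct (He r' Hr') as [H1 H2].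
    eapply Rle_lt_trans; [apply Cmod_le_sum|].
    change (Rabs (fst (gamma (clamp T r')) - fst (gamma (clamp T r))) < eps / 2) in H1.
    change (Rabs (snd (gamma (clamp T r')) - snd (gamma (clamp T r))) < eps / 2) in H2.
    simpl. unfold Rminus in *. lra.
  - intros r r' Hr Hr' Eg. rewrite !Hcl in Eg by easy. now apply Hinj.
  - intros r Hr. rewrite Hcl by lra. now apply Hgp.
  - intros w Hw.
    assert (Hon : (exists r, 0 < r <= T /\ gamma (clamp T r) = w) <-> (exists r, 0 < r <= T /\ gamma r = w)).
    { split; intros [r [Hr Er]]; exists r; (split; [easy|]).
      - now rewrite Hcl in Er by lra.
      - now rewrite Hcl by lra. }
    rewrite Hon. split.
    + intros [g [Hg Eg]].
      assert (Hz : upper_half_plane (g 0)) by (apply Hg; lra).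
      destruct (loewner_flow_hsol T xi eta h (g 0) HT E Hh Hz) as [f [Hf Ef]].
      destruct (Hh (g 0) Hz) as [H0 _].
      assert (EfT : f T = g T).
      { apply (hsol_unique eta 0 T f g 0); auto; try lra. rewrite Ef by lra. exact H0. }
      destruct (proj2 (Honto w)) as [_ Hoff]; [|exact Hoff].
      exists (g 0). split; [easy|]. rewrite <- Eg, <- EfT. symmetry. apply Ef. lra.
    + intros Hoff. destruct (proj1 (Honto w) (conj Hw Hoff)) as [z [Hz Ez]].
      destruct (loewner_flow_hsol T xi eta h z HT E Hh Hz) as [f [Hf Ef]].
      exists f. split; [easy|]. rewrite Ef by lra. exact Ez.
Qed.

(** The sign [e = 1] or [e = -1] selects the right or the left side of the
    driver. *)
Definition sided (e : R) (xi : R -> R) (s : R) : R := e * xi s.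

Definition backward_complete (T : Rbar) (xi : R -> R) : Prop :=
  forall e ts p, e = 1 \/ e = -1 -> 0 < ts -> Rbar_le ts T -> 0 < e * (p - xi ts) ->
  exists u, rsol (sided e xi) 0 ts u /\ u ts = e * p.

Lemma simple_curve_backward_complete T xi eta : Rbar_lt 0 T ->
  (forall s, continuous eta s) -> (forall s, time_interval T s -> xi s = eta s) ->
  simple_curve_driver T xi -> backward_complete T eta.
Proof.
  intros HT Heta E Hxi e ts p He Hts HtsT Hp.
  assert (H : exists T', ts <= T' /\ 0 < T' /\ (forall s, time_interval T' s -> xi s = eta s) /\ simple_curve_driver_fin T' xi).
  { destruct T as [T| |]; simpl in *; [|exists ts|easy].
    - now exists T.
    - split; [lra|]. split; [easy|]. split; [|auto]. intros s [Hs _]. now apply E. }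
  destruct H as [T' [H1 [H2 [H3 [_ Hg]]]]].
  destruct (simple_curve_slit T' xi eta H2 H3 Hg) as [gamma Hslit].
  apply (backward_survival eta T' gamma e ts p); auto.
Qed.

(** * Swallowing times *)

(** [swallowed xi t x] means that [x] has met the driver by time [t].  On the
    side on which [x] does not lie survival fails trivially, so that asking for
    failure on both sides spares a case distinction. *)
Definition swallowed (xi : R -> R) (t x : R) : Prop :=
  forall e, e = 1 \/ e = -1 -> ~ aliveR (sided e xi) (e * x) t.

Section Swallowed.

Variable xi : R -> R.
Hypothesis Hxi : forall s, continuous xi s.

Lemma sided_continuous e s : continuous (sided e xi) s.
Proof. apply (continuous_scal_r (V := R_NormedModule) e xi), Hxi. Qed.

Lemma sided_start e x t : 0 <= t -> aliveR (sided e xi) (e * x) t -> 0 < e * (x - xi 0).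
Proof. intros Ht H. apply aliveR_start in H; [|easy]. unfold sided in H. lra. Qed.

Lemma swallowed_incr t t' x : t <= t' -> swallowed xi t x -> swallowed xi t' x.
Proof. intros Ht H e He Ha. apply (H e He). now apply aliveR_sub with t'. Qed.

Lemma swallowed_center t : 0 <= t -> swallowed xi t (xi 0).
Proof. intros Ht e _ H. apply sided_start in H; [|easy]. rewrite Rminus_diag in H. lra. Qed.

Lemma swallowed_between t x y z : 0 <= t -> x <= y <= z ->
  swallowed xi t x -> swallowed xi t z -> swallowed xi t y.
Proof.
  intros Ht Hy Hx Hz e He Ha.
  destruct He as [->| ->]; [apply (Hz 1)|apply (Hx (-1))]; auto;
    apply (aliveR_mono _ _ _ t (sided_continuous _) Ht) with (2 := Ha); lra.
Qed.

Lemma hitting_time_sided T e x : Rbar_lt 0 T -> e = 1 \/ e = -1 ->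
  hitting_time T (sided e xi) (e * x) = hitting_time T xi x.
Proof.
  intros HT [->| ->].
  - rewrite Rmult_1_l. apply hitting_time_ext; [easy|]. intros s _. unfold sided. ring.
  - rewrite <- (hitting_time_neg T xi x). replace (-1 * x) with (- x) by ring.
    apply hitting_time_ext; [easy|]. intros s _. unfold sided. ring.
Qed.

Lemma side_cases x : x <> xi 0 -> exists e, (e = 1 \/ e = -1) /\ 0 < e * (x - xi 0).
Proof.
  intros Hx. destruct (Rlt_le_dec (xi 0) x); [exists 1|exists (-1)]; (split; [tauto|lra]).
Qed.

Lemma hitting_time_le T x t : Rbar_lt 0 T -> time_interval T t ->
  Rbar_le (hitting_time T xi x) t <-> swallowed xi t x.
Proof.
  intros HT [Ht HtT]. destruct (Req_dec x (xi 0)) as [->|Hne].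
  - unfold hitting_time. destruct (Req_EM_T (xi 0) (xi 0)); [|easy]. simpl.
    split; [intros _; now apply swallowed_center|easy].
  - destruct (side_cases x Hne) as [e [He Hside]].
    assert (Hsw : swallowed xi t x <-> ~ aliveR (sided e xi) (e * x) t).
    { split; [intros H; now apply H|]. intros H e' He' Ha.
      assert (Hs := sided_start e' x t Ht Ha).
      replace e' with e in Ha; [easy|]. destruct He as [->| ->], He' as [->| ->]; lra. }
    rewrite Hsw, <- (hitting_time_sided T e x HT He).
    destruct (hitting_time_spec T (sided e xi) (e * x)) as [[t' [-> [Ht' [_ [Hn Hal]]]]]|[-> Hal]].
    + apply sided_continuous.
    + unfold sided. lra.
    + simpl. split.
      * intros Hle Ha. apply Hn. now apply aliveR_sub with t.
      * intros Hna. destruct (Rle_lt_dec t' t); [easy|]. exfalso. apply Hna, Hal. lra.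
    + simpl. split; [easy|]. intros Hna. apply Hna, Hal. now split.
Qed.

Lemma hitting_time_range T x : Rbar_lt 0 T ->
  hitting_time T xi x = p_infty \/
  exists t, hitting_time T xi x = Finite t /\ time_interval T t.
Proof.
  intros HT. destruct (Req_dec x (xi 0)) as [->|Hne].
  - right. exists 0. split; [|split; [lra|now apply Rbar_lt_le]].
    unfold hitting_time. now destruct (Req_EM_T (xi 0) (xi 0)).
  - destruct (side_cases x Hne) as [e [He Hside]].
    rewrite <- (hitting_time_sided T e x HT He).
    destruct (hitting_time_spec T (sided e xi) (e * x)) as [[t' [-> [Ht' [HtT _]]]]|[-> _]].
    + apply sided_continuous.
    + unfold sided. lra.
    + right. exists t'. split; [easy|]. split; [lra|easy].
    + now left.
Qed.

Definition hit (T : Rbar) (x : R) : Prop := exists t, time_interval T t /\ swallowed xi t x.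

Lemma hitting_time_finite T x : Rbar_lt 0 T -> is_finite (hitting_time T xi x) <-> hit T x.
Proof.
  intros HT. split.
  - intros Hf. destruct (hitting_time_range T x HT) as [E|[t [E Ht]]].
    + now rewrite E in Hf.
    + exists t. split; [easy|]. apply (hitting_time_le T); auto. rewrite E. simpl. lra.
  - intros [t [Ht Hs]]. apply (hitting_time_le T x t HT Ht) in Hs.
    destruct (hitting_time_range T x HT) as [E|[t' [E _]]]; rewrite E in *; easy.
Qed.

Lemma hit_real T x : Rbar_lt 0 T -> hit T x ->
  hitting_time T xi x = Finite (real (hitting_time T xi x)) /\
  time_interval T (real (hitting_time T xi x)) /\
  swallowed xi (real (hitting_time T xi x)) x.
Proof.
  intros HT Hx. apply (hitting_time_finite T x HT) in Hx.
  destruct (hitting_time_range T x HT) as [E|[t [E Ht]]].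
  - now rewrite E in Hx.
  - rewrite E. simpl. split; [easy|]. split; [easy|].
    apply (hitting_time_le T); auto. rewrite E. simpl. lra.
Qed.

Lemma hitting_time_real_le T x t : Rbar_lt 0 T -> time_interval T t -> swallowed xi t x ->
  real (hitting_time T xi x) <= t.
Proof.
  intros HT Ht Hs. assert (Hh : hit T x) by now exists t.
  apply (hitting_time_le T) in Hs; auto. destruct (hit_real T x HT Hh) as [E _].
  rewrite E in Hs. exact Hs.
Qed.

Lemma hit_interval T : is_interval (hit T).
Proof.
  intros x y z [t [Ht Hx]] [t' [Ht' Hz]] Hy.
  assert (Hm : time_interval T (Rmax t t')).
  { unfold Rmax. destruct (Rle_dec t t'); easy. }
  exists (Rmax t t'). split; [easy|].
  apply (swallowed_between (Rmax t t') x y z); [apply Hm|easy| |].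
  - apply swallowed_incr with t; [apply Rmax_l|easy].
  - apply swallowed_incr with t'; [apply Rmax_r|easy].
Qed.

Lemma hit_center T : Rbar_lt 0 T -> hit T (xi 0).
Proof.
  intros HT. exists 0. split; [split; [lra|now apply Rbar_lt_le]|]. apply swallowed_center. lra.
Qed.

Lemma maximal_interval_hit T I : Rbar_lt 0 T ->
  maximal_interval (fun x => is_finite (hitting_time T xi x)) I -> forall x, I x <-> hit T x.
Proof.
  intros HT [_ [HI Hmax]] x. split.
  - intros Hx. apply hitting_time_finite; auto.
  - intros Hx. apply (Hmax (hit T)); auto.
    + apply hit_interval.
    + intros y Hy. now apply hitting_time_finite.
    + intros y Hy. apply hitting_time_finite; auto.
Qed.

(** ** Continuity of the hitting time *)

Variable T : Rbar.
Hypothesis HT : Rbar_lt 0 T.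
Hypothesis Hback : backward_complete T xi.

Lemma swallowed_upper_semi t0 t1 x : 0 <= t0 -> t0 < t1 -> Rbar_le t1 T -> swallowed xi t0 x ->
  exists dl, 0 < dl /\ forall x', Rabs (x' - x) < dl -> swallowed xi t1 x'.
Proof.
  intros H0 H1 HT1 Hx.
  assert (G : forall e, e = 1 \/ e = -1 -> exists y, e * x < y /\ ~ aliveR (sided e xi) y t1).
  { intros e He. apply (no_gap (sided e xi) (sided_continuous e) t0 t1 (e * x)); [lra| |now apply Hx].
    intros ts p Hts Hp.
    assert (Hee : e * e = 1) by (destruct He as [->| ->]; ring).
    destruct (Hback e ts (e * p) He) as [u [Hu Eu]].
    - lra.
    - apply Rbar_le_trans with t1; [simpl; lra|easy].
    - unfold sided in Hp. replace (e * (e * p - xi ts)) with ((e * e) * p - e * xi ts) by ring.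
      rewrite Hee. lra.
    - exists u. split; [easy|]. rewrite Eu, <- Rmult_assoc, Hee. ring. }
  destruct (G 1) as [y1 [Hy1 Hn1]]; [tauto|]. destruct (G (-1)) as [y2 [Hy2 Hn2]]; [tauto|].
  exists (Rmin (y1 - 1 * x) (y2 - -1 * x)). split; [apply Rmin_glb_lt; lra|].
  intros x' Hx'. generalize (Rmin_l (y1 - 1 * x) (y2 - -1 * x)) (Rmin_r (y1 - 1 * x) (y2 - -1 * x)).
  intros M1 M2. apply Rabs_def2 in Hx'.
  intros e [->| ->] Ha; [apply Hn1|apply Hn2];
    apply (aliveR_mono _ _ _ t1 (sided_continuous _) ltac:(lra)) with (2 := Ha); lra.
Qed.

Lemma swallowed_lower_semi t x : 0 <= t -> ~ swallowed xi t x ->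
  exists dl, 0 < dl /\ forall x', Rabs (x' - x) < dl -> ~ swallowed xi t x'.
Proof.
  intros Ht Hx. apply not_all_ex_not in Hx. destruct Hx as [e Hx].
  apply imply_to_and in Hx. destruct Hx as [He Hx]. apply NNPP in Hx.
  destruct (aliveR_open (sided e xi) (sided_continuous e) (e * x) t Ht Hx) as [dl [Hdl H]].
  exists dl. split; [easy|]. intros x' Hx' Hs. apply (Hs e He), H.
  rewrite <- Rmult_minus_distr_l, Rabs_mult.
  replace (Rabs e) with 1; [lra|]. destruct He as [->| ->]; [now rewrite Rabs_R1|].
  rewrite Rabs_left; lra.
Qed.

Lemma hitting_time_continuous c x d : c < x < d -> hit T c -> hit T d ->
  continuous (fun x => real (hitting_time T xi x)) x.
Proof.
  intros Hx Hc Hd.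
  assert (Hin : forall y, c <= y <= d -> hit T y) by (intros y Hy; now apply (hit_interval T c y d)).
  set (f := fun x => real (hitting_time T xi x)).
  destruct (hit_real T x HT (Hin x ltac:(lra))) as [Ex [[H0 HTx] Hsw]]. fold (f x) in *.
  apply filterlim_locally. intros eps. assert (Heps := cond_pos eps).
  assert (Hup : exists dl, 0 < dl /\ forall y, c <= y <= d -> Rabs (y - x) < dl -> f y <= f x + eps / 2).
  { destruct (Rbar_le_lt_dec (f x + eps / 2) T) as [Hle|Hlt].
    - destruct (swallowed_upper_semi (f x) (f x + eps / 2) x H0 ltac:(lra) Hle Hsw) as [dl [Hdl H]].
      exists dl. split; [easy|]. intros y Hy Hyx. apply hitting_time_real_le; auto.
      split; [lra|easy].
    - exists 1. split; [lra|]. intros y Hy _.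
      destruct (hit_real T y HT (Hin y Hy)) as [_ [[_ HTy] _]]. fold (f y) in HTy.
      assert (H := Rbar_le_lt_trans _ _ _ HTy Hlt). simpl in H. lra. }
  assert (Hlow : exists dl, 0 < dl /\ forall y, c <= y <= d -> Rabs (y - x) < dl -> f x - eps / 2 <= f y).
  { destruct (Rle_lt_dec 0 (f x - eps / 2)) as [Hge|Hneg].
    - destruct (swallowed_lower_semi (f x - eps / 2) x Hge) as [dl [Hdl H]].
      + intros Hs. apply (hitting_time_le T x (f x - eps / 2) HT) in Hs.
        * rewrite Ex in Hs. simpl in Hs. lra.
        * split; [easy|]. apply Rbar_le_trans with (f x); [simpl; lra|easy].
      + exists dl. split; [easy|]. intros y Hy Hyx.
        destruct (hit_real T y HT (Hin y Hy)) as [_ [_ Hsy]]. fold (f y) in Hsy.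
        destruct (Rle_lt_dec (f x - eps / 2) (f y)); [easy|]. exfalso. apply (H y Hyx).
        apply swallowed_incr with (f y); [lra|easy].
    - exists 1. split; [lra|]. intros y Hy _.
      destruct (hit_real T y HT (Hin y Hy)) as [_ [[H1 _] _]]. fold (f y) in H1. lra. }
  destruct Hup as [d1 [Hd1 Hup]]. destruct Hlow as [d2 [Hd2 Hlow]].
  assert (Hdl : 0 < Rmin (Rmin d1 d2) (Rmin (x - c) (d - x))) by (repeat apply Rmin_glb_lt; lra).
  exists (mkposreal _ Hdl). intros y Hy.
  change (Rabs (y - x) < Rmin (Rmin d1 d2) (Rmin (x - c) (d - x))) in Hy.
  generalize (Rmin_l (Rmin d1 d2) (Rmin (x - c) (d - x))) (Rmin_r (Rmin d1 d2) (Rmin (x - c) (d - x)))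
    (Rmin_l d1 d2) (Rmin_r d1 d2) (Rmin_l (x - c) (d - x)) (Rmin_r (x - c) (d - x)). intros.
  assert (Hyx := Hy). apply Rabs_def2 in Hyx.
  change (Rabs (f y - f x) < eps).
  generalize (Hup y ltac:(lra) ltac:(lra)) (Hlow y ltac:(lra) ltac:(lra)). intros.
  apply Rabs_def1; lra.
Qed.

End Swallowed.

(** * Comparison of two drivers *)

Section TwoDrivers.

Variables (xi eta : R -> R) (r0 r : R).
Hypothesis Hxi : forall s, continuous xi s.
Hypothesis Heta : forall s, continuous eta s.
Hypothesis Hr : r0 < r.

Lemma aliveR_shift e x t : e = 1 \/ e = -1 -> 0 <= t ->
  (forall s, 0 <= s <= t -> Rabs (xi s - eta s) <= r0) ->
  aliveR (sided e xi) (e * x) t -> aliveR (sided e eta) (e * x + r) t.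
Proof.
  intros He Ht Hc. apply aliveR_compare with r0; auto using sided_continuous; [|lra].
  intros s Hs. assert (H := Hc s Hs). apply Rabs_le_between in H.
  unfold sided. destruct He as [->| ->]; lra.
Qed.

(** The conclusion needs both neighbours, since [x] may be on different sides
    of the two drivers. *)
Lemma swallowed_shift x t : 0 <= t ->
  (forall s, 0 <= s <= t -> Rabs (xi s - eta s) <= r0) ->
  swallowed eta t (x + r) -> swallowed eta t (x - r) -> swallowed xi t x.
Proof.
  intros Ht Hc H1 H2 e He Ha. apply aliveR_shift in Ha; auto.
  destruct He as [->| ->].
  - apply (H1 1); [tauto|]. now replace (1 * (x + r)) with (1 * x + r) by ring.
  - apply (H2 (-1)); [tauto|]. now replace (-1 * (x - r)) with (-1 * x + r) by ring.
Qed.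

(** The endpoints of the set of hit points move by at most [r]; [eta 0] serves
    when the shifted point falls on the other side of the driver. *)
Lemma hit_shift T e x : Rbar_lt 0 T -> e = 1 \/ e = -1 ->
  (forall s, time_interval T s -> Rabs (xi s - eta s) <= r0) ->
  hit xi T x -> exists x', hit eta T x' /\ e * x - r <= e * x'.
Proof.
  intros HT He Hc [t [[Ht HtT] Hs]].
  assert (Hee : e * e = 1) by (destruct He as [->| ->]; ring).
  set (y := x - e * r). assert (Ey : e * y = e * x - r).
  { unfold y. replace (e * (x - e * r)) with (e * x - (e * e) * r) by ring. rewrite Hee. ring. }
  destruct (Rle_lt_dec (e * eta 0) (e * y)) as [Hge|Hlt].
  - exists y. split; [|lra]. exists t. split; [now split|].
    intros e' He' Ha. assert (Hst := sided_start eta e' y t Ht Ha).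
    assert (E : e' = e) by (destruct He as [->| ->], He' as [->| ->]; lra). subst e'.
    apply (Hs e He).
    assert (Ha2 : aliveR (sided e xi) (e * y + r) t).
    { apply (aliveR_compare (sided e eta) (sided e xi) r0 (e * y)); auto using sided_continuous; [|lra].
      intros s Hss.
      assert (H := Hc s). assert (Hts : time_interval T s).
      { split; [lra|]. apply Rbar_le_trans with t; [simpl; lra|easy]. }
      specialize (H Hts). apply Rabs_le_between in H. unfold sided. destruct He as [->| ->]; lra. }
    now replace (e * x) with (e * y + r) by lra.
  - exists (eta 0). split; [now apply hit_center|]. lra.
Qed.

End TwoDrivers.

Lemma is_lim_lub (F : R -> Prop) (F_ : nat -> R -> Prop) (b : Rbar) (b_ : nat -> Rbar) :
  (exists x, F x) -> is_lub_Rbar F b -> (forall n, is_lub_Rbar (F_ n) (b_ n)) ->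
  (forall r, 0 < r -> eventually (fun n =>
     (forall x, F x -> exists x', F_ n x' /\ x - r <= x') /\
     (forall x, F_ n x -> exists x', F x' /\ x - r <= x'))) ->
  is_lim_Rbar_seq b_ b.
Proof.
  intros [x0 Hx0] [Hub Hlub] Hb_ Hev.
  assert (Hex : forall m : R, Rbar_lt m b -> exists x, F x /\ m < x).
  { intros m Hm. apply NNPP. intros Hn. apply (Rbar_lt_not_le _ _ Hm), Hlub.
    intros x Hx. simpl. destruct (Rle_lt_dec x m); [easy|]. exfalso. apply Hn. now exists x. }
  destruct b as [b| |]; cbn [is_lim_Rbar_seq].
  - intros eps. assert (Heps := cond_pos eps).
    destruct (Hev (eps / 4) ltac:(lra)) as [N HN]. exists N. intros n Hn.
    destruct (HN n Hn) as [H1 H2]. destruct (Hb_ n) as [Hubn Hlubn]. split.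
    + destruct (Hex (b - eps / 4)) as [x [Hx Hxb]]; [simpl; lra|].
      destruct (H1 x Hx) as [x' [Hx' Hxx]].
      apply Rbar_lt_le_trans with (Finite x'); [simpl; lra|]. now apply Hubn.
    + apply Rbar_le_lt_trans with (Finite (b + eps / 4)); [|simpl; lra].
      apply Hlubn. intros x Hx. destruct (H2 x Hx) as [x' [Hx' Hxx]].
      generalize (Hub x' Hx'). simpl. lra.
  - intros M. destruct (Hev 1 Rlt_0_1) as [N HN]. exists N. intros n Hn.
    destruct (HN n Hn) as [H1 _]. destruct (Hb_ n) as [Hubn _].
    destruct (Hex (M + 1)) as [x [Hx HxM]]; [easy|].
    destruct (H1 x Hx) as [x' [Hx' Hxx]].
    apply Rbar_lt_le_trans with (Finite x'); [simpl; lra|]. now apply Hubn.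
  - now apply Hub in Hx0.
Qed.

Lemma is_lim_Rbar_seq_opp (u : nat -> Rbar) (l : Rbar) :
  is_lim_Rbar_seq (fun n => Rbar_opp (u n)) (Rbar_opp l) -> is_lim_Rbar_seq u l.
Proof.
  destruct l as [l| |]; simpl; intros H.
  - intros eps. destruct (H eps) as [N HN]. exists N. intros n Hn.
    destruct (HN n Hn) as [H1 H2]. destruct (u n) as [x| |]; simpl in *; try easy. lra.
  - intros M. destruct (H (- M)) as [N HN]. exists N. intros n Hn.
    specialize (HN n Hn). destruct (u n) as [x| |]; simpl in *; try easy. lra.
  - intros M. destruct (H (- M)) as [N HN]. exists N. intros n Hn.
    specialize (HN n Hn). destruct (u n) as [x| |]; simpl in *; try easy. lra.
Qed.

Theorem theorem3p4 (T : Rbar) (HT : Rbar_lt 0 T)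
  (xi : R -> R) (xi_ : nat -> R -> R)
  (Hxi : simple_curve_driver T xi)
  (Hxi_ : forall n : nat, simple_curve_driver T (xi_ n))
  (a b : Rbar) (a_ b_ : nat -> Rbar)
  (Hlt : Rbar_lt a b) (Hlt_ : forall n : nat, Rbar_lt (a_ n) (b_ n))
  (Hab : finite_hitting_endpoints T xi a b)
  (Hab_ : forall n : nat, finite_hitting_endpoints T (xi_ n) (a_ n) (b_ n))
  (Hconv : converges_uniformly_on (time_interval T) xi_ xi) :
  is_lim_Rbar_seq a_ a /\
  is_lim_Rbar_seq b_ b /\
  forall c d : R, c <= d -> Rbar_lt a c -> Rbar_lt d b ->
    converges_uniformly_finite_on (fun x => c <= x <= d)
      (fun n => hitting_time T (xi_ n)) (hitting_time T xi).
Proof.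
  (* constant continuation makes the drivers continuous on the whole line, and
     hitting times only see the time interval *)
  set (eta := fun s => xi (clamp T s)). set (eta_ := fun n s => xi_ n (clamp T s)).
  assert (Ceta : forall s, continuous eta s).
  { apply (clamp_continuous T xi HT). now apply driver_continuous_on. }
  assert (Ceta_ : forall n s, continuous (eta_ n) s).
  { intros n. apply (clamp_continuous T (xi_ n) HT). now apply driver_continuous_on. }
  assert (E : forall s, time_interval T s -> xi s = eta s) by (intros s Hs; unfold eta; now rewrite clamp_id).
  assert (E_ : forall n s, time_interval T s -> xi_ n s = eta_ n s) by (intros n s Hs; unfold eta_; now rewrite clamp_id).
  assert (Eh : forall x, hitting_time T xi x = hitting_time T eta x) by (intros x; now apply hitting_time_ext).
  assert (Eh_ : forall n x, hitting_time T (xi_ n) x = hitting_time T (eta_ n) x) by (intros n x; apply hitting_time_ext; [easy|apply E_]).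
  assert (Hback := simple_curve_backward_complete T xi eta HT Ceta E Hxi).
  assert (Hc : forall r, 0 < r -> eventually (fun n => forall s, time_interval T s -> Rabs (eta_ n s - eta s) <= r)).
  { intros r Hr. destruct (Hconv (mkposreal r Hr)) as [N HN]. exists N. intros n Hn s Hs.
    rewrite <- E, <- E_ by easy. left. now apply HN. }
  assert (Hends : forall zeta (rho : R -> R) al be, (forall s, continuous zeta s) ->
     (forall x, hitting_time T rho x = hitting_time T zeta x) ->
     finite_hitting_endpoints T rho al be -> is_glb_Rbar (hit zeta T) al /\ is_lub_Rbar (hit zeta T) be).
  { intros zeta rho al be Hz Ez [I [[HI1 [HI2 HI3]] [Hg Hl]]].
    assert (HI : forall x, I x <-> hit zeta T x).
    { apply (maximal_interval_hit zeta Hz T I HT). split; [easy|]. split.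
      - intros x Hx. rewrite <- Ez. now apply HI2.
      - intros J HJ HJf. apply HI3; auto. intros x Hx. rewrite Ez. now apply HJf. }
    split; [apply (is_glb_Rbar_eqset I)|apply (is_lub_Rbar_eqset I)]; try easy; intros x; symmetry; apply HI. }
  destruct (Hends eta xi a b Ceta Eh Hab) as [Ha Hb].
  assert (Hends_ := fun n => Hends (eta_ n) (xi_ n) (a_ n) (b_ n) (Ceta_ n) (Eh_ n) (Hab_ n)).
  assert (Hsym : forall e, e = 1 \/ e = -1 -> forall r, 0 < r -> eventually (fun n =>
     (forall x, hit eta T x -> exists x', hit (eta_ n) T x' /\ e * x - r <= e * x') /\
     (forall x, hit (eta_ n) T x -> exists x', hit eta T x' /\ e * x - r <= e * x'))).
  { intros e He r Hr. destruct (Hc (r / 2) ltac:(lra)) as [N HN]. exists N. intros n Hn. split.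
    - intros x Hx. apply (hit_shift eta (eta_ n) (r / 2) r); auto; try lra.
      intros s Hs. rewrite Rabs_minus_sym. now apply HN.
    - intros x Hx. apply (hit_shift (eta_ n) eta (r / 2) r); auto; lra. }
  split; [|split].
  - apply is_lim_Rbar_seq_opp.
    apply (is_lim_lub (fun x => hit eta T (- x)) (fun n x => hit (eta_ n) T (- x))).
    + exists (- eta 0). rewrite Ropp_involutive. now apply hit_center.
    + now apply (is_lub_Rbar_opp (hit eta T)).
    + intros n. apply (is_lub_Rbar_opp (hit (eta_ n) T)), Hends_.
    + intros r Hr. destruct (Hsym (-1) ltac:(tauto) r Hr) as [N HN]. exists N. intros n Hn.
      destruct (HN n Hn) as [H1 H2]. split; intros x Hx.
      * destruct (H1 _ Hx) as [x' [Hx' Hxx]]. exists (- x'). rewrite Ropp_involutive. split; [easy|lra].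
      * destruct (H2 _ Hx) as [x' [Hx' Hxx]]. exists (- x'). rewrite Ropp_involutive. split; [easy|lra].
  - apply (is_lim_lub (hit eta T) (fun n => hit (eta_ n) T)); auto.
    + exists (eta 0). now apply hit_center.
    + intros n. apply Hends_.
    + intros r Hr. destruct (Hsym 1 ltac:(tauto) r Hr) as [N HN]. exists N. intros n Hn.
      destruct (HN n Hn) as [H1 H2]. split; intros x Hx.
      * destruct (H1 _ Hx) as [x' [Hx' Hxx]]. exists x'. split; [easy|lra].
      * destruct (H2 _ Hx) as [x' [Hx' Hxx]]. exists x'. split; [easy|lra].
  - intros c d Hcd Hac Hdb.
    assert (Hc' : exists c', hit eta T c' /\ c' < c).
    { apply NNPP. intros Hn. apply (Rbar_lt_not_le _ _ Hac). apply Ha. intros x Hx. simpl.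
      destruct (Rle_lt_dec c x); [easy|]. exfalso. apply Hn. now exists x. }
    assert (Hd' : exists d', hit eta T d' /\ d < d').
    { apply NNPP. intros Hn. apply (Rbar_lt_not_le _ _ Hdb). apply Hb. intros x Hx. simpl.
      destruct (Rle_lt_dec x d); [easy|]. exfalso. apply Hn. now exists x. }
    destruct Hc' as [c' [Hc' Hcc]]. destruct Hd' as [d' [Hd' Hdd]].
    assert (Hin : forall y, c' <= y <= d' -> hit eta T y).
    { intros y Hy. now apply (hit_interval eta Ceta T c' y d'). }
    set (f := fun x => real (hitting_time T eta x)).
    split.
    { intros x Hx. rewrite Eh. apply hitting_time_finite; auto. apply Hin. lra. }
    intros eps. assert (Heps := cond_pos eps).
    set (c1 := (c' + c) / 2). set (d1 := (d + d') / 2).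
    assert (Hc1 : c' < c1 < c) by (unfold c1; lra). assert (Hd1 : d < d1 < d') by (unfold d1; lra).
    clearbody c1 d1.
    assert (Heps2 : 0 < eps / 2) by lra.
    destruct (unifcont_1d f c1 d1) with (eps := mkposreal _ Heps2) as [dl Hdl].
    { intros x Hx. apply (hitting_time_continuous eta Ceta T HT Hback c' x d'); auto. lra. }
    assert (Huc : forall x y, c1 <= x <= d1 -> c1 <= y <= d1 -> Rabs (y - x) < dl -> Rabs (f y - f x) < eps / 2).
    { intros x y Hx Hy Hxy. exact (NNPP _ (Hdl x y Hx Hy Hxy)). }
    assert (Hdlp := cond_pos dl).
    set (r := Rmin (dl / 2) (Rmin (c - c1) (d1 - d))).
    assert (Hr : 0 < r /\ r < dl /\ r <= c - c1 /\ r <= d1 - d).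
    { generalize (Rmin_l (dl / 2) (Rmin (c - c1) (d1 - d))) (Rmin_r (dl / 2) (Rmin (c - c1) (d1 - d)))
        (Rmin_l (c - c1) (d1 - d)) (Rmin_r (c - c1) (d1 - d)). fold r.
      assert (0 < r) by (unfold r; repeat apply Rmin_glb_lt; lra). lra. }
    clearbody r. destruct Hr as [Hr0 [Hrdl [Hrc Hrd]]].
    destruct (Hc (r / 2) ltac:(lra)) as [N HN]. exists N. intros n Hn x Hx.
    rewrite Eh, Eh_. fold (f x).
    assert (Hclose : forall y, c1 <= y <= d1 -> Rabs (y - x) <= r -> f x - eps / 2 < f y < f x + eps / 2).
    { intros y Hy Hyx. assert (H := Huc x y ltac:(lra) Hy ltac:(lra)). apply Rabs_def2 in H. lra. }
    assert (Hp := Hclose (x + r) ltac:(lra) ltac:(rewrite Rabs_right; lra)).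
    assert (Hm := Hclose (x - r) ltac:(lra) ltac:(rewrite Rabs_left; lra)).
    assert (Hle_T : forall t, time_interval T t -> forall s, 0 <= s <= t -> time_interval T s).
    { intros t [_ HtT] s Hs. split; [lra|]. apply Rbar_le_trans with t; [simpl; lra|easy]. }
    destruct (hit_real eta Ceta T (x + r) HT (Hin (x + r) ltac:(lra))) as [_ [Tp Sp]].
    destruct (hit_real eta Ceta T (x - r) HT (Hin (x - r) ltac:(lra))) as [_ [Tm Sm]].
    fold (f (x + r)) in Tp, Sp. fold (f (x - r)) in Tm, Sm.
    set (t1 := Rmax (f (x + r)) (f (x - r))).
    assert (Ht1 : time_interval T t1) by (unfold t1, Rmax; now destruct (Rle_dec (f (x + r)) (f (x - r)))).
    assert (Ht1f : t1 < f x + eps / 2) by (unfold t1; apply Rmax_lub_lt; lra).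
    assert (Hsw : swallowed (eta_ n) t1 x).
    { apply (swallowed_shift (eta_ n) eta (r / 2) r); auto; [lra|apply Ht1| | |].
      - intros s Hs. apply HN; [easy|]. now apply Hle_T with t1.
      - apply swallowed_incr with (f (x + r)); [apply Rmax_l|easy].
      - apply swallowed_incr with (f (x - r)); [apply Rmax_r|easy]. }
    assert (Hhit : hit (eta_ n) T x) by now exists t1.
    split; [now apply hitting_time_finite|].
    assert (Hup := hitting_time_real_le (eta_ n) (Ceta_ n) T x t1 HT Ht1 Hsw).
    destruct (hit_real (eta_ n) (Ceta_ n) T x HT Hhit) as [_ [Tn Sn]].
    set (tn := real (hitting_time T (eta_ n) x)) in *.
    assert (Hlow : f x - eps / 2 < tn); [|apply Rabs_def1; lra].
    assert (Hside : forall e, e = 1 \/ e = -1 -> ~ aliveR (sided e eta) (e * (x - e * r)) tn).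
    { intros e He Ha'. apply (Sn e He).
      apply (aliveR_shift eta (eta_ n) (r / 2) r) in Ha'; auto; [|lra|apply Tn|].
      - replace (e * (x - e * r) + r) with (e * x) in Ha'; [easy|]. destruct He as [->| ->]; ring.
      - intros s Hs. rewrite Rabs_minus_sym. apply HN; [easy|]. now apply Hle_T with tn. }
    assert (Hcase : forall e, e = 1 \/ e = -1 -> e * eta 0 <= e * (x - e * r) -> f (x - e * r) <= tn).
    { intros e He Hge. apply hitting_time_real_le; auto. intros e' He' Ha'.
      assert (Hst := sided_start eta e' _ tn (proj1 Tn) Ha').
      assert (Ee : e' = e) by (destruct He as [->| ->], He' as [->| ->]; lra). subst e'.
      now apply (Hside e He). }
    (* if [x] is within [r] of the driver, its own hitting time is small *)
    destruct (Rle_lt_dec (eta 0) (x - r)) as [H1|H1].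
    { assert (G := Hcase 1 ltac:(tauto) ltac:(lra)). replace (x - 1 * r) with (x - r) in G by ring. lra. }
    destruct (Rle_lt_dec (x + r) (eta 0)) as [H2|H2].
    { assert (G := Hcase (-1) ltac:(tauto) ltac:(lra)). replace (x - -1 * r) with (x + r) in G by ring. lra. }
    assert (G := Hclose (eta 0) ltac:(lra) ltac:(apply Rabs_le; lra)).
    assert (Z : f (eta 0) = 0).
    { unfold f, hitting_time. now destruct (Req_EM_T (eta 0) (eta 0)). }
    destruct Tn as [Tn0 _]. lra.
Qed.
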